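(* Let $B$ be a $\Bbbk$-bialgebra (or a Hopf $\Bbbk$-algebra), $\Bbbk$ a field. Then: (a) $\big(B^\vee_t\big)'\big|_{t=1}:=\big(B^\vee_t\big)'\big/(t-1)\big(B^\vee_t\big)'\;\cong\;B^\vee$ as $\Bbbk$-bialgebras (or as Hopf $\Bbbk$-algebras); (b) $\big(B'_t\big)^\vee\big|_{t=1}:=\big(B'_t\big)^\vee\big/(t-1)\big(B'_t\big)^\vee\;\cong\;B'$ as $\Bbbk$-bialgebras (or as Hopf $\Bbbk$-algebras).
   Context: Let $B$ have unit $1$, counit $\epsilon$, coproduct $\Delta$, iterated coproducts $\Delta^n$. For any bialgebra put $\delta_n:=(\mathrm{id}-u\circ\epsilon)^{\otimes n}\circ\Delta^n$ ($n\ge1$), $\delta_0:=\epsilon$, $u$ the unit map. Let $J:=\mathrm{Ker}(\epsilon)$, $D_n:=\mathrm{Ker}(\delta_{n+1})$, $B^\vee:=B/\bigcap_{n}J^n$ (a quotient bialgebra of $B$), $B':=\bigcup_nD_n$ (a Hopf algebra contained in $B$). $B^\vee_t$ is the $\Bbbk[t]$-submodule of $B^\vee[t,t^{-1}]$ generated by $\sum_{n\ge0}t^{-n}J_{B^\vee}^n$, where $J_{B^\vee}:=\mathrm{Ker}(\epsilon_{B^\vee})$; $B'_t$ is the $\Bbbk[t]$-submodule of $B[t,t^{-1}]$ generated by $\sum_{n\ge0}t^nD_n$. Both are $\Bbbk[t]$-bialgebras (Hopf algebras if $B$ is). Define $$\big(B^\vee_t\big)':=\big\{b\in B^\vee_t\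 \big|\ \delta_n(b)\in t^n\,(B^\vee_t)^{\otimes n}\ \ \forall n\in\mathbb{N}\big\},\qquad \big(B'_t\big)^\vee:=\sum_{n\ge0}t^{-n}(J')^n\subseteq\Bbbk(t)\otimes_{\Bbbk[t]}B'_t,$$ with $J':=\mathrm{Ker}(\epsilon:B'_t\to\Bbbk[t])$ and tensor powers over $\Bbbk[t]$; these are $\Bbbk[t]$-bialgebras (Hopf algebras if $B$ is). *)

(* Defs.v *)
From HB Require Import structures.
From mathcomp Require Import all_boot all_order all_algebra.
From mathcomp Require Import boolp classical_sets.

Set Implicit Arguments.
Unset Strict Implicit.
Unset Printing Implicit Defensive.

Import GRing.Theory.
Local Open Scope ring_scope.
Local Open Scope classical_set_scope.
Local Open Scope quotient_scope.

(* M ⊗_R N is the free commutative monoid on M * N (lists of pairs up to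
   permutation), modulo the relations of bilinearity.  Scalars need not be
   formal coefficients, because a (x ⊗ y) = (a x) ⊗ y. *)
Section TensorProduct.
Variables (R : comNzRingType) (M N : lmodType R).
Implicit Types (s : seq (M * N)) (x : M) (y : N) (a : R).

Inductive tens_eqv : seq (M * N) -> seq (M * N) -> Prop :=
| TensRefl s : tens_eqv s s
| TensSym s1 s2 : tens_eqv s1 s2 -> tens_eqv s2 s1
| TensTrans s1 s2 s3 : tens_eqv s1 s2 -> tens_eqv s2 s3 -> tens_eqv s1 s3
| TensCat s1 s2 s3 s4 :
    tens_eqv s1 s2 -> tens_eqv s3 s4 -> tens_eqv (s1 ++ s3) (s2 ++ s4)
| TensComm s1 s2 : tens_eqv (s1 ++ s2) (s2 ++ s1)
| TensZero y : tens_eqv [:: (0, y)] [::]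
| TensDl x1 x2 y : tens_eqv [:: (x1 + x2, y)] [:: (x1, y); (x2, y)]
| TensDr x y1 y2 : tens_eqv [:: (x, y1 + y2)] [:: (x, y1); (x, y2)]
| TensZ a x y : tens_eqv [:: (a *: x, y)] [:: (x, a *: y)].

Definition tens_rel s1 s2 := `[< tens_eqv s1 s2 >].

Lemma tens_rel_refl : reflexive tens_rel.
Proof. by move=> s; apply/asboolP; exact: TensRefl. Qed.

Lemma tens_rel_sym : symmetric tens_rel.
Proof. by move=> s t; apply/asboolP/asboolP; exact: TensSym. Qed.

Lemma tens_rel_trans : transitive tens_rel.
Proof. by move=> t s u /asboolP st /asboolP tu; apply/asboolP; exact: TensTrans tu. Qed.

Canonical tens_equiv_rel := EquivRel tens_rel tens_rel_refl tens_rel_sym tens_rel_trans.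

Definition tens := {eq_quot tens_equiv_rel}.

HB.instance Definition _ := Choice.on tens.

Definition tens_cls s : tens := \pi_({eq_quot tens_equiv_rel}) s.

Definition tens_repr (u : tens) : seq (M * N) := repr (u : {eq_quot tens_equiv_rel}).

Lemma tens_clsP s1 s2 : tens_cls s1 = tens_cls s2 <-> tens_eqv s1 s2.
Proof.
split=> [/eqP | h].
  by rewrite /tens_cls eqmodE => /asboolP.
by apply/eqP; rewrite /tens_cls eqmodE; apply/asboolP.
Qed.

Lemma tens_reprK u : tens_cls (tens_repr u) = u.
Proof. exact: (@reprK _ {eq_quot tens_equiv_rel}). Qed.

Lemma tens_repr_cls s : tens_eqv (tens_repr (tens_cls s)) s.
Proof. by apply/tens_clsP; rewrite tens_reprK. Qed.

Definition pure x y : tens := tens_cls [:: (x, y)].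

Definition sscale a s := [seq (a *: p.1, p.2) | p <- s].

Lemma sscale_eqv a s1 s2 : tens_eqv s1 s2 -> tens_eqv (sscale a s1) (sscale a s2).
Proof.
elim=> {s1 s2} [s|s1 s2 _|s1 s2 s3 _ h1 _ h2|s1 s2 s3 s4 _ h1 _ h2|s1 s2|y|x1 x2 y|x y1 y2|b x y].
- exact: TensRefl.
- exact: TensSym.
- exact: TensTrans h2.
- by rewrite /sscale !map_cat; exact: TensCat.
- by rewrite /sscale !map_cat; exact: TensComm.
- by rewrite /sscale /= scaler0; exact: TensZero.
- by rewrite /sscale /= scalerDr; exact: TensDl.
- by rewrite /sscale /=; exact: TensDr.
- by rewrite /sscale /= scalerA mulrC -scalerA; exact: TensZ.
Qed.

Definition tens_add u v := tens_cls (tens_repr u ++ tens_repr v).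
Definition tens_scale a u := tens_cls (sscale a (tens_repr u)).

Lemma tens_addE s1 s2 : tens_add (tens_cls s1) (tens_cls s2) = tens_cls (s1 ++ s2).
Proof. by apply/tens_clsP; apply: TensCat; exact: tens_repr_cls. Qed.

Lemma tens_scaleE a s : tens_scale a (tens_cls s) = tens_cls (sscale a s).
Proof. by apply/tens_clsP; apply: sscale_eqv; exact: tens_repr_cls. Qed.

Lemma tens_ind_cls (P : tens -> Prop) : (forall s, P (tens_cls s)) -> forall u, P u.
Proof. by move=> h u; rewrite -(tens_reprK u). Qed.

Lemma tens_addA : associative tens_add.
Proof.
elim/tens_ind_cls => s1; elim/tens_ind_cls => s2; elim/tens_ind_cls => s3.
by rewrite !tens_addE catA.
Qed.

Lemma tens_addC : commutative tens_add.
Proof.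
elim/tens_ind_cls => s1; elim/tens_ind_cls => s2.
by rewrite !tens_addE; apply/tens_clsP; exact: TensComm.
Qed.

Lemma tens_add0 : left_id (tens_cls [::]) tens_add.
Proof. by elim/tens_ind_cls => s; rewrite tens_addE. Qed.

Lemma sscale_cancel a b s : a + b = 0 -> tens_eqv (sscale a s ++ sscale b s) [::].
Proof.
move=> ab0; elim: s => [|[x y] s IHs]; first exact: TensRefl.
have e : tens_cls (sscale a ((x, y) :: s) ++ sscale b ((x, y) :: s)) =
         tens_add (tens_cls [:: (a *: x, y); (b *: x, y)])
                  (tens_cls (sscale a s ++ sscale b s)).
  rewrite -[sscale a (_ :: _)]/([:: (a *: x, y)] ++ sscale a s).
  rewrite -[sscale b (_ :: _)]/([:: (b *: x, y)] ++ sscale b s).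
  rewrite -[[:: (a *: x, y); (b *: x, y)]]/([:: (a *: x, y)] ++ [:: (b *: x, y)]).
  rewrite -!tens_addE -!tens_addA; congr (tens_add _ _).
  by rewrite !tens_addA; congr (tens_add _ _); exact: tens_addC.
apply/tens_clsP; rewrite e; move/tens_clsP: IHs => ->.
rewrite tens_addE cats0; apply/tens_clsP; apply: TensTrans (TensZero y).
by apply: TensSym; rewrite -(scale0r x) -ab0 scalerDl; exact: TensDl.
Qed.

Lemma sscale1 s : sscale 1 s = s.
Proof. by rewrite /sscale -[RHS]map_id; apply: eq_map => -[x y] /=; rewrite scale1r. Qed.

Lemma tens_addN : left_inverse (tens_cls [::]) (tens_scale (-1)) tens_add.
Proof.
elim/tens_ind_cls => s; rewrite tens_scaleE tens_addE; apply/tens_clsP.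
by rewrite -{2}(sscale1 s); apply: sscale_cancel; rewrite addNr.
Qed.

HB.instance Definition _ :=
  GRing.isZmodule.Build tens tens_addA tens_addC tens_add0 tens_addN.

Lemma tens_scaleA a b u : tens_scale a (tens_scale b u) = tens_scale (a * b) u.
Proof.
elim/tens_ind_cls: u => s; rewrite !tens_scaleE; congr (tens_cls _).
by rewrite /sscale -map_comp; apply: eq_map => -[x y] /=; rewrite scalerA.
Qed.

Lemma tens_scale1 : left_id 1 tens_scale.
Proof. by elim/tens_ind_cls => s; rewrite tens_scaleE sscale1. Qed.

Lemma tens_scaleDr : right_distributive tens_scale +%R.
Proof.
move=> a; elim/tens_ind_cls => s1; elim/tens_ind_cls => s2.
by rewrite -[RHS]/(tens_add _ _) -[_ + _]/(tens_add _ _)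
           !(tens_addE, tens_scaleE) /sscale map_cat.
Qed.

Lemma tens_scaleDl u : {morph tens_scale^~ u : a b / a + b}.
Proof.
move=> a b; elim/tens_ind_cls: u => s.
rewrite -[RHS]/(tens_add _ _) !tens_scaleE tens_addE.
elim: s => [|[x y] s IHs] //.
rewrite -[sscale (a + b) (_ :: _)]/([:: ((a + b) *: x, y)] ++ sscale (a + b) s).
rewrite -[sscale a (_ :: _)]/([:: (a *: x, y)] ++ sscale a s).
rewrite -[sscale b (_ :: _)]/([:: (b *: x, y)] ++ sscale b s).
rewrite -!tens_addE IHs -tens_addE.
have -> : tens_cls [:: ((a + b) *: x, y)] =
          tens_add (tens_cls [:: (a *: x, y)]) (tens_cls [:: (b *: x, y)]).
  by rewrite tens_addE; apply/tens_clsP; rewrite scalerDl; exact: TensDl.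
rewrite -!tens_addA; congr (tens_add _ _).
by rewrite !tens_addA; congr (tens_add _ _); exact: tens_addC.
Qed.

HB.instance Definition _ :=
  GRing.Zmodule_isLmodule.Build R tens tens_scaleA tens_scale1 tens_scaleDr tens_scaleDl.

(* The additive map x ⊗ y |-> g x y.  It is defined from representatives, and
   is only meaningful when g is biadditive and R-balanced, as it is in all the
   uses below. *)
Definition tens_fold (P : zmodType) (g : M -> N -> P) (u : tens) : P :=
  \sum_(p <- tens_repr u) g p.1 p.2.

Lemma tens_fold_eqv (P : zmodType) (g : M -> N -> P) s1 s2 :
    (forall x1 x2 y, g (x1 + x2) y = g x1 y + g x2 y) ->
    (forall x y1 y2, g x (y1 + y2) = g x y1 + g x y2) ->
    (forall a x y, g (a *: x) y = g x (a *: y)) ->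
  tens_eqv s1 s2 -> \sum_(p <- s1) g p.1 p.2 = \sum_(p <- s2) g p.1 p.2.
Proof.
move=> gDl gDr gZ; elim=> {s1 s2} //.
- by move=> s1 s2 s3 _ -> _ ->.
- by move=> s1 s2 s3 s4 _ h1 _ h2; rewrite !big_cat /= h1 h2.
- by move=> s1 s2; rewrite !big_cat /= addrC.
- move=> y; rewrite big_seq1 big_nil /=.
  by apply: (addrI (g 0 y)); rewrite -gDl !addr0.
- by move=> x1 x2 y; rewrite !big_cons !big_nil !addr0 /= gDl.
- by move=> x y1 y2; rewrite !big_cons !big_nil !addr0 /= gDr.
- by move=> a x y; rewrite !big_seq1 /= gZ.
Qed.

Lemma tens_fold_pure (P : zmodType) (g : M -> N -> P) x y :
    (forall x1 x2 y, g (x1 + x2) y = g x1 y + g x2 y) ->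
    (forall x y1 y2, g x (y1 + y2) = g x y1 + g x y2) ->
    (forall a x y, g (a *: x) y = g x (a *: y)) ->
  tens_fold g (pure x y) = g x y.
Proof.
move=> gDl gDr gZ.
by rewrite /tens_fold (tens_fold_eqv gDl gDr gZ (tens_repr_cls _)) big_seq1.
Qed.

End TensorProduct.

Arguments pure {R M N} x y.

(* φ ⊗ ψ; the two tensor products may be over different rings, for maps that
   are semilinear over a ring morphism. *)
Definition tens_map (R S : comNzRingType) (M N : lmodType R) (M' N' : lmodType S)
    (phi : M -> M') (psi : N -> N') : tens M N -> tens M' N' :=
  tens_fold (fun x y => pure (phi x) (psi y)).

Definition tens_assoc (R : comNzRingType) (M N P : lmodType R) :
    tens (tens M N) P -> tens M (tens N P) :=
  tens_fold (fun u z => tens_fold (fun x y => pure x (pure y z)) u).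

(* (a ⊗ b) (c ⊗ d) = ac ⊗ bd *)
Definition tens_mul (R : comNzRingType) (A : algType R) (u v : tens A A) : tens A A :=
  tens_fold (fun a b => tens_fold (fun c d => pure (a * c) (b * d)) v) u.

Record bialgebra (R : comNzRingType) := Bialgebra {
  bialg_alg :> algType R;
  cop : {linear bialg_alg -> tens bialg_alg bialg_alg};
  eps : {scalar bialg_alg};
  cop_assoc : forall x, tens_assoc (tens_map cop idfun (cop x)) = tens_map idfun cop (cop x);
  cop_epsl : forall x, tens_fold (fun a b => eps a *: b) (cop x) = x;
  cop_epsr : forall x, tens_fold (fun a b => eps b *: a) (cop x) = x;
  cop1 : cop 1 = pure 1 1;
  copM : forall x y, cop (x * y) = tens_mul (cop x) (cop y);
  eps1 : eps 1 = 1;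
  epsM : forall x y, eps (x * y) = eps x * eps y
}.

Arguments cop {R b}.
Arguments eps {R b}.

Section Bialgebras.
Variable R : comNzRingType.
Implicit Types A B : bialgebra R.

Definition antipode A (S : A -> A) : Prop :=
  [/\ linear S,
      forall x, tens_fold (fun a b => S a * b) (cop x) = (eps x)%:A
    & forall x, tens_fold (fun a b => a * S b) (cop x) = (eps x)%:A].

Definition is_hopf A : Prop := exists S : A -> A, antipode S.

(* A^{⊗n} is A ⊗ (A ⊗ ... (A ⊗ R)), and Δ^n is read in it; in particular Δ^1
   is the identity up to A ⊗ R = A. *)
Fixpoint tpow A (n : nat) : lmodType R :=
  if n is m.+1 then tens A (tpow A m) else R^o.

Fixpoint iter_cop A (n : nat) : A -> tpow A n :=
  match n return A -> tpow A n with
  | 0 => fun x => eps x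
  | m.+1 => fun x => tens_map idfun (@iter_cop A m) (cop x)
  end.

Fixpoint tpow_map A (f : A -> A) (n : nat) : tpow A n -> tpow A n :=
  match n return tpow A n -> tpow A n with
  | 0 => idfun
  | m.+1 => tens_map f (@tpow_map A f m)
  end.

(* δ_n *)
Definition delta A (n : nat) (x : A) : tpow A n :=
  tpow_map (fun y => y - (eps y)%:A) (iter_cop n x).

Definition aug_ideal A : set A := [set x | eps x = 0].

Definition ideal_mul A (I J : set A) : set A :=
  [set z | exists2 s : seq (A * A),
    forall p, p \in s -> I p.1 /\ J p.2 & z = \sum_(p <- s) p.1 * p.2].

Fixpoint ideal_exp A (I : set A) (n : nat) : set A :=
  if n is m.+1 then ideal_mul I (ideal_exp I m) else setT.

(* D_n = Ker δ_{n+1} *)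
Definition Dker A (n : nat) : set A := [set x | delta n.+1 x = 0].

End Bialgebras.

(* S as an R-module through f *)
Section RestrictScalars.
Variables R S : comNzRingType.

Definition restrict_scalars of {rmorphism R -> S} : Type := S.

Variable f : {rmorphism R -> S}.
Local Notation Sf := (restrict_scalars f).

HB.instance Definition _ := GRing.Zmodule.on Sf.

Definition rs_scale (a : R) (x : Sf) : Sf := f a * (x : S).

Lemma rs_scaleA a b x : rs_scale a (rs_scale b x) = rs_scale (a * b) x.
Proof. by rewrite /rs_scale rmorphM mulrA. Qed.

Lemma rs_scale1 : left_id 1 rs_scale.
Proof. by move=> x; rewrite /rs_scale rmorph1 mul1r. Qed.

Lemma rs_scaleDr : right_distributive rs_scale +%R.
Proof. by move=> a x y; rewrite /rs_scale mulrDr. Qed.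

Lemma rs_scaleDl x : {morph rs_scale^~ x : a b / a + b}.
Proof. by move=> a b; rewrite /rs_scale rmorphD mulrDl. Qed.

HB.instance Definition _ := GRing.Zmodule_isLmodule.Build R Sf
  rs_scaleA rs_scale1 rs_scaleDr rs_scaleDl.

End RestrictScalars.

Section SemilinearMorphisms.
Variables (R S : comNzRingType) (f : {rmorphism R -> S}).

(* Morphisms of bialgebras over f, i.e. morphisms of R-bialgebras when f is
   the identity of R.  *)
Definition bialg_hom (A : bialgebra R) (B : bialgebra S) (phi : A -> B) : Prop :=
  [/\ forall a x y, phi (a *: x + y) = f a *: phi x + phi y,
      phi 1 = 1 /\ {morph phi : x y / x * y},
      forall x, eps (phi x) = f (eps x)
    & forall x, cop (phi x) = tens_map phi phi (cop x)].

(* phi presents B as the quotient A / I, with scalars reduced along f. *)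
Definition is_quotient (A : bialgebra R) (B : bialgebra S) (phi : A -> B) (I : set A) :=
  [/\ bialg_hom phi, range phi = setT & [set x | phi x = 0] = I].

(* phi presents A as an R-bialgebra contained in the S-bialgebra B, with
   underlying set X.  *)
Definition is_sub (A : bialgebra R) (B : bialgebra S) (phi : A -> B) (X : set B) :=
  [/\ bialg_hom phi, injective phi & range phi = X].

(* phi presents B as S ⊗_R A. *)
Definition is_base_change (A : bialgebra R) (B : bialgebra S) (phi : A -> B) :=
  bialg_hom phi /\
  bijective (tens_fold (fun (c : restrict_scalars f) (x : A) => (c : S) *: phi x)).

(* The R-submodule of the S-module V generated by X. *)
Definition span_over (V : lmodType S) (X : set V) : set V :=
  [set z | exists2 s : seq (R * V),
    forall p, p \in s -> X p.2 & z = \sum_(p <- s) f p.1 *: p.2].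

End SemilinearMorphisms.

Definition bialg_iso (R : comNzRingType) (A B : bialgebra R) (phi : A -> B) : Prop :=
  bialg_hom idfun phi /\ bijective phi.

Definition hopf_iso (R : comNzRingType) (A B : bialgebra R) (phi : A -> B) : Prop :=
  bialg_iso phi /\
  forall SA SB, antipode SA -> antipode SB -> forall x, phi (SA x) = SB (phi x).

(* k[t, t^-1], as a subring of k(t). *)
Section Laurent.
Variable k : fieldType.

Definition laurent_pred : {pred {fraction {poly k}}} :=
  fun x => `[< exists n (p : {poly k}), x = tofrac p / tofrac ('X^n) >].

Lemma tofracXn_neq0 n : tofrac ('X^n : {poly k}) != 0.
Proof. by rewrite tofrac_eq0 -size_poly_eq0 size_polyXn. Qed.

Lemma laurent_subring : subring_closed laurent_pred.
Proof.
split=> [|x y /asboolP[n [p ->]] /asboolP[m [q ->]]|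
          x y /asboolP[n [p ->]] /asboolP[m [q ->]]]; apply/asboolP.
- by exists 0%N, 1; rewrite expr0 !rmorph1 divr1.
- exists (n + m)%N, (p * 'X^m - q * 'X^n).
  rewrite exprD tofracB !tofracM -[- (tofrac q / _)]mulNr addf_div ?tofracXn_neq0 //.
  by rewrite mulNr.
- exists (n + m)%N, (p * q).
  by rewrite exprD !rmorphM /= mulf_div.
Qed.

HB.instance Definition _ :=
  GRing.isSubringClosed.Build {fraction {poly k}} laurent_pred laurent_subring.

Record laurent := Laurent { laurent_val :> {fraction {poly k}};
                            _ : laurent_val \in laurent_pred }.

HB.instance Definition _ := [isSub for laurent_val].
HB.instance Definition _ := [Choice of laurent by <:].
HB.instance Definition _ := [SubChoice_isSubComNzRing of laurent by <:].

Fact laurent_poly_subproof (p : {poly k}) : tofrac p \in laurent_pred.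
Proof. by apply/asboolP; exists 0%N, p; rewrite expr0 rmorph1 divr1. Qed.

Definition laurent_poly (p : {poly k}) : laurent := Laurent (laurent_poly_subproof p).

Fact laurent_poly_zmod : zmod_morphism laurent_poly.
Proof. by move=> p q; apply: val_inj; rewrite /= rmorphB. Qed.

Fact laurent_poly_monoid : monoid_morphism laurent_poly.
Proof. by split=> [|p q]; apply: val_inj; rewrite /= ?rmorph1 ?rmorphM. Qed.

HB.instance Definition _ :=
  GRing.isZmodMorphism.Build {poly k} laurent laurent_poly laurent_poly_zmod.
HB.instance Definition _ :=
  GRing.isMonoidMorphism.Build {poly k} laurent laurent_poly laurent_poly_monoid.

Fact laurent_inv_subproof n : (tofrac ('X^n : {poly k}))^-1 \in laurent_pred.
Proof. by apply/asboolP; exists n, 1; rewrite rmorph1 mul1r. Qed.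

(* t^-n *)
Definition laurent_inv (n : nat) : laurent := Laurent (laurent_inv_subproof n).

Definition laurent_const : {rmorphism k -> laurent} := laurent_poly \o polyC.

End Laurent.

(* The objects of the statement are determined up to a unique isomorphism; each
   predicate below says that its last argument is a model of one of them. *)
Section QuantumDuality.
Variable k : fieldType.

(* V = B^∨ *)
Definition is_vee (B V : bialgebra k) : Prop :=
  exists pi : B -> V, is_quotient idfun pi (\bigcap_n ideal_exp (@aug_ideal k B) n).

(* P = B' *)
Definition is_prime (B P : bialgebra k) : Prop :=
  exists i : P -> B, is_sub idfun i (\bigcup_n Dker (A := B) n).

(* For V = B^∨, this is V_t = B^∨_t, inside E = V[t, t^-1]. *)
Definition is_vee_t (V : bialgebra k) (Vt : bialgebra {poly k}) : Prop :=
  exists (E : bialgebra (laurent k)) (iota : V -> E) (i : Vt -> E),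
    is_base_change (laurent_const k) iota /\
    is_sub (@laurent_poly k) i (span_over (@laurent_poly k)
      [set z | exists n x, ideal_exp (@aug_ideal k V) n x /\
                           z = laurent_inv k n *: iota x]).

(* Pt = B'_t, inside E = B[t, t^-1]. *)
Definition is_prime_t (B : bialgebra k) (Pt : bialgebra {poly k}) : Prop :=
  exists (E : bialgebra (laurent k)) (iota : B -> E) (i : Pt -> E),
    is_base_change (laurent_const k) iota /\
    is_sub (@laurent_poly k) i (span_over (@laurent_poly k)
      [set z | exists n x, Dker (A := B) n x /\
                           z = laurent_poly 'X^n *: iota x]).

(* Hp = H', for a k[t]-bialgebra H *)
Definition is_drinfeld_prime (H Hp : bialgebra {poly k}) : Prop :=
  exists i : Hp -> H, is_sub idfun i
    [set b | forall n, exists u : tpow H n, delta n b = 'X^n *: u].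

(* Hv = H^∨, for a k[t]-bialgebra H, inside F = k(t) ⊗ H *)
Definition is_drinfeld_vee (H Hv : bialgebra {poly k}) : Prop :=
  exists (F : bialgebra {fraction {poly k}}) (iota : H -> F) (i : Hv -> F),
    is_base_change (@tofrac {poly k}) iota /\
    is_sub (@tofrac {poly k}) i (span_over (@tofrac {poly k})
      [set z | exists n x, ideal_exp (@aug_ideal {poly k} H) n x /\
                           z = (tofrac 'X^n)^-1 *: iota x]).

(* Q = H|_{t=1} = H / (t - 1) H *)
Definition is_at1 (H : bialgebra {poly k}) (Q : bialgebra k) : Prop :=
  exists p : H -> Q, is_quotient (horner_eval (1 : k)) p
    [set z | exists y, z = ('X - 1%:P) *: y].

End QuantumDuality.

(* Main.v *)
(* Inverting t turns (B^\vee_t)' into B^\vee[t, t^-1] and (B'_t)^\vee into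
   B'[t, t^-1]; since t becomes 1 modulo t - 1, evaluation at t = 1 identifies
   the fibres with B^\vee and B'.

   That the objects exist comes down to coproducts.  If X is a submodule of a
   torsion-free module E over a localisation of a Euclidean ring, then X ⊗ X
   embeds in E ⊗ E, so it suffices to see that the coproduct of x in X is a sum
   of pure tensors of elements of X.  For the Drinfeld prime M' of M, write the
   coproduct of b in M' as \sum f_i ⊗ v_i, where the f_i are a basis of the part
   of M' in a finite free direct summand of M; since (δ_n ⊗ δ_m) Δ = δ_(n+m)
   and the f_i stay independent modulo t M', the v_i are in M' as well.  Closure
   of M' under products follows from closure under the coproduct.  The
   bialgebra B'_t is the Drinfeld prime of B[t], and B' is its image at t = 1. *)
From HB Require Import structures.
From mathcomp Require Import all_boot all_order all_algebra.
From mathcomp Require Import boolp classical_sets.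
Require Import Defs.

Set Implicit Arguments.
Unset Strict Implicit.
Unset Printing Implicit Defensive.

Import GRing.Theory.
Local Open Scope ring_scope.
Local Open Scope classical_set_scope.

(** * Additive and semilinear maps *)

(** Elements of a tensor product are classes of lists, so an equality of tensors is easy to produce
    and hard to refute. Injectivity and divisibility are therefore tested by linear functionals;
    over a domain these come from Zorn's lemma, with values in a fraction field, and bases over a
    Euclidean ring take the place of flatness.

    The spaces [D n] are the second obstacle: how products and coproducts act on the kernels of the
    δ_n is not visible from the definition. Presenting [B'_t] as a Drinfeld prime obtains what is
    needed of both from one argument about divisibility by [t].

    On the fibres the content is the kernel of evaluation: for [e] in the lattice, [t^m] times the
    value of [e] at [t = 1] differs from [e] by [t - 1] times an element of the lattice as soon as
    [m] is large. The isomorphism results from two presentations of the same quotient. For Hopf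
    algebras every object inherits an antipode, and uniqueness of antipodes turns any bialgebra
    isomorphism into one of Hopf algebras. *)

Section AdditiveMaps.
Variables U V : zmodType.

Definition is_add (F : U -> V) := {morph F : x y / x + y}.

Variable F : U -> V.
Hypothesis addF : is_add F.

Lemma is_add0 : F 0 = 0.
Proof. by apply: (addrI (F 0)); rewrite -addF !addr0. Qed.

Lemma is_addN x : F (- x) = - F x.
Proof. by apply/eqP; rewrite -addr_eq0 -addF addNr is_add0. Qed.

Lemma is_addB x y : F (x - y) = F x - F y.
Proof. by rewrite addF is_addN. Qed.

Lemma is_add_sum I (r : seq I) (P : pred I) (G : I -> U) :
  F (\sum_(i <- r | P i) G i) = \sum_(i <- r | P i) F (G i).
Proof. exact: (big_morph F addF is_add0). Qed.

End AdditiveMaps.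

Section Semilinear.
Variables (R S : comNzRingType) (f : {rmorphism R -> S}).
Variables (U : lmodType R) (V : lmodType S).

(** Semilinearity over a ring morphism [f] covers with one predicate linear maps, where [f] is the
    identity, inclusions of [{poly k}]-modules in modules over a localisation, and evaluation at
    [t = 1]. *)
Definition slinear (F : U -> V) := forall a x y, F (a *: x + y) = f a *: F x + F y.

Variable F : U -> V.
Hypothesis linF : slinear F.

Lemma slin_add : is_add F.
Proof. by move=> x y; rewrite -[x in LHS]scale1r linF rmorph1 scale1r. Qed.

Lemma slinZ a x : F (a *: x) = f a *: F x.
Proof. by rewrite -[a *: x]addr0 linF (is_add0 slin_add) addr0. Qed.

End Semilinear.

Lemma mk_slinear (R S : comNzRingType) (f : {rmorphism R -> S}) (U : lmodType R)
    (V : lmodType S) (F : U -> V) :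
  is_add F -> (forall a x, F (a *: x) = f a *: F x) -> slinear f F.
Proof. by move=> FD FZ a x y; rewrite FD FZ. Qed.

Lemma linear_slinear (R : comNzRingType) (U V : lmodType R) (F : {linear U -> V}) :
  slinear idfun F.
Proof. by move=> a x y; rewrite linearP. Qed.

(** * Maps out of tensor products *)

Section TensorMaps.
Variables (R : comNzRingType) (M N : lmodType R).
Implicit Types (x : M) (y : N) (u : tens M N) (P : zmodType).

(** The conditions under which [tens_fold g] does not depend on the chosen representative; they are
    the hypothesis of the universal property. *)
Definition balanced P (g : M -> N -> P) :=
  [/\ forall x1 x2 y, g (x1 + x2) y = g x1 y + g x2 y,
      forall x y1 y2, g x (y1 + y2) = g x y1 + g x y2
    & forall a x y, g (a *: x) y = g x (a *: y)].

Lemma pureDl x1 x2 y : pure (x1 + x2) y = pure x1 y + pure x2 y.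
Proof.
rewrite -[RHS]/(tens_add _ _) /pure tens_addE; apply/tens_clsP; exact: TensDl.
Qed.

Lemma pureDr x y1 y2 : pure x (y1 + y2) = pure x y1 + pure x y2.
Proof.
rewrite -[RHS]/(tens_add _ _) /pure tens_addE; apply/tens_clsP; exact: TensDr.
Qed.

Lemma pureZl a x y : pure (a *: x) y = a *: pure x y.
Proof. by rewrite -[RHS]/(tens_scale _ _) /pure tens_scaleE. Qed.

Lemma pureZr a x y : pure x (a *: y) = a *: pure x y.
Proof. by rewrite -pureZl; apply/tens_clsP; apply: TensSym; exact: TensZ. Qed.

Lemma pure_balanced : balanced (@pure R M N).
Proof.
by split=> [*|*|*]; rewrite ?pureDl ?pureDr ?pureZl ?pureZr.
Qed.

Lemma pure_addl y : is_add (fun x => pure x y).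
Proof. by move=> x1 x2; rewrite pureDl. Qed.

Lemma pure_addr x : is_add (pure x : N -> tens M N).
Proof. by move=> y1 y2; rewrite pureDr. Qed.

Lemma pure0l y : pure (0 : M) y = 0.
Proof. exact: (is_add0 (pure_addl y)). Qed.

Lemma pure0r x : pure x (0 : N) = 0.
Proof. exact: (is_add0 (pure_addr x)). Qed.

Lemma tens_sum_pure u : u = \sum_(p <- tens_repr u) pure p.1 p.2.
Proof.
rewrite -[LHS]tens_reprK; elim: (tens_repr u) => [|[x y] s IHs].
  by rewrite big_nil.
rewrite big_cons -IHs /= -[RHS]/(tens_add _ _) /pure tens_addE.
by [].
Qed.

Lemma tens_ind (Q : tens M N -> Prop) :
  Q 0 -> (forall x y, Q (pure x y)) -> (forall u v, Q u -> Q v -> Q (u + v)) ->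
  forall u, Q u.
Proof.
move=> Q0 Qp QD u; rewrite [u]tens_sum_pure.
by elim/big_ind: _ => // *; exact: QD.
Qed.

(** Pure tensors generate the tensor product as an additive group, because scalars can be absorbed
    in a factor; additivity of the two maps therefore suffices. *)
Lemma tens_ext P (F G : tens M N -> P) :
  is_add F -> is_add G -> (forall x y, F (pure x y) = G (pure x y)) -> F =1 G.
Proof.
move=> FD GD FG; elim/tens_ind => [|//|u v Hu Hv].
  by rewrite (is_add0 FD) (is_add0 GD).
by rewrite FD GD Hu Hv.
Qed.

Lemma tens_foldE P (g : M -> N -> P) x y : balanced g -> tens_fold g (pure x y) = g x y.
Proof. by case=> *; apply: tens_fold_pure. Qed.

Lemma tens_fold_add P (g : M -> N -> P) : balanced g -> is_add (tens_fold g).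
Proof.
case=> gDl gDr gZ; rewrite /is_add.
elim/tens_ind_cls => s1; elim/tens_ind_cls => s2.
rewrite -[_ + _ in LHS]/(tens_add _ _) tens_addE /tens_fold.
rewrite !(tens_fold_eqv gDl gDr gZ (tens_repr_cls _)) big_cat /=.
by [].
Qed.

Lemma tens_fold_slin (S : comNzRingType) (f : {rmorphism R -> S}) (P : lmodType S)
    (g : M -> N -> P) :
  balanced g -> (forall a x y, g (a *: x) y = f a *: g x y) -> slinear f (tens_fold g).
Proof.
move=> gB gZ; have gD := tens_fold_add gB; apply: mk_slinear => // a.
apply: tens_ext => [u v|u v|x y]; first by rewrite scalerDr gD.
  by rewrite gD scalerDr.
by rewrite -pureZl !tens_foldE // gZ.
Qed.

Lemma eq_tens_fold P (g h : M -> N -> P) u :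
  (forall x y, g x y = h x y) -> tens_fold g u = tens_fold h u.
Proof. by move=> gh; apply: eq_bigr. Qed.

Lemma tens_fold_comp P P' (F : P -> P') (g : M -> N -> P) u :
  is_add F -> F (tens_fold g u) = tens_fold (fun x y => F (g x y)) u.
Proof. by move=> FD; rewrite /tens_fold (is_add_sum FD). Qed.

Lemma tens_fold_id u : tens_fold pure u = u.
Proof. by rewrite [RHS]tens_sum_pure. Qed.

Lemma tens_foldD P (g h : M -> N -> P) u :
  tens_fold (fun x y => g x y + h x y) u = tens_fold g u + tens_fold h u.
Proof. by rewrite /tens_fold big_split. Qed.

End TensorMaps.

Lemma tens_fold_exchange (R S : comNzRingType) (M N : lmodType R) (M' N' : lmodType S)
    (P : zmodType) (h : M -> N -> M' -> N' -> P) u v :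
  tens_fold (fun a b => tens_fold (fun c d => h a b c d) v) u =
  tens_fold (fun c d => tens_fold (fun a b => h a b c d) u) v.
Proof. by rewrite /tens_fold exchange_big. Qed.

Section TensorFunctor.
Variables (R S : comNzRingType) (f : {rmorphism R -> S}).
Variables (M N : lmodType R) (M' N' : lmodType S).
Variables (phi : M -> M') (psi : N -> N').

Lemma tens_fold_map (P : zmodType) (g : M' -> N' -> P) (u : tens M N) :
  balanced g -> tens_fold g (tens_map phi psi u) = tens_fold (fun x y => g (phi x) (psi y)) u.
Proof.
move=> gB; rewrite /tens_map (tens_fold_comp _ _ (tens_fold_add gB)).
by apply: eq_tens_fold => x y; rewrite tens_foldE.
Qed.

Hypotheses (phil : slinear f phi) (psil : slinear f psi).

Lemma balanced_slin (P : zmodType) (g : M' -> N' -> P) :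
  balanced g -> balanced (fun x y => g (phi x) (psi y)).
Proof.
case=> g1 g2 g3; split=> *.
- by rewrite (slin_add phil) g1.
- by rewrite (slin_add psil) g2.
- by rewrite (slinZ phil) (slinZ psil) g3.
Qed.

Lemma tens_map_pure x y : tens_map phi psi (pure x y) = pure (phi x) (psi y).
Proof. by rewrite /tens_map tens_foldE //; apply: balanced_slin; apply: pure_balanced. Qed.

Lemma tens_map_slin : slinear f (tens_map phi psi).
Proof.
apply: tens_fold_slin => [|a x y]; first by apply: balanced_slin; apply: pure_balanced.
by rewrite (slinZ phil) pureZl.
Qed.

Lemma tens_map_add : is_add (tens_map phi psi).
Proof. exact: slin_add tens_map_slin. Qed.

End TensorFunctor.

Lemma tens_map_comp (R1 R2 R3 : comNzRingType) (M N : lmodType R1) (M' N' : lmodType R2)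
    (M'' N'' : lmodType R3) (g : {rmorphism R2 -> R3})
    (phi : M -> M') (psi : N -> N') (phi' : M' -> M'') (psi' : N' -> N'') u :
  slinear g phi' -> slinear g psi' ->
  tens_map phi' psi' (tens_map phi psi u) = tens_map (phi' \o phi) (psi' \o psi) u.
Proof.
by move=> h1 h2; rewrite /tens_map tens_fold_map //;
  exact: (balanced_slin h1 h2 (pure_balanced _ _)).
Qed.

Lemma eq_tens_map (R1 R2 : comNzRingType) (M N : lmodType R1) (M' N' : lmodType R2)
    (phi phi' : M -> M') (psi psi' : N -> N') u :
  phi =1 phi' -> psi =1 psi' -> tens_map phi psi u = tens_map phi' psi' u.
Proof. by move=> h1 h2; apply: eq_tens_fold => x y; rewrite h1 h2. Qed.

Lemma slinear_id (R : comNzRingType) (M : lmodType R) : slinear idfun (@id M).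
Proof. by []. Qed.

Section TensorAssoc.
Variables (R : comNzRingType) (M N P : lmodType R).

Lemma tens_assoc_bal1 (z : P) :
  balanced (fun (x : M) (y : N) => pure x (pure y z) : tens M (tens N P)).
Proof. by split=> *; rewrite ?pureDl ?pureDr // ?(pureZl, pureZr). Qed.

Lemma tens_assoc_bal2 : balanced (fun (u : tens M N) (z : P) =>
  tens_fold (fun x y => pure x (pure y z)) u : tens M (tens N P)).
Proof.
split=> [u v z|u z1 z2|a u z].
- exact: (tens_fold_add (tens_assoc_bal1 z)).
- by rewrite -tens_foldD; apply: eq_tens_fold => x y; rewrite !pureDr.
- rewrite (slinZ (f := idfun) (tens_fold_slin (tens_assoc_bal1 z) _)) => [|b x y] /=.
    rewrite (tens_fold_comp (F := fun w => a *: w)); last exact: scalerDr.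
    by apply: eq_tens_fold => x y; rewrite !pureZr.
  by rewrite pureZl.
Qed.

Lemma tens_assocE x y z : tens_assoc (pure (pure x y) z) = pure x (pure y z) :> tens M (tens N P).
Proof.
rewrite /tens_assoc tens_foldE; last exact: tens_assoc_bal2.
by rewrite tens_foldE //; exact: tens_assoc_bal1.
Qed.

Lemma tens_assoc_slin : slinear idfun (@tens_assoc R M N P).
Proof.
apply: tens_fold_slin => [|a u z]; first exact: tens_assoc_bal2.
rewrite (slinZ (f := idfun) (tens_fold_slin (tens_assoc_bal1 z) _)) // => b x y.
by rewrite pureZl.
Qed.

End TensorAssoc.

Section TensorAlgebra.
Variables (R : comNzRingType) (A : algType R).
Implicit Types (a b c d : A) (u v w : tens A A).

Lemma tens_mul_bal1 a b : balanced (fun c d => pure (a * c) (b * d) : tens A A).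
Proof.
split=> *; rewrite ?mulrDr ?pureDl ?pureDr //.
by rewrite -!scalerAr pureZl pureZr.
Qed.

Lemma tens_mul_bal2 v :
  balanced (fun a b => tens_fold (fun c d => pure (a * c) (b * d) : tens A A) v).
Proof.
split=> [x1 x2 y|x y1 y2|a x y]; rewrite -?tens_foldD; apply: eq_tens_fold => c d.
- by rewrite mulrDl pureDl.
- by rewrite mulrDl pureDr.
- by rewrite -!scalerAl pureZl pureZr.
Qed.

Lemma tens_mulE a b c d : tens_mul (pure a b) (pure c d) = pure (a * c) (b * d) :> tens A A.
Proof.
rewrite /tens_mul tens_foldE; last exact: tens_mul_bal2.
by rewrite tens_foldE //; exact: tens_mul_bal1.
Qed.

Lemma tens_mulDl u v w : tens_mul (u + v) w = tens_mul u w + tens_mul v w.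
Proof. exact: (tens_fold_add (tens_mul_bal2 w)). Qed.

Lemma tens_mulDr u v w : tens_mul u (v + w) = tens_mul u v + tens_mul u w.
Proof.
rewrite /tens_mul -tens_foldD; apply: eq_tens_fold => a b.
exact: (tens_fold_add (tens_mul_bal1 a b)).
Qed.

Lemma tens_mulZl r u v : tens_mul (r *: u) v = r *: tens_mul u v.
Proof.
apply: (slinZ (f := idfun) (tens_fold_slin (tens_mul_bal2 v) _)) => s a b /=.
rewrite (tens_fold_comp (F := fun w => s *: w)); last exact: scalerDr.
by apply: eq_tens_fold => c d; rewrite -scalerAl pureZl.
Qed.

Lemma tens_mulZr r u v : tens_mul u (r *: v) = r *: tens_mul u v.
Proof.
rewrite /tens_mul (tens_fold_comp (F := fun w => r *: w)); last exact: scalerDr.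
apply: eq_tens_fold => a b.
apply: (slinZ (f := idfun) (tens_fold_slin (tens_mul_bal1 a b) _)) => s c d /=.
by rewrite -scalerAr pureZl.
Qed.

Lemma tens_mul1l u : tens_mul (pure 1 1) u = u.
Proof.
move: u; apply: tens_ext => [u v|//|a b]; first exact: tens_mulDr.
by rewrite tens_mulE !mul1r.
Qed.

Lemma tens_mul1r u : tens_mul u (pure 1 1) = u.
Proof.
move: u; apply: tens_ext => [u v|//|a b]; first exact: tens_mulDl.
by rewrite tens_mulE !mulr1.
Qed.

Lemma tens_mulA u v w : tens_mul u (tens_mul v w) = tens_mul (tens_mul u v) w.
Proof.
move: u; apply: tens_ext => [x y|x y|a b]; rewrite ?tens_mulDl //.
move: v; apply: tens_ext => [x y|x y|c d]; rewrite ?(tens_mulDl, tens_mulDr) //.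
move: w; apply: tens_ext => [x y|x y|e g]; rewrite ?(tens_mulDl, tens_mulDr) //.
by rewrite !tens_mulE !mulrA.
Qed.

Lemma tens_mul_addl w : is_add (fun u => tens_mul u w).
Proof. by move=> u v; rewrite tens_mulDl. Qed.

Lemma tens_mul_addr u : is_add (tens_mul u).
Proof. by move=> v w; rewrite tens_mulDr. Qed.

End TensorAlgebra.

(** * Independence and linear functionals *)

Section Spans.
Variables (R : comNzRingType) (E : lmodType R).
Implicit Types (s : seq E) (N : set E).

Definition submod N := N 0 /\ forall a x y, N x -> N y -> N (a *: x + y).

Lemma submodD N x y : submod N -> N x -> N y -> N (x + y).
Proof. by case=> _ h Nx Ny; rewrite -[x]scale1r; exact: h. Qed.

Lemma submodZ N a x : submod N -> N x -> N (a *: x).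
Proof. by case=> h0 h Nx; rewrite -[_ *: _]addr0; exact: h. Qed.

Lemma submodN N x : submod N -> N x -> N (- x).
Proof. by move=> hN Nx; rewrite -scaleN1r; exact: submodZ. Qed.

Lemma submodB N x y : submod N -> N x -> N y -> N (x - y).
Proof. by move=> hN Nx Ny; apply: submodD => //; exact: submodN. Qed.

Lemma submod_sum N (I : eqType) (r : seq I) (P : pred I) (F : I -> E) : submod N ->
  (forall i, i \in r -> P i -> N (F i)) -> N (\sum_(i <- r | P i) F i).
Proof.
move=> hN hF; rewrite big_seq_cond; apply: (big_ind N); first by case: hN.
  by move=> *; exact: submodD.
by move=> i /andP[]; exact: hF.
Qed.

Definition span s : set E := [set x | exists c : nat -> R, x = \sum_(i < size s) c i *: s`_i].

Definition indep s := forall c : nat -> R, \sum_(i < size s) c i *: s`_i = 0 ->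
  forall i, (i < size s)%N -> c i = 0.

Lemma span_submod s : submod (span s).
Proof.
split=> [|a _ _ [c ->] [d ->]].
  by exists (fun=> 0); rewrite big1 // => i _; rewrite scale0r.
exists (fun i => a * c i + d i); rewrite scaler_sumr -big_split /=.
by apply: eq_bigr => i _; rewrite scalerDl scalerA.
Qed.

Lemma span_mem s x : x \in s -> span s x.
Proof.
move=> xs; exists (fun i => (i == index x s)%:R).
have lt : (index x s < size s)%N by rewrite index_mem.
rewrite (bigD1 (Ordinal lt)) //= eqxx scale1r nth_index // big1 ?addr0 // => i ni.
rewrite (_ : (_ == _) = false) ?scale0r //; apply/negbTE; apply: contra ni => /eqP e.
exact/eqP/val_inj.
Qed.

Lemma span_sub s N x : submod N -> (forall y, y \in s -> N y) -> span s x -> N x.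
Proof.
move=> hN hs [c ->]; apply: submod_sum => // i _ _; apply: submodZ => //.
by apply: hs; exact: mem_nth.
Qed.

Lemma indep_coef s (c d : nat -> R) : indep s ->
  \sum_(i < size s) c i *: s`_i = \sum_(i < size s) d i *: s`_i ->
  forall i, (i < size s)%N -> c i = d i.
Proof.
move=> hs e i li; apply/eqP; rewrite -subr_eq0; apply/eqP.
apply: (hs (fun i => c i - d i)) => //.
under eq_bigr do rewrite scalerBl.
by rewrite sumrB e subrr.
Qed.

End Spans.

Definition torsion_free (R : comNzRingType) (E : lmodType R) :=
  forall (a : R) (x : E), a *: x = 0 -> a = 0 \/ x = 0.

Section Functionals.
Variables (S : idomainType) (E : lmodType S) (K : fieldType) (g : {rmorphism S -> K}).
Hypothesis injg : injective g.

Let gne0 a : a != 0 -> g a != 0.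
Proof. by rewrite -(rmorph0 g) (inj_eq injg). Qed.

(* A maximal submodule avoiding the nonzero multiples of [x0] has a quotient of
   rank one, which embeds in [K]. *)
Lemma exists_functional (N : set E) x0 :
  submod N -> (forall a, N (a *: x0) -> a = 0) ->
  exists lam : E -> K^o,
    [/\ slinear g lam, forall x, N x -> lam x = 0 & lam x0 = 1].
Proof.
move=> hN hx0.
(* Zorn's lemma is applied to all chains, the empty one included, whose union is empty; adjoining
   [N] makes the empty set admissible. *)
pose good (A : set E) := submod (A `|` N) /\ forall a, (A `|` N) (a *: x0) -> a = 0.
have good0 : good set0 by rewrite /good set0U.
have [F Fgood Ftot|A [[[A0 Alin] Ax] Amax]] := @Zorn_bigcup E good.
  set U := \bigcup_(X in F) X.
  have dir x y : (U `|` N) x -> (U `|` N) y ->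
      exists A, [/\ good A, A `<=` U, (A `|` N) x & (A `|` N) y].
    move=> [[A FA Ax]|Nx] [[B FB By]|Ny].
    - have [AB|BA] := Ftot _ _ FA FB.
        exists B; split; [exact: Fgood| by move=> z Bz; exists B| |by left].
        by left; exact: AB.
      exists A; split; [exact: Fgood| by move=> z Az; exists A|by left|].
      by left; exact: BA.
    - by exists A; split; [exact: Fgood| by move=> z Az; exists A|by left|by right].
    - by exists B; split; [exact: Fgood| by move=> z Bz; exists B|by right|by left].
    - by exists set0; split => //; right.
  split.
    split=> [|a x y Ux Uy]; first by right; case: hN.
    have [A [[[_ hA] _] AU Ax Ay]] := dir _ _ Ux Uy.
    by have [/AU|] := hA a x y Ax Ay; [left|right].
  move=> a Ua; have [A [[_ hA] _ Aa _]] := dir _ _ Ua Ua.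
  exact: hA.
set A' := A `|` N in A0 Alin Ax.
have hA' : submod A' by split.
(* Either [y] is in [A'], or [A'] enlarged by [y] contains a nonzero multiple of [x0] by maximality.
   In both cases a nonzero multiple of [y] is a multiple of [x0] modulo [A']: the quotient has rank
   one. *)
have rat y : exists p : S * S, p.2 != 0 /\ A' (p.2 *: y - p.1 *: x0).
  case: (pselect (A' y)) => [Ay|nAy].
    by exists (0, 1); rewrite oner_neq0 scale1r scale0r subr0.
  pose B := [set z | exists a w, A' w /\ z = a *: y + w].
  have hB : submod B.
    split=> [|a _ _ [b [w [Aw ->]]] [c [v [Av ->]]]].
      by exists 0, 0; rewrite scale0r addr0.
    exists (a * b + c), (a *: w + v); split; first exact: Alin.
    by rewrite scalerDr scalerDl scalerA addrACA.
  have subA : A' `<=` B by move=> w Aw; exists 0, w; rewrite scale0r add0r.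
  have BN : B `|` N = B.
    by apply/seteqP; split=> z; [case=> // Nz; apply: subA; right | left].
  case: (pselect (forall a, B (a *: x0) -> a = 0)) => [Bx|].
    exfalso; apply: (Amax B); last by rewrite /good BN.
    split; first by move=> z Az; apply: subA; left.
    move=> /(_ y) BA; apply: nAy; left; apply: BA.
    by exists 1, 0; rewrite scale1r addr0.
  move=> /existsNP[a /not_implyP[[b [w [Aw e]]] ane]].
  exists (a, b) => /=; split.
    apply/eqP => b0; apply: ane; apply: Ax.
    by rewrite e b0 scale0r add0r.
  by rewrite e opprD addrA subrr add0r; apply: submodN.
pose lam y : K^o := let p := projT1 (cid (rat y)) in g p.1 / g p.2.
(* The ratio does not depend on the pair: two relations for the same [y] combine to a multiple of
   [x0] in [A'], whose coefficient must vanish. *)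
have lamE y a b : b != 0 -> A' (b *: y - a *: x0) -> lam y = g a / g b.
  move=> b0 h; rewrite /lam; case: (cid _) => -[c d] /= [d0 h'].
  apply/eqP; rewrite eqr_div ?gne0 // -!rmorphM; apply/eqP; congr (g _).
  apply/eqP; rewrite -subr_eq0; apply/eqP; apply: Ax.
  suff -> : (c * b - a * d) *: x0 = d *: (b *: y - a *: x0) - b *: (d *: y - c *: x0).
    by apply: submodB => //; apply: submodZ.
  rewrite !scalerBr !scalerA opprB (mulrC d b) [RHS]addrC subrKA.
  by rewrite scalerBl (mulrC c b) (mulrC a d).
exists lam; split.
- apply: mk_slinear => [x y|a x]; last first.
    case: (rat x) => -[c d] /= [d0 h].
    rewrite (lamE x c d) // (lamE (a *: x) (a * c) d) //.
      by rewrite rmorphM -mulrA.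
    by rewrite scalerA (mulrC d) -!scalerA -scalerBr; apply: submodZ.
  case: (rat x) => -[a b] /= [b0 h]; case: (rat y) => -[c d] /= [d0 h'].
  rewrite (lamE x a b) // (lamE y c d) // (lamE (x + y) (a * d + c * b) (b * d)).
  - by rewrite rmorphD !rmorphM /= addf_div ?gne0.
  - by rewrite mulf_neq0.
  have -> : (b * d) *: (x + y) - (a * d + c * b) *: x0 =
      d *: (b *: x - a *: x0) + b *: (d *: y - c *: x0).
    rewrite !scalerDr !scalerN !scalerA scalerDl opprD (mulrC d b) addrACA.
    by rewrite (mulrC d a) (mulrC c b).
  by apply: submodD => //; apply: submodZ.
- move=> x Nx; rewrite (lamE x 0 1) ?oner_neq0 ?rmorph0 ?mul0r //.
  by rewrite scale1r scale0r subr0; right.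
- rewrite (lamE x0 1 1) ?oner_neq0 ?rmorph1 ?divr1 //.
  by rewrite subrr.
Qed.

(** An application of [exists_functional] to the vector of index [i0] and the span of the others,
    encoded as the combinations whose coefficient at [i0] is 0. *)
Lemma dual_functional s i0 : indep s -> (i0 < size s)%N ->
  exists lam : E -> K^o,
    slinear g lam /\ forall i, (i < size s)%N -> lam s`_i = (i == i0)%:R.
Proof.
move=> hs li0.
pose N := [set x | exists2 c : nat -> S, c i0 = 0 & x = \sum_(i < size s) c i *: s`_i].
have hN : submod N.
  split=> [|a _ _ [c c0 ->] [d d0 ->]].
    by exists (fun=> 0); rewrite // big1 // => i _; rewrite scale0r.
  exists (fun i => a * c i + d i); first by rewrite c0 d0 mulr0 addr0.
  rewrite scaler_sumr -big_split /=.
  by apply: eq_bigr => i _; rewrite scalerDl scalerA.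
have delta i : (i < size s)%N -> s`_i = \sum_(j < size s) (j == i :> nat)%:R *: s`_j.
  move=> li; rewrite (bigD1 (Ordinal li)) //= eqxx scale1r big1 ?addr0 // => j ji.
  rewrite (_ : (_ == _) = false) ?scale0r //; apply/negbTE; apply: contra ji => /eqP e.
  exact/eqP/val_inj.
have [lam [laml lamN lam1]] : exists lam : E -> K^o,
    [/\ slinear g lam, forall x, N x -> lam x = 0 & lam s`_i0 = 1].
  apply: exists_functional => // a [c c0 e].
  have : \sum_(i < size s) (a * (i == i0 :> nat)%:R) *: s`_i = \sum_(i < size s) c i *: s`_i.
    rewrite -e (delta _ li0) scaler_sumr.
    by apply: eq_bigr => j _; rewrite scalerA.
  move=> /(indep_coef (c := fun i => a * (i == i0)%:R) hs) /(_ _ li0).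
  by rewrite eqxx mulr1 c0.
exists lam; split=> // i li; case: eqVneq => [->//|ni].
apply: lamN; exists (fun j => (j == i)%:R); last exact: delta.
by rewrite eq_sym (negbTE ni).
Qed.

End Functionals.

(** A functional dual to the vector of index [i0] and a functional [mu] with [mu (z i0) = 1]
    multiply to a balanced map into the fraction field, which would send the vanishing sum to 1. *)
Lemma indep_tens0 (S : idomainType) (E E2 : lmodType S) (s : seq E) (z : nat -> E2) :
  torsion_free E2 -> indep s -> \sum_(i < size s) pure s`_i (z i) = 0 ->
  forall i, (i < size s)%N -> z i = 0.
Proof.
move=> tf hs e0 i0 li0; apply: contrapT => zi0.
have injg : injective (@tofrac S) by move=> p q /eqP; rewrite tofrac_eq => /eqP.
have [lam [laml lamE]] := dual_functional injg hs li0.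
have [||mu [mul _ mu1]] := exists_functional injg (N := [set 0]) (x0 := z i0).
- by split=> // a x y -> ->; rewrite scaler0 addr0.
- by move=> a /tf[].
pose G : E -> E2 -> {fraction S} := fun x y => lam x * mu y.
have GB : balanced G.
  split=> [x1 x2 y|x y1 y2|a x y]; rewrite /G.
  - by rewrite (slin_add laml) mulrDl.
  - by rewrite (slin_add mul) mulrDr.
  - by rewrite (slinZ laml) (slinZ mul) -[_ *: lam x]/(_ * _) -[_ *: mu y]/(_ * _) mulrCA mulrA.
have := congr1 (tens_fold G) e0.
rewrite (is_add_sum (tens_fold_add GB)) (is_add0 (tens_fold_add GB)).
rewrite (bigD1 (Ordinal li0)) //= tens_foldE // /G lamE // eqxx mul1r mu1 big1.
  by rewrite addr0 => /eqP; rewrite oner_eq0.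
move=> j ji; rewrite tens_foldE // lamE // (_ : (_ == _) = false) ?mul0r //.
by apply/negbTE; apply: contra ji => /eqP e; apply/eqP/val_inj.
Qed.

(** * Bases over Euclidean rings *)

Definition euclid (R : idomainType) := exists sz : R -> nat,
  (forall c, (sz c == 0%N) = (c == 0)) /\
  forall a b : R, b != 0 -> exists q, (sz (a - q * b)%R < sz b)%N.

Lemma euclid_field (k : fieldType) : euclid k.
Proof.
exists (fun c : k => (c != 0) : nat); split=> [c|a b b0]; first by rewrite eqb0 negbK.
by exists (a / b); rewrite divfK // subrr eqxx b0.
Qed.

Lemma euclid_poly (k : fieldType) : euclid {poly k}.
Proof.
exists (fun p : {poly k} => size p); split=> [c|a b b0]; first exact: size_poly_eq0.
exists (a %/ b); rewrite {1}(divp_eq a b) addrC addKr ltn_modp.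
by [].
Qed.

Section EuclideanBases.
Variables (R : idomainType) (E : lmodType R).
Hypothesis eucl : euclid R.

(* Euclid's algorithm on the coefficients of a nontrivial linear relation. *)
Lemma relation_elim (ps : seq (R * E)) : torsion_free E ->
  \sum_(p <- ps) p.1 *: p.2 = 0 -> has (fun p => p.1 != 0) ps ->
  exists2 s', (size s' < size ps)%N & forall p, p \in ps -> span s' p.2.
Proof.
move=> tf; have [sz [sz0 szlt]] := eucl.
have [n] := ubnP (\sum_(p <- ps) sz p.1); elim: n ps => // n IH ps le_n e /hasP[p pps p0].
have pperm := perm_to_rem pps; set rest := rem p ps in pperm.
have [/hasP[q qrest q0]|/hasPn hrest] := boolP (has (fun p => p.1 != 0) rest); last first.
  (* Here [p] carries the only nonzero coefficient, so torsion-freeness forces [p.2 = 0] and the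
     other vectors suffice. *)
  exists (map snd rest); first by rewrite size_map (perm_size pperm) ltnS.
  have p2 : p.2 = 0.
    move: e; rewrite (perm_big _ pperm) big_cons /= [X in _ + X]big_seq big1.
      by rewrite addr0 => /tf[/eqP|//]; rewrite (negbTE p0).
    by move=> q /hrest; rewrite negbK => /eqP->; rewrite scale0r.
  move=> q; rewrite (perm_mem pperm) inE => /predU1P[->|qrest].
    by rewrite p2; case: (span_submod (map snd rest)).
  by apply: span_mem; apply: map_f.
have {pperm qrest rest} [rest pqperm] : exists rest', perm_eq ps [:: p, q & rest'].
  exists (rem q rest); apply: (perm_trans pperm); rewrite perm_cons.
  exact: perm_to_rem.
wlog le_pq : p q p0 q0 {pps} pqperm / (sz p.1 <= sz q.1)%N.
  have [le|/ltnW le] := leqP (sz p.1) (sz q.1) => hw; first exact: (hw p q).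
  apply: (hw q p) => //; apply: (perm_trans pqperm).
  by rewrite -[_ :: _]/([:: p] ++ [:: q] ++ rest) perm_catCA.
have [c lt] := szlt q.1 p.1 p0.
(* One division step: the coefficient of [q] is replaced by its remainder modulo that of [p], and
   [p.2] is changed so that the sum stays the same. The total size of the coefficients drops. *)
pose ps' := [:: (p.1, p.2 + c *: q.2), (q.1 - c * p.1, q.2) & rest].
have [||| s' lt' hs'] := IH ps'.
- move: le_n; rewrite (perm_big _ pqperm) !big_cons /= ltnS; apply: leq_trans.
  by rewrite ltn_add2l ltn_add2r (leq_trans lt).
- rewrite -[RHS]e (perm_big _ pqperm) !big_cons /= scalerDr scalerBl scalerA.
  by rewrite (mulrC c) -!addrA; congr (_ + _); rewrite addrCA addNKr.
- by rewrite /= p0.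
exists s'; first by rewrite (perm_size pqperm).
move=> r; rewrite (perm_mem pqperm) !inE => /or3P[/eqP->|/eqP->|rr].
- have h1 := hs' _ (mem_head _ _); have h2 := hs' (q.1 - c * p.1, q.2); move: h1 h2 => /=.
  rewrite !inE eqxx orbT => h1 /(_ isT) h2.
  rewrite -(addrK (c *: q.2) p.2); apply: (submodB (span_submod _)) => //.
  exact: (submodZ _ (span_submod _)).
- by have := hs' (q.1 - c * p.1, q.2); rewrite !inE eqxx orbT; apply.
- by apply: hs'; rewrite !inE rr !orbT.
Qed.

(** A nontrivial relation lets [relation_elim] shorten a dependent family, so induction on the
    length ends with an independent one. This is the freeness of finitely generated torsion-free
    modules. *)
Lemma torsion_free_basis (s : seq E) : torsion_free E ->
  exists2 s', indep s' & forall x, x \in s -> span s' x.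
Proof.
move=> tf; have [n] := ubnP (size s); elim: n s => // n IH s; rewrite ltnS => le_n.
case: (pselect (indep s)) => [hs|]; first by exists s => // x; exact: span_mem.
move=> /existsNP[c /not_implyP[e /existsNP[i /not_implyP[li /eqP ci]]]].
pose ps := [seq (c (nat_of_ord i), s`_i) | i : 'I_(size s)].
have [||s' lt hs'] := relation_elim (ps := ps) tf.
- by rewrite big_map big_enum.
- by apply/hasP; exists (c i, s`_i) => //; apply/mapP; exists (Ordinal li); rewrite ?mem_enum.
have szps : size ps = size s by rewrite size_map size_enum_ord.
have [|s'' ind hs''] := IH s'; first by rewrite szps in lt; exact: leq_trans le_n.
exists s'' => // x xs; apply: (span_sub (span_submod _) hs'').
have lx : (index x s < size s)%N by rewrite index_mem.
apply: (hs' (c (index x s), x)); apply/mapP; exists (Ordinal lx); rewrite ?mem_enum //=.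
by rewrite nth_index.
Qed.

(** The classical argument for submodules of a free module: the values of the last functional on [X]
    form an ideal, generated by a value of least nonzero size; a vector attaining it is added to a
    basis of the kernel. *)
Lemma submod_basis (X : set E) n (l : nat -> E -> R^o) :
  submod X -> (forall i, slinear idfun (l i)) ->
  (forall x, X x -> (forall i, (i < n)%N -> l i x = 0) -> x = 0) ->
  exists fs, [/\ forall i, (i < size fs)%N -> X fs`_i, indep fs & X `<=` span fs].
Proof.
move=> + hl; elim: n X => [|n IH] X hX inj.
  exists [::]; split=> //.
  by move=> x Xx; exists (fun=> 0); rewrite big_ord0; exact: inj.
pose X0 := X `&` [set x | l n x = 0].
have hX0 : submod X0.
  split=> [|a x y [Xx x0] [Xy y0]].
    by split; [case: hX | exact: (is_add0 (slin_add (hl n)))].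
  by split; [case: hX => _ h; exact: h | rewrite /= hl x0 y0 scaler0 addr0].
have [||fs [Xfs ifs sfs]] := IH X0 => //.
  move=> x [Xx x0] h; apply: inj => // i; rewrite ltnS leq_eqVlt => /predU1P[->//|].
  exact: h.
case: (pselect (X `<=` X0)) => [XX0|/existsNP[x /not_implyP[Xx nx]]].
  exists fs; split=> //; first by move=> i /Xfs[].
  by move=> x /XX0/sfs.
have lx0 : l n x != 0 by apply/eqP => h; apply: nx.
have [sz [sz0 szlt]] := eucl.
have exm : exists m, `[< exists x, [/\ X x, l n x != 0 & sz (l n x) = m] >].
  by exists (sz (l n x)); apply/asboolP; exists x.
have [m /asboolP[f [Xf f0 szf]] minm] := ex_minnP exm.
have quo y : X y -> exists q : R, l n y = q * l n f.
  move=> Xy; have [q lt] := szlt (l n y) (l n f) f0; exists q.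
  apply/eqP; rewrite -subr_eq0; apply/negPn/negP => ne.
  have e : l n (- q *: f + y) = l n y - q * l n f.
    by rewrite hl addrC; congr (_ + _); rewrite -mulNr.
  suff /minm : `[< exists x, [/\ X x, l n x != 0 & sz (l n x) = sz (l n y - q * l n f)] >].
    by rewrite -szf leqNgt lt.
  apply/asboolP; exists (- q *: f + y); rewrite e; split=> //.
  by case: hX => _ h; exact: h.
exists (f :: fs); split.
- by case=> [|i] //= /Xfs[].
- move=> c; rewrite big_ord_recl /= => e.
  have c0 : c 0%N = 0.
    have := congr1 (l n) e; rewrite hl (is_add_sum (slin_add (hl n))) big1 => [|i _].
      rewrite (is_add0 (slin_add (hl n))) addr0 => /eqP.
      by rewrite mulf_eq0 (negbTE f0) orbF => /eqP.
    have [_ /= ->] : X0 (c (lift ord0 i) *: fs`_i).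
      by apply: submodZ => //; exact: Xfs.
    by [].
  case=> [|i] // li; move: e; rewrite c0 scale0r add0r => e.
  exact: (ifs (fun i => c i.+1)).
- move=> y Xy; have [q e] := quo y Xy.
  have [c ec] : span fs (y - q *: f).
    apply: sfs; split; first by apply: submodB => //; exact: submodZ.
    by rewrite /= (is_addB (slin_add (hl n))) (slinZ (hl n)) e subrr.
  exists (fun i => if i is i'.+1 then c i' else q).
  by rewrite big_ord_recl /= -ec addrC subrK.
Qed.

End EuclideanBases.

(** * Restriction of scalars and localisations *)

Section Restriction.
Variables (R S : comNzRingType) (f : {rmorphism R -> S}) (E : lmodType S).

(** The morphism is an argument of the type, so that restrictions of one module along different
    morphisms carry different structures. *)
Definition res_mod of {rmorphism R -> S} : Type := E.

HB.instance Definition _ := GRing.Zmodule.on (res_mod f).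

Definition res_scale (a : R) (x : res_mod f) : res_mod f := f a *: (x : E).

Fact res_scaleA a b x : res_scale a (res_scale b x) = res_scale (a * b) x.
Proof. by rewrite /res_scale rmorphM scalerA. Qed.

Fact res_scale1 : left_id 1 res_scale.
Proof. by move=> x; rewrite /res_scale rmorph1 scale1r. Qed.

Fact res_scaleDr : right_distributive res_scale +%R.
Proof. by move=> a x y; rewrite /res_scale scalerDr. Qed.

Fact res_scaleDl x : {morph res_scale^~ x : a b / a + b}.
Proof. by move=> a b; rewrite /res_scale rmorphD scalerDl. Qed.

HB.instance Definition _ := GRing.Zmodule_isLmodule.Build R (res_mod f)
  res_scaleA res_scale1 res_scaleDr res_scaleDl.

End Restriction.

(** [S] consists of fractions over [R]. The instances are the identity and the embeddings of
    [{poly k}] in the Laurent polynomials and in the rational functions. *)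
Definition localizing (R S : comNzRingType) (f : {rmorphism R -> S}) :=
  injective f /\ forall s, exists r r', r != 0 /\ f r * s = f r'.

Lemma localizing_id (R : comNzRingType) : localizing (@idfun R : {rmorphism R -> R}).
Proof. by split=> // s; exists 1, s; rewrite oner_neq0 mul1r. Qed.

Section Localization.
Variables (R S : idomainType) (f : {rmorphism R -> S}).
Hypotheses (eucl : euclid R) (locf : localizing f).

Let fne0 a : a != 0 -> f a != 0.
Proof. by case: locf => injf _; rewrite -(rmorph0 f) (inj_eq injf). Qed.

Lemma common_denominator n (c : nat -> S) :
  exists r (d : nat -> R), r != 0 /\ forall i, (i < n)%N -> f r * c i = f (d i).
Proof.
elim: n => [|n [r [d [r0 hd]]]]; first by exists 1, (fun=> 0); rewrite oner_neq0.
have [_ /(_ (c n)) [a [b [a0 e]]]] := locf.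
exists (a * r), (fun i => if (i < n)%N then a * d i else r * b).
split=> [|i]; first by rewrite mulf_neq0.
rewrite ltnS leq_eqVlt => /predU1P[->|lt]; last by rewrite lt !rmorphM -mulrA hd.
by rewrite ltnn !rmorphM mulrAC e mulrC.
Qed.

(** A relation over [S] among the images becomes, after multiplication by a common denominator, the
    image of a relation over [R]. *)
Lemma indep_map (A : lmodType R) (E : lmodType S) (i : A -> E) s :
  slinear f i -> injective i -> indep s -> indep (map i s).
Proof.
move=> li inji hs c; rewrite size_map => e j lj.
have [r [d [r0 hd]]] := common_denominator (size s) c.
suff d0 : d j = 0.
  have /eqP := hd j lj; rewrite d0 rmorph0 mulf_eq0 (negbTE (fne0 r0)) /=.
  by move/eqP.
apply: hs lj; apply: inji; rewrite (is_add0 (slin_add li)) (is_add_sum (slin_add li)).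
rewrite -[RHS](scaler0 _ (f r)) -[X in _ = _ *: X]e scaler_sumr; apply: eq_bigr => l _.
by rewrite (slinZ li) scalerA hd // (nth_map 0).
Qed.

(** The Euclidean algorithm runs over [R], on [E] with restricted scalars; the resulting family
    stays independent over [S] by clearing denominators. *)
Lemma localized_basis (E : lmodType S) (s : seq E) : torsion_free E ->
  exists2 s', indep s' & forall x, x \in s -> span s' x.
Proof.
move=> tf.
have tfr : torsion_free (res_mod E f).
  move=> a x /tf[] h; [left | by right].
  by apply/eqP; apply: contraPT h => /fne0 /eqP.
have [s' hs' sp] := torsion_free_basis eucl (s : seq (res_mod E f)) tfr.
exists (s' : seq E).
  rewrite -[s']map_id; apply: (indep_map (i := fun x : res_mod E f => x : E)) hs' => //.
by move=> x /sp[c e]; exists (fun i => f (c i)).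
Qed.

Lemma tens_basis (E E2 : lmodType S) (s : seq E) (u : tens E E2) :
  (forall p, p \in tens_repr u -> span s p.1) ->
  exists z : nat -> E2, u = \sum_(i < size s) pure s`_i (z i).
Proof.
move=> hu; suff [z e] : exists z : nat -> E2,
    \sum_(p <- tens_repr u) pure p.1 p.2 = \sum_(i < size s) pure s`_i (z i).
  by exists z; rewrite [LHS]tens_sum_pure.
elim: (tens_repr u) hu => [|[x y] r IH] hr.
  by exists (fun=> 0); rewrite big_nil big1 // => i _; rewrite pure0r.
rewrite big_cons /=; have [|z ->] := IH; first by move=> p pr; apply: hr; rewrite inE pr orbT.
have [c /= ->] := hr (x, y) (mem_head _ _).
exists (fun i => c i *: y + z i).
rewrite (is_add_sum (pure_addl y)) -big_split; apply: eq_bigr => i _ /=.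
by rewrite pureDr pureZl pureZr.
Qed.

(** With [u] expanded along an independent family [s], the relation [a *: u = 0] becomes
    [a *: z i = 0] for each coefficient separately. *)
Lemma torsion_free_tens (E E2 : lmodType S) :
  torsion_free E -> torsion_free E2 -> torsion_free (tens E E2).
Proof.
move=> tf tf2 a u e; have [s hs sp] := localized_basis (map fst (tens_repr u)) tf.
have [|z uz] := @tens_basis E E2 s u; first by move=> p pr; apply: sp; apply: map_f.
case: (eqVneq a 0) => [->|a0]; [by left | right].
rewrite uz big1 // => i _.
suff /tf2[/eqP|->] : a *: z i = 0; [by rewrite (negbTE a0)|by rewrite pure0r|].
apply: (indep_tens0 tf2 hs (z := fun i => a *: z i)) => //.
by rewrite -[RHS]e uz scaler_sumr; apply: eq_bigr => j _; rewrite pureZr.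
Qed.

End Localization.

(** Stands in for flatness. The left factors of [u] lie in a free submodule whose basis remains
    independent in [E], so the coefficients on the right are mapped to 0 one by one. *)
Lemma tens_map_inj (R S : idomainType) (f : {rmorphism R -> S})
    (A A2 : lmodType R) (E E2 : lmodType S) (i : A -> E) (i2 : A2 -> E2) :
  euclid R -> localizing f -> torsion_free E -> torsion_free E2 ->
  slinear f i -> slinear f i2 -> injective i -> injective i2 ->
  injective (tens_map i i2).
Proof.
move=> eucl locf tf tf2 li li2 inji inji2.
have tmD := tens_map_add li li2.
suff inj0 u : tens_map i i2 u = 0 -> u = 0.
  by move=> u v e; apply/eqP; rewrite -subr_eq0; apply/eqP/inj0; rewrite (is_addB tmD) e subrr.
move=> e.
have tfA : torsion_free A.
  move=> a x /(congr1 i); rewrite (slinZ li) (is_add0 (slin_add li)).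
  case/tf=> [fa|ix]; [left|right].
    by apply: (proj1 locf); rewrite fa rmorph0.
  by apply: inji; rewrite ix (is_add0 (slin_add li)).
have [s hs sp] := torsion_free_basis eucl (map fst (tens_repr u)) tfA.
have [|z uz] := @tens_basis R A A2 s u; first by move=> p pr; apply: sp; apply: map_f.
rewrite uz big1 // => j _; suff -> : z j = 0 by rewrite pure0r.
apply: inji2; rewrite (is_add0 (slin_add li2)).
apply: (indep_tens0 tf2 (indep_map locf li inji hs) (z := fun j => i2 (z j)));
  last by rewrite size_map.
rewrite -[RHS]e uz (is_add_sum tmD) size_map; apply: eq_bigr => l _.
by rewrite (tens_map_pure li li2) (nth_map 0).
Qed.

(** * Bialgebras inside a bialgebra *)

Section TensorNaturality.
Variables (R S : comNzRingType) (f : {rmorphism R -> S}).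

Lemma tens_assoc_map (M N P : lmodType R) (M' N' P' : lmodType S)
    (a : M -> M') (b : N -> N') (c : P -> P') (u : tens (tens M N) P) :
  slinear f a -> slinear f b -> slinear f c ->
  tens_assoc (tens_map (tens_map a b) c u) = tens_map a (tens_map b c) (tens_assoc u).
Proof.
move=> la lb lc.
have lab := tens_map_slin la lb; have lbc := tens_map_slin lb lc.
have lL : is_add (fun u : tens (tens M N) P => tens_assoc (tens_map (tens_map a b) c u)).
  by move=> v w /=; rewrite (tens_map_add lab lc) (slin_add (@tens_assoc_slin _ _ _ _)).
have lR : is_add (fun u : tens (tens M N) P => tens_map a (tens_map b c) (tens_assoc u)).
  by move=> v w /=; rewrite (slin_add (@tens_assoc_slin _ _ _ _)) (tens_map_add la lbc).
move: u; apply: (tens_ext lL lR) => v z.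
rewrite (tens_map_pure lab lc).
have lL2 : is_add (fun v : tens M N => tens_assoc (pure (tens_map a b v) (c z))).
  by move=> v1 w /=; rewrite (tens_map_add la lb) pureDl (slin_add (@tens_assoc_slin _ _ _ _)).
have lR2 : is_add (fun v : tens M N => tens_map a (tens_map b c) (tens_assoc (pure v z))).
  by move=> v1 w /=; rewrite pureDl (slin_add (@tens_assoc_slin _ _ _ _)) (tens_map_add la lbc).
move: v; apply: (tens_ext lL2 lR2) => x y.
by rewrite (tens_map_pure la lb) !tens_assocE (tens_map_pure la lbc) (tens_map_pure lb lc).
Qed.

Lemma tens_mul_map (A : algType R) (B : algType S) (a : A -> B) (u v : tens A A) :
  slinear f a -> {morph a : x y / x * y} ->
  tens_map a a (tens_mul u v) = tens_mul (tens_map a a u) (tens_map a a v).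
Proof.
move=> la aM; have laa := tens_map_add la la.
move: u; apply: tens_ext => [x y|x y|x1 x2]; rewrite ?(tens_mulDl, laa) //.
move: v; apply: tens_ext => [x y|x y|y1 y2]; rewrite ?(tens_mulDr, laa) //.
by rewrite tens_mulE !(tens_map_pure la la) tens_mulE !aM.
Qed.

End TensorNaturality.

Lemma tens_id_sum (R : comNzRingType) (M N : lmodType R) (u : tens M N) :
  tens_map id id u = u.
Proof. exact: tens_fold_id. Qed.

Section HomFacts.
Variables (R S : comNzRingType) (f : {rmorphism R -> S}).
Variables (A : bialgebra R) (B : bialgebra S) (phi : A -> B).
Hypothesis hphi : bialg_hom f phi.

Lemma bialg_hom_slin : slinear f phi. Proof. by case: hphi. Qed.
Lemma bialg_hom1 : phi 1 = 1. Proof. by case: hphi => _ []. Qed.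
Lemma bialg_homM x y : phi (x * y) = phi x * phi y. Proof. by case: hphi => _ [_ ->]. Qed.
Lemma bialg_hom_eps x : eps (phi x) = f (eps x). Proof. by case: hphi. Qed.
Lemma bialg_hom_cop x : cop (phi x) = tens_map phi phi (cop x). Proof. by case: hphi. Qed.

End HomFacts.

Lemma epsl_balanced (R : comNzRingType) (C : algType R) (e : {scalar C}) :
  balanced (fun a b : C => e a *: b).
Proof.
split=> [*|*|a x y]; first by rewrite linearD scalerDl.
  by rewrite scalerDr.
have -> : e (a *: x) = a * e x by exact: linearZ.
by rewrite scalerA mulrC.
Qed.

Lemma epsr_balanced (R : comNzRingType) (C : algType R) (e : {scalar C}) :
  balanced (fun a b : C => e b *: a).
Proof.
split=> [*|*|a x y]; first by rewrite scalerDr.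
  by rewrite linearD scalerDl.
have -> : e (a *: y) = a * e y by exact: linearZ.
by rewrite scalerA mulrC.
Qed.

(* A coalgebra-like structure on [A] that is mapped to the one of [B] by an
   injective morphism satisfies the axioms because [B] does. *)
Section Pullback.
Variables (R S : comNzRingType) (f : {rmorphism R -> S}).
Variables (A : algType R) (B : bialgebra S) (i : A -> B).
Variables (copA : {linear A -> tens A A}) (epsA : {scalar A}).
Hypotheses (injf : injective f) (li : slinear f i) (i1 : i 1 = 1).
Hypothesis iM : {morph i : x y / x * y}.
Hypotheses (inji : injective i) (inj2 : injective (tens_map i i)).
Hypothesis inj3 : injective (tens_map i (tens_map i i)).
Hypothesis icop : forall x, cop (i x) = tens_map i i (copA x).
Hypothesis ieps : forall x, eps (i x) = f (epsA x).

Let lii := tens_map_slin li li.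

Fact pullback_cop_assoc x :
  tens_assoc (tens_map copA idfun (copA x)) = tens_map idfun copA (copA x).
Proof.
apply: inj3; rewrite -(tens_assoc_map _ li li li).
rewrite !(tens_map_comp _ _ _ (g := f)) //.
have e1 : tens_map (tens_map i i \o copA) (i \o idfun) (copA x) =
    tens_map (cop \o i) (idfun \o i) (copA x).
  by apply: eq_tens_map => y //=; rewrite icop.
have e2 : tens_map (i \o idfun) (tens_map i i \o copA) (copA x) =
    tens_map (idfun \o i) (cop \o i) (copA x).
  by apply: eq_tens_map => y //=; rewrite icop.
have lc : slinear idfun (@cop S B) by exact: linear_slinear.
have lid : slinear idfun (@idfun B) by [].
rewrite e1 e2 -(tens_map_comp _ _ _ lc lid) -(tens_map_comp _ _ _ lid lc) -icop.
exact: cop_assoc.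
Qed.


Fact pullback_cop_epsl x : tens_fold (fun a b => epsA a *: b) (copA x) = x.
Proof.
apply: inji; rewrite -[RHS]cop_epsl icop tens_fold_map; last exact: epsl_balanced.
rewrite (tens_fold_comp _ _ (slin_add li)); apply: eq_tens_fold => a b.
by rewrite (slinZ li) ieps.
Qed.

Fact pullback_cop_epsr x : tens_fold (fun a b => epsA b *: a) (copA x) = x.
Proof.
apply: inji; rewrite -[RHS]cop_epsr icop tens_fold_map; last exact: epsr_balanced.
rewrite (tens_fold_comp _ _ (slin_add li)); apply: eq_tens_fold => a b.
by rewrite (slinZ li) ieps.
Qed.

Fact pullback_cop1 : copA 1 = pure 1 1.
Proof. by apply: inj2; rewrite -icop i1 cop1 (tens_map_pure li li) i1. Qed.

Fact pullback_copM x y : copA (x * y) = tens_mul (copA x) (copA y).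
Proof. by apply: inj2; rewrite (tens_mul_map _ _ li) // -!icop iM copM. Qed.

Fact pullback_eps1 : epsA 1 = 1.
Proof. by apply: injf; rewrite -ieps i1 eps1 rmorph1. Qed.

Fact pullback_epsM x y : epsA (x * y) = epsA x * epsA y.
Proof. by apply: injf; rewrite -ieps iM epsM !ieps rmorphM. Qed.

Definition pullback_bialgebra : bialgebra R :=
  Bialgebra pullback_cop_assoc pullback_cop_epsl pullback_cop_epsr
    pullback_cop1 pullback_copM pullback_eps1 pullback_epsM.

End Pullback.

Section SubBialgebra.
Variables (R S : idomainType) (f : {rmorphism R -> S}) (E : bialgebra S) (X : set E).

(** The coproduct is required to be a sum of pure tensors of [E ⊗ E] with entries in [X], since
    [X ⊗ X] is available only after [X] has been made a module. *)
Definition sub_bialg_closed :=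
  [/\ X 0 /\ forall a x y, X x -> X y -> X (f a *: x + y),
      X 1 /\ forall x y, X x -> X y -> X (x * y),
      forall x, X x -> exists a, eps x = f a
    & forall x, X x -> exists2 s : seq (E * E),
        forall p, p \in s -> X p.1 /\ X p.2 & cop x = \sum_(p <- s) pure p.1 p.2].

Hypotheses (eucl : euclid R) (locf : localizing f) (tfE : torsion_free E).
Hypothesis hX : sub_bialg_closed.

Let Xp : {pred E} := fun x => `[< X x >].

Let Xp_subring : subring_closed Xp.
Proof.
case: hX => [[X0 Xl] [X1 XM] _ _].
split=> [|x y /asboolP Xx /asboolP Xy|x y /asboolP Xx /asboolP Xy]; apply/asboolP => //.
  rewrite addrC -[- y]scaleN1r -(rmorphN1 f); exact: Xl.
exact: XM.
Qed.

HB.instance Definition _ := GRing.isSubringClosed.Build E Xp Xp_subring.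

Record sub_type := SubT { sub_val :> E; _ : sub_val \in Xp }.
HB.instance Definition _ := [isSub for sub_val].
HB.instance Definition _ := [Choice of sub_type by <:].
HB.instance Definition _ := [SubChoice_isSubNzRing of sub_type by <:].


Let Xval (x : sub_type) : X (sub_val x).
Proof. by case: x => x /= /asboolP. Qed.

Let mkX (x : E) (Xx : X x) : sub_type := SubT (introT (asboolP _) Xx).

Fact sub_scale_subproof (a : R) (x : sub_type) : X (f a *: sub_val x).
Proof. by case: hX => [[X0 Xl] _ _ _]; rewrite -[_ *: _]addr0; apply: Xl. Qed.

Definition sub_scale a x := mkX (sub_scale_subproof a x).

Fact sub_scaleA a b x : sub_scale a (sub_scale b x) = sub_scale (a * b) x.
Proof. by apply: val_inj; rewrite /= rmorphM scalerA. Qed.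

Fact sub_scale1 : left_id 1 sub_scale.
Proof. by move=> x; apply: val_inj; rewrite /= rmorph1 scale1r. Qed.

Fact sub_scaleDr : right_distributive sub_scale +%R.
Proof. by move=> a x y; apply: val_inj; rewrite /= scalerDr. Qed.

Fact sub_scaleDl x : {morph sub_scale^~ x : a b / a + b}.
Proof. by move=> a b; apply: val_inj; rewrite /= rmorphD scalerDl. Qed.

HB.instance Definition _ := GRing.Zmodule_isLmodule.Build R sub_type
  sub_scaleA sub_scale1 sub_scaleDr sub_scaleDl.

Fact sub_scaleAl (a : R) (x y : sub_type) : a *: (x * y) = (a *: x) * y.
Proof. by apply: val_inj; rewrite /= scalerAl. Qed.

HB.instance Definition _ := GRing.Lmodule_isLalgebra.Build R sub_type sub_scaleAl.

Fact sub_scaleAr (a : R) (x y : sub_type) : a *: (x * y) = x * (a *: y).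
Proof. by apply: val_inj; rewrite /= scalerAr. Qed.

HB.instance Definition _ := GRing.Lalgebra_isAlgebra.Build R sub_type sub_scaleAr.

Let sub_val_slin : slinear f (sub_val : sub_type -> E).
Proof. by []. Qed.

Let sub_val_inj : injective (sub_val : sub_type -> E).
Proof. exact: val_inj. Qed.

Let inj2 : injective (tens_map (sub_val : sub_type -> E) (sub_val : sub_type -> E)).
Proof. exact: (tens_map_inj eucl locf tfE tfE sub_val_slin sub_val_slin). Qed.

Let inj3 : injective (tens_map (sub_val : sub_type -> E)
  (tens_map (sub_val : sub_type -> E) (sub_val : sub_type -> E))).
Proof.
apply: (tens_map_inj eucl locf tfE _ sub_val_slin (tens_map_slin sub_val_slin sub_val_slin)) => //.
exact: (torsion_free_tens eucl locf).
Qed.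

Fact sub_cop_subproof (x : sub_type) : exists u : tens sub_type sub_type,
  tens_map (sub_val : sub_type -> E) (sub_val : sub_type -> E) u = cop (sub_val x).
Proof.
case: hX => [_ _ _ /(_ _ (Xval x)) [s hs ->]]; elim: s hs => [|p s IH] hs.
  by exists 0; rewrite big_nil (is_add0 (tens_map_add sub_val_slin sub_val_slin)).
have [|u eu] := IH; first by move=> q qs; apply: hs; rewrite inE qs orbT.
have [X1 X2] := hs p (mem_head _ _).
exists (pure (mkX X1) (mkX X2) + u).
rewrite big_cons (tens_map_add sub_val_slin sub_val_slin) eu.
by rewrite (tens_map_pure sub_val_slin sub_val_slin).
Qed.

(** The coproduct of [E] is lifted by choice. Injectivity of the tensor square of the inclusion
    makes the lift unique, from which its linearity follows. *)
Definition sub_cop x := projT1 (cid (sub_cop_subproof x)).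

Let sub_copE x : tens_map (sub_val : sub_type -> E) (sub_val : sub_type -> E) (sub_cop x)
  = cop (sub_val x).
Proof. by rewrite /sub_cop; case: (cid _). Qed.

Fact sub_cop_linear : linear sub_cop.
Proof.
move=> a x y; apply: inj2.
rewrite (tens_map_slin sub_val_slin sub_val_slin) !sub_copE.
by rewrite -linearP.
Qed.

HB.instance Definition _ :=
  GRing.isLinear.Build R sub_type (tens sub_type sub_type) *:%R sub_cop sub_cop_linear.

Fact sub_eps_subproof (x : sub_type) : exists a, eps (sub_val x) = f a.
Proof. by case: hX => _ _ h _; exact: h. Qed.

Definition sub_eps x : R := projT1 (cid (sub_eps_subproof x)).

Let sub_epsE x : eps (sub_val x) = f (sub_eps x).
Proof. by rewrite /sub_eps; case: (cid _). Qed.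

Fact sub_eps_linear : linear_for *%R sub_eps.
Proof.
move=> a x y; apply: (proj1 locf); rewrite rmorphD rmorphM -!sub_epsE.
exact: linearP.
Qed.

HB.instance Definition _ := GRing.isLinear.Build R sub_type R *%R sub_eps sub_eps_linear.

Lemma sub_bialgebra_exists : exists (A : bialgebra R) (i : A -> E), is_sub f i X.
Proof.
have injf : injective f by case: locf.
exists (pullback_bialgebra injf sub_val_slin erefl (fun _ _ => erefl) sub_val_inj inj2 inj3
  (fun x => esym (sub_copE x)) sub_epsE), sub_val; split.
- by split.
- exact: sub_val_inj.
- by apply/seteqP; split=> [_ [x _ <-]|x Xx]; [exact: Xval | exists (mkX Xx)].
Qed.

End SubBialgebra.

(** * Base change *)

Section BaseChange.
Variables (R S : comNzRingType) (f : {rmorphism R -> S}) (A : bialgebra R).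

Local Notation Sf := (restrict_scalars f).
(** The alias keeps the additive group of the tensor product but not its [R]-module structure,
    leaving room for the one over [S]. *)
Definition bc_type := tens Sf A.
Implicit Types (c d : S) (x y : A) (u v w : bc_type).

HB.instance Definition _ := GRing.Zmodule.on bc_type.

Definition bc_pure c x : bc_type := pure (c : Sf) x.

Let bc_ext (P : zmodType) (F G : bc_type -> P) : is_add F -> is_add G ->
  (forall c x, F (bc_pure c x) = G (bc_pure c x)) -> F =1 G.
Proof. exact: tens_ext. Qed.

Let bc_pureDl c d x : bc_pure (c + d) x = bc_pure c x + bc_pure d x.
Proof. exact: pureDl. Qed.

Let bc_pureDr c x y : bc_pure c (x + y) = bc_pure c x + bc_pure c y.
Proof. exact: pureDr. Qed.

Let bc_pureZ (a : R) c x : bc_pure c (a *: x) = bc_pure (f a * c) x.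
Proof. by apply/tens_clsP; apply: TensSym; exact: (@TensZ _ Sf A). Qed.

Let bc_balanced (P : zmodType) (g : S -> A -> P) :
  (forall c d x, g (c + d) x = g c x + g d x) ->
  (forall c x y, g c (x + y) = g c x + g c y) ->
  (forall a c x, g (f a * c) x = g c (a *: x)) -> balanced (g : Sf -> A -> P).
Proof. by move=> g1 g2 g3; split. Qed.

Definition bc_scale c u : bc_type := tens_map ( *%R c : Sf -> Sf) (idfun : A -> A) u.

Let bc_mull_slin c : slinear idfun ( *%R c : Sf -> Sf).
Proof. by move=> a d e; rewrite mulrDr; congr (_ + _); exact: mulrCA. Qed.

Let bc_scale_add c : is_add (bc_scale c).
Proof. exact: (tens_map_add (bc_mull_slin c) (@slinear_id _ _)). Qed.

Let bc_scale_pure c d x : bc_scale c (bc_pure d x) = bc_pure (c * d) x.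
Proof. exact: (tens_map_pure (bc_mull_slin c) (@slinear_id _ _)). Qed.

Fact bc_scaleA c d u : bc_scale c (bc_scale d u) = bc_scale (c * d) u.
Proof.
move: u; apply: bc_ext => [u v|u v|e x]; first by rewrite !bc_scale_add.
  by rewrite !bc_scale_add.
by rewrite !bc_scale_pure mulrA.
Qed.

Fact bc_scale1 : left_id 1 bc_scale.
Proof.
by apply: bc_ext => [u v|u v|e x]; rewrite ?bc_scale_add // bc_scale_pure mul1r.
Qed.

Fact bc_scaleDr : right_distributive bc_scale +%R.
Proof. by move=> c u v; rewrite bc_scale_add. Qed.

Fact bc_scaleDl u : {morph bc_scale^~ u : c d / c + d}.
Proof.
move=> c d; move: u; apply: bc_ext => [u v|u v|e x].
- by rewrite !bc_scale_add.
- by rewrite !bc_scale_add addrACA.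
- by rewrite !bc_scale_pure mulrDl bc_pureDl.
Qed.

HB.instance Definition _ := GRing.Zmodule_isLmodule.Build S bc_type
  bc_scaleA bc_scale1 bc_scaleDr bc_scaleDl.

Definition bc_inj x := bc_pure 1 x.

Let bc_pureE c x : bc_pure c x = c *: bc_inj x.
Proof. by rewrite -[RHS]/(bc_scale _ _) bc_scale_pure mulr1. Qed.

Let bc_inj_slin : slinear f bc_inj.
Proof.
apply: mk_slinear => [x y|a x]; first exact: bc_pureDr.
by rewrite -bc_pureE /bc_inj bc_pureZ mulr1.
Qed.

Let bc_ext_slin (P : lmodType S) (F G : bc_type -> P) :
  slinear idfun F -> slinear idfun G -> (forall x, F (bc_inj x) = G (bc_inj x)) -> F =1 G.
Proof.
move=> lF lG FG; apply: (bc_ext (slin_add lF) (slin_add lG)) => c x.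
by rewrite bc_pureE (slinZ lF) (slinZ lG) FG.
Qed.

Section Lift.
Variables (P : lmodType S) (g : A -> P).
Hypothesis lg : slinear f g.

Definition bc_lift u : P := tens_fold (fun (c : Sf) x => (c : S) *: g x) u.

Let lift_balanced : balanced (fun (c : Sf) x => (c : S) *: g x).
Proof.
apply: (@bc_balanced P (fun c x => c *: g x)) => *; first by rewrite scalerDl.
  by rewrite (slin_add lg) scalerDr.
by rewrite (slinZ lg) scalerA mulrC.
Qed.

Lemma bc_lift_pure c x : bc_lift (bc_pure c x) = c *: g x.
Proof. exact: tens_foldE. Qed.

Lemma bc_lift_slin : slinear idfun bc_lift.
Proof.
have liftD : is_add bc_lift := tens_fold_add lift_balanced.
apply: mk_slinear => // a; apply: bc_ext => [u v|u v|c x]; first by rewrite scalerDr liftD.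
  by rewrite liftD scalerDr.
by rewrite -[a *: _ in LHS]/(bc_scale _ _) bc_scale_pure !bc_lift_pure scalerA.
Qed.

Lemma bc_lift_inj x : bc_lift (bc_inj x) = g x.
Proof. by rewrite bc_lift_pure scale1r. Qed.

End Lift.

Let bc_mul_bal1 c x : balanced (fun (d : Sf) y => bc_pure (c * d) (x * y)).
Proof.
apply: (@bc_balanced bc_type (fun d y => bc_pure (c * d) (x * y))) => *.
- by rewrite mulrDr bc_pureDl.
- by rewrite mulrDr bc_pureDr.
- by rewrite -scalerAr bc_pureZ mulrCA.
Qed.

Let bc_mul_bal2 v :
  balanced (fun (c : Sf) x => tens_fold (fun (d : Sf) y => bc_pure (c * d) (x * y)) v).
Proof.
apply: (@bc_balanced bc_type
  (fun c x => tens_fold (fun (d : Sf) y => bc_pure (c * d) (x * y)) v)) => *;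
  rewrite -?tens_foldD; apply: eq_tens_fold => d y.
- by rewrite mulrDl bc_pureDl.
- by rewrite mulrDl bc_pureDr.
- by rewrite -scalerAl bc_pureZ mulrA.
Qed.

Definition bc_mul u v : bc_type :=
  tens_fold (fun (c : Sf) x => tens_fold (fun (d : Sf) y => bc_pure (c * d) (x * y)) v) u.

Let bc_mul_pure c x d y : bc_mul (bc_pure c x) (bc_pure d y) = bc_pure (c * d) (x * y).
Proof.
rewrite /bc_mul tens_foldE; last exact: bc_mul_bal2.
by rewrite tens_foldE //; exact: bc_mul_bal1.
Qed.

Fact bc_mulDl : left_distributive bc_mul +%R.
Proof. by move=> u v w; exact: (tens_fold_add (bc_mul_bal2 w)). Qed.

Fact bc_mulDr : right_distributive bc_mul +%R.
Proof.
move=> u v w; rewrite /bc_mul -tens_foldD; apply: eq_tens_fold => c x.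
exact: (tens_fold_add (bc_mul_bal1 c x)).
Qed.

Fact bc_mulA : associative bc_mul.
Proof.
move=> u v w.
move: u; apply: bc_ext => [x y|x y|a b]; rewrite ?bc_mulDl //.
move: v; apply: bc_ext => [x y|x y|c d]; rewrite ?(bc_mulDl, bc_mulDr) //.
move: w; apply: bc_ext => [x y|x y|e g]; rewrite ?(bc_mulDl, bc_mulDr) //.
by rewrite !bc_mul_pure !mulrA.
Qed.

Fact bc_mul1r : left_id (bc_pure 1 1) bc_mul.
Proof.
apply: bc_ext => [u v|//|c x]; first exact: bc_mulDr.
by rewrite bc_mul_pure !mul1r.
Qed.

Fact bc_mulr1 : right_id (bc_pure 1 1) bc_mul.
Proof.
apply: bc_ext => [u v|//|c x]; first exact: bc_mulDl.
by rewrite bc_mul_pure !mulr1.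
Qed.

Let eps_slin : slinear f (fun x => f (eps x) : S^o).
Proof. by move=> a x y; rewrite linearP rmorphD rmorphM. Qed.

Definition bc_eps (u : bc_type) : S := bc_lift (fun x => f (eps x) : S^o) u.

Let bc_eps_pure c x : bc_eps (bc_pure c x) = c * f (eps x).
Proof. exact: (bc_lift_pure eps_slin). Qed.

(** The counit separates [1 ⊗ 1] from 0. *)
Fact bc_oner_neq0 : bc_pure 1 1 != 0.
Proof.
apply/eqP => /(congr1 bc_eps); rewrite bc_eps_pure eps1 rmorph1 mulr1.
rewrite [RHS](is_add0 (slin_add (bc_lift_slin eps_slin))).
by move/eqP; rewrite oner_eq0.
Qed.

HB.instance Definition _ := GRing.Zmodule_isNzRing.Build bc_type
  bc_mulA bc_mul1r bc_mulr1 bc_mulDl bc_mulDr bc_oner_neq0.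

Fact bc_scaleAl c u v : c *: (u * v) = (c *: u) * v.
Proof.
move: u; apply: bc_ext => [x y|x y|a b]; rewrite ?(mulrDl, scalerDr) //.
move: v; apply: bc_ext => [x y|x y|d e]; rewrite ?(mulrDr, scalerDr) //.
rewrite -[c *: bc_pure _ _]/(bc_scale _ _) -[c *: _]/(bc_scale _ _) bc_scale_pure.
by rewrite -![bc_pure _ _ * _]/(bc_mul _ _) !bc_mul_pure bc_scale_pure mulrA.
Qed.

HB.instance Definition _ := GRing.Lmodule_isLalgebra.Build S bc_type bc_scaleAl.

Fact bc_scaleAr c u v : c *: (u * v) = u * (c *: v).
Proof.
move: u; apply: bc_ext => [x y|x y|a b]; rewrite ?(mulrDl, scalerDr) //.
move: v; apply: bc_ext => [x y|x y|d e]; rewrite ?(mulrDr, scalerDr) //.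
rewrite -[c *: bc_pure _ _]/(bc_scale _ _) -[c *: _]/(bc_scale _ _) bc_scale_pure.
by rewrite -![bc_pure _ _ * _]/(bc_mul _ _) !bc_mul_pure bc_scale_pure mulrCA.
Qed.

HB.instance Definition _ := GRing.Lalgebra_isAlgebra.Build S bc_type bc_scaleAr.

Let bc_injM : {morph bc_inj : x y / x * y}.
Proof. by move=> x y; rewrite -[RHS]/(bc_mul _ _) bc_mul_pure mulr1. Qed.

Fact bc_eps_linear : linear_for *%R bc_eps.
Proof. exact: (bc_lift_slin eps_slin). Qed.

HB.instance Definition _ := GRing.isLinear.Build S bc_type S *%R bc_eps bc_eps_linear.

Let bc_inj2_slin := tens_map_slin bc_inj_slin bc_inj_slin.

Let cop_slin : slinear f (fun x => tens_map bc_inj bc_inj (cop x)).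
Proof. by move=> a x y; rewrite linearP bc_inj2_slin. Qed.

Definition bc_cop := bc_lift (fun x => tens_map bc_inj bc_inj (cop x)).

Fact bc_cop_linear : linear bc_cop.
Proof. exact: (bc_lift_slin cop_slin). Qed.

HB.instance Definition _ :=
  GRing.isLinear.Build S bc_type (tens bc_type bc_type) *:%R bc_cop bc_cop_linear.

Let bc_cop_inj x : bc_cop (bc_inj x) = tens_map bc_inj bc_inj (cop x).
Proof. exact: (bc_lift_inj cop_slin). Qed.

Let bc_eps_inj x : bc_eps (bc_inj x) = f (eps x).
Proof. exact: (bc_lift_inj eps_slin). Qed.

Let lcop : slinear idfun (bc_cop : bc_type -> tens bc_type bc_type).
Proof. by move=> a x y; exact: bc_cop_linear. Qed.

Let lid : slinear idfun (idfun : bc_type -> bc_type).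
Proof. by []. Qed.

Fact bc_cop_assoc u :
  tens_assoc (tens_map bc_cop idfun (bc_cop u)) = tens_map idfun bc_cop (bc_cop u).
Proof.
move: u; apply: bc_ext_slin => [a u v|a u v|x].
- by rewrite lcop (tens_map_slin lcop lid) tens_assoc_slin.
- by rewrite lcop (tens_map_slin lid lcop).
rewrite bc_cop_inj (tens_map_comp _ _ _ lcop lid) (tens_map_comp _ _ _ lid lcop).
have e1 : tens_map (bc_cop \o bc_inj) (idfun \o bc_inj) (cop x) =
    tens_map (tens_map bc_inj bc_inj \o cop) (bc_inj \o idfun) (cop x).
  by apply: eq_tens_map => // y /=.
have e2 : tens_map (idfun \o bc_inj) (bc_cop \o bc_inj) (cop x) =
    tens_map (bc_inj \o idfun) (tens_map bc_inj bc_inj \o cop) (cop x).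
  by apply: eq_tens_map => // y /=.
rewrite e1 e2 -(tens_map_comp _ _ _ bc_inj2_slin bc_inj_slin).
rewrite -(tens_map_comp _ _ _ bc_inj_slin bc_inj2_slin).
by rewrite (tens_assoc_map _ bc_inj_slin bc_inj_slin bc_inj_slin) cop_assoc.
Qed.

Fact bc_cop_epsl u : tens_fold (fun a b : bc_type => bc_eps a *: b) (bc_cop u) = u.
Proof.
have bal : balanced (fun a b : bc_type => bc_eps a *: b) by exact: epsl_balanced.
move: u; apply: bc_ext_slin => // [|x].
  move=> a u v; rewrite lcop; apply: (tens_fold_slin (f := idfun) bal) => b y z.
  by rewrite [bc_eps _]linearZ scalerA.
rewrite bc_cop_inj tens_fold_map // -[in RHS](cop_epsl x).
rewrite (tens_fold_comp _ _ (slin_add bc_inj_slin)); apply: eq_tens_fold => y z.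
by rewrite (slinZ bc_inj_slin) bc_eps_inj.
Qed.

Fact bc_cop_epsr u : tens_fold (fun a b : bc_type => bc_eps b *: a) (bc_cop u) = u.
Proof.
have bal : balanced (fun a b : bc_type => bc_eps b *: a) by exact: epsr_balanced.
move: u; apply: bc_ext_slin => // [|x].
  move=> a u v; rewrite lcop; apply: (tens_fold_slin (f := idfun) bal) => b y z.
  by rewrite !scalerA mulrC.
rewrite bc_cop_inj tens_fold_map // -[in RHS](cop_epsr x).
rewrite (tens_fold_comp _ _ (slin_add bc_inj_slin)); apply: eq_tens_fold => y z.
by rewrite (slinZ bc_inj_slin) bc_eps_inj.
Qed.

Fact bc_cop1 : bc_cop 1 = pure 1 1.
Proof. by rewrite -[1]/(bc_inj 1) bc_cop_inj cop1 (tens_map_pure bc_inj_slin bc_inj_slin). Qed.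

Fact bc_copM u v : bc_cop (u * v) = tens_mul (bc_cop u) (bc_cop v).
Proof.
move: u; apply: bc_ext_slin => [a x y|a x y|x].
- by rewrite mulrDl -scalerAl lcop.
- by rewrite lcop tens_mulDl tens_mulZl.
move: v; apply: bc_ext_slin => [a y z|a y z|y].
- by rewrite mulrDr -scalerAr lcop.
- by rewrite lcop tens_mulDr tens_mulZr.
by rewrite -bc_injM !bc_cop_inj copM (tens_mul_map _ _ bc_inj_slin).
Qed.

Fact bc_eps1 : bc_eps 1 = 1.
Proof. by rewrite -[1]/(bc_inj 1) bc_eps_inj eps1 rmorph1. Qed.

Fact bc_epsM u v : bc_eps (u * v) = bc_eps u * bc_eps v.
Proof.
have leps : slinear idfun (bc_eps : bc_type -> S^o) by move=> a x y; exact: bc_eps_linear.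
move: u; apply: (@bc_ext_slin S^o) => [a x y|a x y|x].
- by rewrite mulrDl -scalerAl leps.
- by rewrite leps mulrDl -mulrA.
move: v; apply: (@bc_ext_slin S^o) => [a y z|a y z|y].
- by rewrite mulrDr -scalerAr leps.
- by rewrite leps mulrDr; congr (_ + _); rewrite mulrCA.
by rewrite -bc_injM !bc_eps_inj epsM rmorphM.
Qed.

Definition base_change : bialgebra S :=
  Bialgebra bc_cop_assoc bc_cop_epsl bc_cop_epsr bc_cop1 bc_copM bc_eps1 bc_epsM.

Lemma base_change_exists : exists (E : bialgebra S) (iota : A -> E), is_base_change f iota.
Proof.
exists base_change, bc_inj; split.
  by split=> //; exact: bc_inj_slin.
have e u : bc_lift bc_inj u = u.
  apply: (bc_ext_slin (bc_lift_slin bc_inj_slin)) => // x.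
  by rewrite (bc_lift_inj bc_inj_slin).
by exists id => u; exact: e.
Qed.

End BaseChange.

(** * Quotient bialgebras *)

Section QuotientBialgebra.
Variables (R : comNzRingType) (B : bialgebra R) (I : set B).
Hypotheses (hI : submod I) (Il : forall x y, I y -> I (x * y)).
Hypotheses (Ir : forall x y, I x -> I (x * y)) (Ieps : forall x, I x -> eps x = 0).
(** The coideal condition [Δ I ⊆ I ⊗ B + B ⊗ I], phrased through the kernel of [p ⊗ p]. The map [p]
    is an arbitrary surjection with kernel [I], because the quotient is not yet constructed. *)
Hypothesis Icop : forall (V : lmodType R) (p : B -> V),
  slinear idfun p -> (forall x, exists y, p y = x) -> (forall x, p x = 0 <-> I x) ->
  forall x, I x -> tens_map p p (cop x) = 0.

(** A representative that depends only on the coset: [xget] is applied to the coset itself, and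
    equal sets give equal choices. The quotient is realised as the type of fixed points of [rep]. *)
Let rep (x : B) : B := xget 0 [set y | I (x - y)].

Let rep_mem x : I (x - rep x).
Proof.
rewrite /rep; case: xgetP => [y _ //|/(_ x)[]] /=.
by rewrite subrr; case: hI.
Qed.

Let rep_eq x y : I (x - y) -> rep x = rep y.
Proof.
move=> Ixy; rewrite /rep; congr (xget _ _); apply/seteqP; split=> z /= h.
  rewrite -(subrKA x); apply: submodD => //.
  by rewrite -opprB; apply: submodN.
by rewrite -(subrKA y); apply: submodD.
Qed.

Record quot_type := QuotT { quot_val :> B; _ : rep quot_val == quot_val }.
HB.instance Definition _ := [isSub for quot_val].
HB.instance Definition _ := [Choice of quot_type by <:].

Fact quot_proj_subproof x : rep (rep x) == rep x.
Proof. by apply/eqP/esym/rep_eq/rep_mem. Qed.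

Definition quot_proj x := QuotT (quot_proj_subproof x).
Local Notation p := quot_proj.

Let pP x y : p x = p y <-> I (x - y).
Proof.
split=> [/(congr1 quot_val) /= e|h]; last by apply: val_inj => /=; exact: rep_eq.
rewrite -(subrKA (rep x)); apply: submodD => //.
by rewrite e -opprB; apply: submodN.
Qed.

Let pK (u : quot_type) : p (quot_val u) = u.
Proof. by apply: val_inj => /=; case: u => x /= /eqP. Qed.

Let p_ind (Q : quot_type -> Prop) : (forall x, Q (p x)) -> forall u, Q u.
Proof. by move=> h u; rewrite -(pK u). Qed.

Definition quot_add (u v : quot_type) := p (quot_val u + quot_val v).
Definition quot_opp (u : quot_type) := p (- quot_val u).
Definition quot_mul (u v : quot_type) := p (quot_val u * quot_val v).
Definition quot_scale (a : R) (u : quot_type) := p (a *: quot_val u).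

Let I_rep x : I (rep x - x).
Proof. by rewrite -opprB; apply: submodN. Qed.

Let addE x y : quot_add (p x) (p y) = p (x + y).
Proof. by apply/pP; rewrite /= opprD addrACA; apply: submodD. Qed.

Let oppE x : quot_opp (p x) = p (- x).
Proof. by apply/pP; rewrite /= opprK addrC. Qed.

Let mulE x y : quot_mul (p x) (p y) = p (x * y).
Proof.
apply/pP => /=; rewrite -(subrKA (rep x * y)) -mulrBr -mulrBl.
by apply: submodD; [|apply: Il|apply: Ir].
Qed.

Let scaleE a x : quot_scale a (p x) = p (a *: x).
Proof. by apply/pP; rewrite /= -scalerBr; apply: submodZ. Qed.

Fact quot_addA : associative quot_add.
Proof. by elim/p_ind=> x; elim/p_ind=> y; elim/p_ind=> z; rewrite !addE addrA. Qed.
Fact quot_addC : commutative quot_add.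
Proof. by elim/p_ind=> x; elim/p_ind=> y; rewrite !addE addrC. Qed.
Fact quot_add0 : left_id (p 0) quot_add.
Proof. by elim/p_ind=> x; rewrite addE add0r. Qed.
Fact quot_addN : left_inverse (p 0) quot_opp quot_add.
Proof. by elim/p_ind=> x; rewrite oppE addE addNr. Qed.

HB.instance Definition _ :=
  GRing.isZmodule.Build quot_type quot_addA quot_addC quot_add0 quot_addN.

Fact quot_mulA : associative quot_mul.
Proof. by elim/p_ind=> x; elim/p_ind=> y; elim/p_ind=> z; rewrite !mulE mulrA. Qed.
Fact quot_mul1r : left_id (p 1) quot_mul.
Proof. by elim/p_ind=> x; rewrite mulE mul1r. Qed.
Fact quot_mulr1 : right_id (p 1) quot_mul.
Proof. by elim/p_ind=> x; rewrite mulE mulr1. Qed.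
Fact quot_mulDl : left_distributive quot_mul +%R.
Proof.
elim/p_ind=> x; elim/p_ind=> y; elim/p_ind=> z.
by rewrite -![_ + _]/(quot_add _ _) !(mulE, addE) mulrDl.
Qed.
Fact quot_mulDr : right_distributive quot_mul +%R.
Proof.
elim/p_ind=> x; elim/p_ind=> y; elim/p_ind=> z.
by rewrite -![_ + _]/(quot_add _ _) !(mulE, addE) mulrDr.
Qed.
Fact quot_oner_neq0 : p 1 != p 0.
Proof.
apply/eqP => /pP; rewrite subr0 => /Ieps /eqP.
by rewrite eps1 oner_eq0.
Qed.

HB.instance Definition _ := GRing.Zmodule_isNzRing.Build quot_type
  quot_mulA quot_mul1r quot_mulr1 quot_mulDl quot_mulDr quot_oner_neq0.

Fact quot_scaleA a b u : quot_scale a (quot_scale b u) = quot_scale (a * b) u.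
Proof. by elim/p_ind: u => x; rewrite !scaleE scalerA. Qed.
Fact quot_scale1 : left_id 1 quot_scale.
Proof. by elim/p_ind=> x; rewrite scaleE scale1r. Qed.
Fact quot_scaleDr : right_distributive quot_scale +%R.
Proof.
move=> a; elim/p_ind=> x; elim/p_ind=> y.
by rewrite -![_ + _]/(quot_add _ _) !(scaleE, addE) scalerDr.
Qed.
Fact quot_scaleDl u : {morph quot_scale^~ u : a b / a + b}.
Proof.
move=> a b; elim/p_ind: u => x.
by rewrite -[RHS]/(quot_add _ _) !(scaleE, addE) scalerDl.
Qed.

HB.instance Definition _ := GRing.Zmodule_isLmodule.Build R quot_type
  quot_scaleA quot_scale1 quot_scaleDr quot_scaleDl.

Fact quot_scaleAl (a : R) (u v : quot_type) : a *: (u * v) = (a *: u) * v.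
Proof.
elim/p_ind: u => x; elim/p_ind: v => y.
by rewrite -![_ * _]/(quot_mul _ _) -![a *: _]/(quot_scale _ _) !(scaleE, mulE) scalerAl.
Qed.

HB.instance Definition _ := GRing.Lmodule_isLalgebra.Build R quot_type quot_scaleAl.

Fact quot_scaleAr (a : R) (u v : quot_type) : a *: (u * v) = u * (a *: v).
Proof.
elim/p_ind: u => x; elim/p_ind: v => y.
by rewrite -![_ * _]/(quot_mul _ _) -![a *: _]/(quot_scale _ _) !(scaleE, mulE) scalerAr.
Qed.

HB.instance Definition _ := GRing.Lalgebra_isAlgebra.Build R quot_type quot_scaleAr.

Let p_slin : slinear idfun p.
Proof. by move=> a x y; rewrite -[RHS]/(quot_add (quot_scale _ _) _) scaleE addE. Qed.

Let pM : {morph p : x y / x * y}.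
Proof. by move=> x y; rewrite -[RHS]/(quot_mul _ _) mulE. Qed.

Let p0P x : p x = 0 <-> I x.
Proof. by rewrite -[X in I X]subr0; exact: pP. Qed.

Let pp := tens_map_slin p_slin p_slin.

Definition quot_cop (u : quot_type) : tens quot_type quot_type :=
  tens_map p p (cop (quot_val u)).

Definition quot_eps (u : quot_type) : R := eps (quot_val u).

Let quot_copE x : quot_cop (p x) = tens_map p p (cop x).
Proof.
apply/eqP; rewrite -subr_eq0 /quot_cop -(is_addB (slin_add pp)) -linearB /=.
apply/eqP; apply: (Icop p_slin _ p0P (I_rep x)).
by move=> u; exists (quot_val u).
Qed.

Let quot_epsE x : quot_eps (p x) = eps x.
Proof. by apply/eqP; rewrite -subr_eq0 -linearB; apply/eqP/Ieps/I_rep. Qed.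

Fact quot_cop_linear : linear quot_cop.
Proof.
move=> a; elim/p_ind=> x; elim/p_ind=> y.
by rewrite -p_slin !quot_copE linearP pp.
Qed.

Fact quot_eps_linear : linear_for *%R quot_eps.
Proof.
move=> a; elim/p_ind=> x; elim/p_ind=> y.
by rewrite -p_slin !quot_epsE linearP.
Qed.

HB.instance Definition _ :=
  GRing.isLinear.Build R quot_type (tens quot_type quot_type) *:%R quot_cop quot_cop_linear.
HB.instance Definition _ := GRing.isLinear.Build R quot_type R *%R quot_eps quot_eps_linear.

Let lcop : slinear idfun (quot_cop : quot_type -> tens quot_type quot_type).
Proof. by move=> a x y; exact: quot_cop_linear. Qed.

Let lid : slinear idfun (idfun : quot_type -> quot_type).
Proof. by []. Qed.

Fact quot_cop_assoc u :
  tens_assoc (tens_map quot_cop idfun (quot_cop u)) = tens_map idfun quot_cop (quot_cop u).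
Proof.
elim/p_ind: u => x.
rewrite quot_copE (tens_map_comp _ _ _ lcop lid) (tens_map_comp _ _ _ lid lcop).
have e1 : tens_map (quot_cop \o p) (idfun \o p) (cop x) =
    tens_map (tens_map p p \o cop) (p \o idfun) (cop x).
  by apply: eq_tens_map => // y /=.
have e2 : tens_map (idfun \o p) (quot_cop \o p) (cop x) =
    tens_map (p \o idfun) (tens_map p p \o cop) (cop x).
  by apply: eq_tens_map => // y /=.
rewrite e1 e2 -(tens_map_comp _ _ _ pp p_slin) -(tens_map_comp _ _ _ p_slin pp).
by rewrite (tens_assoc_map _ p_slin p_slin p_slin) cop_assoc.
Qed.

Fact quot_cop_epsl u : tens_fold (fun a b : quot_type => quot_eps a *: b) (quot_cop u) = u.
Proof.
have bal : balanced (fun a b : quot_type => quot_eps a *: b) by exact: epsl_balanced.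
elim/p_ind: u => x; rewrite quot_copE tens_fold_map // -[in RHS](cop_epsl x).
rewrite (tens_fold_comp _ _ (slin_add p_slin)); apply: eq_tens_fold => y z.
by rewrite (slinZ p_slin) quot_epsE.
Qed.

Fact quot_cop_epsr u : tens_fold (fun a b : quot_type => quot_eps b *: a) (quot_cop u) = u.
Proof.
have bal : balanced (fun a b : quot_type => quot_eps b *: a) by exact: epsr_balanced.
elim/p_ind: u => x; rewrite quot_copE tens_fold_map // -[in RHS](cop_epsr x).
rewrite (tens_fold_comp _ _ (slin_add p_slin)); apply: eq_tens_fold => y z.
by rewrite (slinZ p_slin) quot_epsE.
Qed.

Fact quot_cop1 : quot_cop 1 = pure 1 1.
Proof. by rewrite -[1]/(p 1) quot_copE cop1 (tens_map_pure p_slin p_slin). Qed.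

Fact quot_copM u v : quot_cop (u * v) = tens_mul (quot_cop u) (quot_cop v).
Proof.
elim/p_ind: u => x; elim/p_ind: v => y.
by rewrite -pM !quot_copE copM (tens_mul_map _ _ p_slin).
Qed.

Fact quot_eps1 : quot_eps 1 = 1.
Proof. by rewrite -[1]/(p 1) quot_epsE eps1. Qed.

Fact quot_epsM u v : quot_eps (u * v) = quot_eps u * quot_eps v.
Proof. by elim/p_ind: u => x; elim/p_ind: v => y; rewrite -pM !quot_epsE epsM. Qed.

Definition quotient_bialgebra : bialgebra R :=
  Bialgebra quot_cop_assoc quot_cop_epsl quot_cop_epsr quot_cop1 quot_copM quot_eps1 quot_epsM.

Lemma quotient_bialgebra_exists : exists (V : bialgebra R) (pi : B -> V), is_quotient idfun pi I.
Proof.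
exists quotient_bialgebra, p; split.
- by split.
- by apply/seteqP; split=> // u _; exists (quot_val u).
- by apply/seteqP; split=> x /p0P.
Qed.

End QuotientBialgebra.

(** * Antipodes *)

Lemma eps_slin (R : comNzRingType) (A : bialgebra R) : slinear idfun (eps : A -> R^o).
Proof. by move=> a x y; rewrite linearP. Qed.

Lemma cop_slin (R : comNzRingType) (A : bialgebra R) : slinear idfun (@cop R A).
Proof. exact: linear_slinear. Qed.

Section Sweedler.
Variables (R : comNzRingType) (A : bialgebra R).
Implicit Types (x y : A) (P : zmodType).

(* [sw x (fun a b => g a b)] is Sweedler's sum of the [g x_(1) x_(2)]. *)
Definition sw P x (g : A -> A -> P) : P := tens_fold g (cop x).

Lemma eq_sw P x (g h : A -> A -> P) : (forall a b, g a b = h a b) -> sw x g = sw x h.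
Proof. exact: eq_tens_fold. Qed.

Lemma sw_comp P P' (F : P -> P') x (g : A -> A -> P) :
  is_add F -> F (sw x g) = sw x (fun a b => F (g a b)).
Proof. exact: tens_fold_comp. Qed.

Lemma sw_exchange P x y (h : A -> A -> A -> A -> P) :
  sw x (fun a b => sw y (fun c d => h a b c d)) = sw y (fun c d => sw x (fun a b => h a b c d)).
Proof. exact: tens_fold_exchange. Qed.

Lemma sw_pure x : sw x (fun a b => pure a b) = cop x.
Proof. exact: tens_fold_id. Qed.

Lemma sw_add P (g : A -> A -> P) : balanced g -> is_add (fun x => sw x g).
Proof. by move=> gB x y; rewrite /sw linearD (tens_fold_add gB). Qed.

Lemma swD P x (g h : A -> A -> P) : sw x (fun a b => g a b + h a b) = sw x g + sw x h.
Proof. exact: tens_foldD. Qed.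

Lemma swZ (P : lmodType R) (g : A -> A -> P) a x :
  balanced g -> (forall a x y, g (a *: x) y = a *: g x y) -> sw (a *: x) g = a *: sw x g.
Proof.
move=> gB gZ; rewrite /sw linearZ.
by rewrite (slinZ (f := idfun) (tens_fold_slin gB (gZ : forall a x y, _ = (idfun a) *: _))).
Qed.

Lemma sw1 P (g : A -> A -> P) : balanced g -> sw 1 g = g 1 1.
Proof. by move=> gB; rewrite /sw cop1 tens_foldE. Qed.

Lemma swM P x y (g : A -> A -> P) : balanced g ->
  sw (x * y) g = sw x (fun a b => sw y (fun c d => g (a * c) (b * d))).
Proof.
move=> gB; rewrite /sw copM /tens_mul (tens_fold_comp _ _ (tens_fold_add gB)).
apply: eq_tens_fold => a b; rewrite (tens_fold_comp _ _ (tens_fold_add gB)).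
by apply: eq_tens_fold => c d; rewrite tens_foldE.
Qed.

Lemma sw_epsl P (g : A -> P) x : is_add g -> sw x (fun a b => g (eps a *: b)) = g x.
Proof. by move=> gD; rewrite -(sw_comp x (fun a b => eps a *: b) gD) /sw cop_epsl. Qed.

Lemma sw_epsr P (g : A -> P) x : is_add g -> sw x (fun a b => g (eps b *: a)) = g x.
Proof. by move=> gD; rewrite -(sw_comp x (fun a b => eps b *: a) gD) /sw cop_epsr. Qed.

(** The trilinear [T] is evaluated on both sides of [cop_assoc]. Balance in the two adjacent pairs
    of arguments is what makes [T] a map on the triple tensor product. *)
Lemma sw_coassoc P (T : A -> A -> A -> P) x :
  (forall c, balanced (fun a b => T a b c)) -> (forall a, balanced (T a)) ->
  sw x (fun y c => sw y (fun a b => T a b c)) = sw x (fun a y => sw y (fun b c => T a b c)).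
Proof.
move=> T12 T23.
have G1 : balanced (fun (w : tens A A) c => tens_fold (fun a b => T a b c) w).
  split=> [u v c|u c1 c2|a u c].
  - exact: (tens_fold_add (T12 c)).
  - by rewrite -tens_foldD; apply: eq_tens_fold => a b; case: (T23 a) => _ ->.
  - have e1 : is_add (fun u => tens_fold (fun a b => T a b c) (a *: u)).
      by move=> v w; rewrite scalerDr (tens_fold_add (T12 c)).
    have e2 := tens_fold_add (T12 (a *: c)).
    move: u; apply: (tens_ext e1 e2) => b d.
    rewrite -pureZr !tens_foldE //; case: (T23 b) => _ _.
    by rewrite -[X in X -> _]/(forall a x y, T b (a *: x) y = T b x (a *: y)); apply.
have G2 : balanced (fun a (w : tens A A) => tens_fold (fun b c => T a b c) w).
  split=> [a1 a2 w|a u v|r a w].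
  - by rewrite -tens_foldD; apply: eq_tens_fold => b c; case: (T12 c) => ->.
  - exact: (tens_fold_add (T23 a)).
  - have e1 := tens_fold_add (T23 (r *: a)).
    have e2 : is_add (fun u => tens_fold (T a) (r *: u)).
      by move=> v u; rewrite scalerDr (tens_fold_add (T23 a)).
    move: w; apply: (tens_ext e1 e2) => b d.
    by rewrite -pureZl !tens_foldE //; case: (T12 d).
transitivity (tens_fold (fun a w => tens_fold (fun b c => T a b c) w)
    (tens_map idfun cop (cop x))); last by rewrite tens_fold_map.
rewrite -cop_assoc.
rewrite /tens_assoc (tens_fold_comp _ _ (tens_fold_add G2)).
transitivity (tens_fold (fun (w : tens A A) c => tens_fold (fun a b => T a b c) w)
    (tens_map cop idfun (cop x))); first by rewrite tens_fold_map.
apply: eq_tens_fold => w c; rewrite (tens_fold_comp _ _ (tens_fold_add G2)).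
by apply: eq_tens_fold => a b; rewrite !tens_foldE.
Qed.

End Sweedler.

Section Antipode.
Variables (R : comNzRingType) (A : bialgebra R) (S : A -> A).
Hypothesis hS : antipode S.

Let lS : slinear idfun S. Proof. by case: hS. Qed.
Let SD : is_add S. Proof. exact: slin_add lS. Qed.
Let SZ a x : S (a *: x) = a *: S x. Proof. exact: (slinZ lS). Qed.

Let Sl x : sw x (fun a b => S a * b) = (eps x)%:A. Proof. by case: hS => _ h _; exact: h. Qed.
Let Sr x : sw x (fun a b => a * S b) = (eps x)%:A. Proof. by case: hS => _ _ h; exact: h. Qed.

Let mulDl (c : A) : is_add (fun z => z * c). Proof. by move=> *; rewrite mulrDl. Qed.
Let mulDr (c : A) : is_add (fun z => c * z). Proof. by move=> *; rewrite mulrDr. Qed.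

Let SrB : balanced (fun a b => a * S b).
Proof. by split=> *; rewrite ?SD ?SZ ?(mulrDl, mulrDr) // -scalerAl -scalerAr. Qed.
Let SlB : balanced (fun a b => S a * b).
Proof. by split=> *; rewrite ?SD ?SZ ?(mulrDl, mulrDr) // -scalerAl -scalerAr. Qed.

Lemma antipode1 : S 1 = 1.
Proof. by rewrite -[LHS]mulr1 -(sw1 SlB) Sl eps1 scale1r. Qed.

Lemma antipode_eps x : eps (S x) = eps x.
Proof.
have epsD : is_add (eps : A -> R) by move=> *; rewrite linearD.
have : eps (sw x (fun a b => S a * b)) = eps x.
  by rewrite Sl -[LHS]/(eps _) [LHS](slinZ (@eps_slin _ A)) eps1; exact: mulr1.
rewrite (sw_comp _ _ epsD) => <-.
have e : is_add (fun x => eps (S x)) by move=> *; rewrite SD linearD.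
rewrite -[LHS](sw_epsr x e); apply: eq_sw => a b.
by rewrite epsM SZ [LHS](slinZ (@eps_slin _ A)) mulrC.
Qed.

(** [S (x y)] and [S y S x] are both convolution inverses of the product, as maps on [A ⊗ A]: the
    sum of the [S y1 S x1 x2 y2 S (x3 y3)] collapses to one or the other according to the
    bracketing. *)
Lemma antipodeM x y : S (x * y) = S y * S x.
Proof.
pose T x1 x2 x3 y1 y2 y3 := S y1 * S x1 * ((x2 * y2) * S (x3 * y3)).
transitivity (sw x (fun x1 x' => sw x' (fun x2 x3 => sw y (fun y1 y' => sw y' (fun y2 y3 =>
    T x1 x2 x3 y1 y2 y3))))); last first.
  transitivity (sw x (fun x1 x' => sw y (fun y1 y' => S (eps y' *: y1) * S (eps x' *: x1)))).
    apply: eq_sw => x1 x'; rewrite sw_exchange; apply: eq_sw => y1 y'.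
    transitivity (S y1 * S x1 * sw x' (fun x2 x3 => sw y' (fun y2 y3 =>
        (x2 * y2) * S (x3 * y3)))).
      rewrite (sw_comp _ _ (mulDr _)); apply: eq_sw => x2 x3.
      by rewrite (sw_comp _ _ (mulDr _)).
    rewrite -(swM x' y' SrB) Sr epsM -scalerAr mulr1 mulrC -scalerA.
    by rewrite !SZ -scalerAl -scalerAr.
  transitivity (sw x (fun x1 x' => S y * S (eps x' *: x1))).
    apply: eq_sw => x1 x'.
    by apply: (sw_epsr (g := fun z => S z * S (eps x' *: x1)) y) => a b; rewrite SD mulrDl.
  by rewrite (sw_epsr (g := fun z => S y * S z) x) // => a b; rewrite SD mulrDr.
have Ty x1 x2 x3 : sw y (fun y1 y' => sw y' (fun y2 y3 => T x1 x2 x3 y1 y2 y3)) =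
    sw y (fun y' y3 => sw y' (fun y1 y2 => T x1 x2 x3 y1 y2 y3)).
  rewrite sw_coassoc // => z; split=> *; rewrite /T ?(mulrDl, mulrDr, SD) ?(mulrDl, mulrDr) //;
    by rewrite ?(SZ, =^~ scalerAl, =^~ scalerAr).
transitivity (sw x (fun x' x3 => sw x' (fun x1 x2 => sw y (fun y1 y' => sw y' (fun y2 y3 =>
    T x1 x2 x3 y1 y2 y3))))); last first.
  rewrite -sw_coassoc // => z; split=> *; rewrite -?swD; apply: eq_sw => y1 y';
    rewrite -?swD; apply: eq_sw => y2 y3;
    rewrite /T ?(mulrDl, mulrDr, SD) ?(mulrDl, mulrDr) //;
    by rewrite ?(SZ, =^~ scalerAl, =^~ scalerAr).
transitivity (sw x (fun x' x3 => sw y (fun y' y3 => S ((eps x' *: x3) * (eps y' *: y3))))).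
  rewrite (sw_epsl (g := fun z => sw y (fun y' y3 => S (z * (eps y' *: y3)))) x).
    by rewrite (sw_epsl (g := fun z => S (x * z)) y) // => a b; rewrite mulrDr SD.
  by move=> a b; rewrite -swD; apply: eq_sw => c d; rewrite mulrDl SD.
apply: eq_sw => x' x3; under [RHS]eq_sw do rewrite Ty.
rewrite sw_exchange; apply: eq_sw => y' y3.
transitivity (sw y' (fun y1 y2 => S y1 * sw x' (fun x1 x2 => S x1 * x2) * (y2 * S (x3 * y3)))).
  rewrite -scalerAl -scalerAr !SZ.
  transitivity (sw y' (fun y1 y2 => S y1 * y2) * (eps x' *: S (x3 * y3))).
    by rewrite Sl -scalerAl mul1r scalerA mulrC -scalerA.
  rewrite (sw_comp _ _ (mulDl _)); apply: eq_sw => y1 y2.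
  by rewrite Sl -!(scalerAl, scalerAr) mulr1 mulrA.
rewrite sw_exchange; apply: eq_sw => y1 y2.
rewrite (sw_comp _ _ (mulDr _)) (sw_comp _ _ (mulDl _)); apply: eq_sw => x1 x2.
by rewrite /T !mulrA.
Qed.


Let pureSS : balanced (fun a b => pure (S b) (S a) : tens A A).
Proof. by split=> *; rewrite ?SD ?SZ ?(pureDl, pureDr, pureZl, pureZr). Qed.

(** For the convolution of maps from [A] to [A ⊗ A], both [L], which is [cop] after [S], and [Q],
    the twisted square of [S], are inverse to [cop]. The sum of the [Q x1 · cop x2 · L x3] is
    evaluated in two ways. *)
Lemma antipode_cop x : cop (S x) = sw x (fun a b => pure (S b) (S a)).
Proof.
pose L x := cop (S x); pose Q x := sw x (fun a b => pure (S b) (S a) : tens A A).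
have QD : is_add Q := sw_add pureSS.
have QZ a y : Q (a *: y) = a *: Q y.
  by apply: swZ => // r b c; rewrite SZ pureZr.
have LD : is_add L by move=> y z; rewrite /L SD linearD.
have LZ a y : L (a *: y) = a *: L y by rewrite /L SZ linearZ.
(* [Q] is a left inverse of [cop]: after reassociation the inner pair [S d · e] collapses, and after
   it the outer pair [S c · f]. *)
have inner y : sw y (fun a b => tens_mul (Q a) (cop b)) = eps y *: pure 1 1.
  pose U c d e f := pure (S d * e) (S c * f) : tens A A.
  have UB c d : balanced (U c d).
    split=> *; rewrite /U ?(mulrDr, pureDl, pureDr) //.
    by rewrite -!(scalerAl, scalerAr) pureZl pureZr.
  transitivity (sw y (fun a b => sw a (fun c d => sw b (fun e f => U c d e f)))).
    apply: eq_sw => a b; rewrite (sw_comp _ _ (tens_mul_addl _)); apply: eq_sw => c d.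
    rewrite -[cop b]sw_pure (sw_comp _ _ (tens_mul_addr _)); apply: eq_sw => e f.
    by rewrite tens_mulE.
  rewrite (sw_coassoc (T := fun c d b => sw b (fun e f => U c d e f))); first last.
  - move=> c; split=> [d1 d2 b|d b1 b2|r d b].
    + by rewrite -swD; apply: eq_sw => e f; rewrite /U SD mulrDl pureDl.
    + exact: (sw_add (UB c d)).
    + rewrite swZ //; last by move=> s e f; rewrite /U -scalerAr pureZl.
      rewrite (sw_comp (F := fun w : tens A A => r *: w)); last exact: scalerDr.
      by apply: eq_sw => e f; rewrite /U SZ -scalerAl pureZl.
  - move=> b; split=> [c1 c2 d|c d1 d2|r c d]; rewrite -?swD; apply: eq_sw => e f; rewrite /U.
    + by rewrite SD mulrDl pureDr.
    + by rewrite SD mulrDl pureDl.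
    + by rewrite !SZ -!scalerAl pureZl pureZr.
  transitivity (sw y (fun c z => pure 1 (S c * z) : tens A A)); last first.
    by rewrite -(sw_comp _ _ (pure_addr _)) Sl pureZr.
  apply: eq_sw => c z.
  rewrite -(sw_coassoc (T := fun d e f => U c d e f)) //; last first.
    move=> f; split=> *; rewrite /U ?(SD, mulrDl, mulrDr, pureDl) //.
    by rewrite SZ -!(scalerAl, scalerAr).
  transitivity (sw z (fun w f => pure 1 (S c * (eps w *: f)) : tens A A)).
    apply: eq_sw => w f; rewrite -scalerAr pureZr -pureZl.
    by rewrite -Sl (sw_comp (F := fun u => pure u (S c * f))) //; exact: pure_addl.
  rewrite (sw_epsl (g := fun f => pure 1 (S c * f) : tens A A)) // => f1 f2.
  by rewrite mulrDr pureDr.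
pose T x1 x2 x3 := tens_mul (tens_mul (Q x1) (cop x2)) (L x3).
transitivity (sw x (fun x1 x' => sw x' (fun x2 x3 => T x1 x2 x3))).
  rewrite -sw_coassoc; first last.
  - move=> a; split=> *; rewrite /T ?(LD, linearD) ?(tens_mulDr, tens_mulDl) //.
    by rewrite LZ linearZ /= ?(tens_mulZl, tens_mulZr).
  - move=> a; split=> *; rewrite /T ?(QD, linearD) ?(tens_mulDr, tens_mulDl) //.
    by rewrite QZ linearZ /= ?(tens_mulZl, tens_mulZr).
  transitivity (sw x (fun x' x3 => L (eps x' *: x3))); first by rewrite (sw_epsl x LD).
  apply: eq_sw => x' x3; rewrite LZ -[in LHS](tens_mul1l (L x3)) -tens_mulZl -inner.
  by rewrite (sw_comp _ _ (tens_mul_addl _)).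
transitivity (sw x (fun x1 x' => Q (eps x' *: x1))); last by rewrite (sw_epsr x QD).
apply: eq_sw => x1 x'; rewrite QZ -[in RHS](tens_mul1r (Q x1)) -tens_mulZr -cop1 -linearZ /=.
rewrite -Sr (sw_comp (F := cop)); last by move=> *; rewrite linearD.
rewrite (sw_comp _ _ (tens_mul_addr _)); apply: eq_sw => x2 x3.
by rewrite /T -tens_mulA copM.
Qed.

End Antipode.

Section AntipodeMorphism.
Variables (R S : comNzRingType) (f : {rmorphism R -> S}).
Variables (A : bialgebra R) (B : bialgebra S) (phi : A -> B).
Hypothesis hphi : bialg_hom f phi.

Let lp := bialg_hom_slin hphi.

Lemma sw_hom (P : zmodType) x (g : B -> B -> P) : balanced g ->
  sw (phi x) g = sw x (fun a b => g (phi a) (phi b)).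
Proof. by move=> gB; rewrite /sw (bialg_hom_cop hphi) tens_fold_map. Qed.

(** [SB ∘ phi] is a left and [phi ∘ SA] a right convolution inverse of [phi], hence they agree. For
    [phi] the identity this is uniqueness of the antipode. *)
Lemma antipode_hom SA SB x : antipode SA -> antipode SB -> phi (SA x) = SB (phi x).
Proof.
move=> [lA _ hA] [lB hB _].
have AZ a y : SA (a *: y) = a *: SA y := slinZ (f := idfun) lA a y.
have AD : is_add SA := slin_add (f := idfun) lA.
have BZ a y : SB (a *: y) = a *: SB y := slinZ (f := idfun) lB a y.
have BD : is_add SB := slin_add (f := idfun) lB.
pose T x1 x2 x3 := SB (phi x1) * (phi x2 * phi (SA x3)).
have pD := slin_add lp; have pZ := slinZ lp.
transitivity (sw x (fun x1 x' => sw x' (fun x2 x3 => T x1 x2 x3))).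
  rewrite -sw_coassoc; first last.
  - by move=> a; split=> *; rewrite /T ?(AD, AZ, BD, BZ, pD, pZ)
      ?(mulrDl, mulrDr, =^~ scalerAl, =^~ scalerAr) // ?(pD, mulrDr).
  - by move=> a; split=> *; rewrite /T ?(AD, AZ, BD, BZ, pD, pZ)
      ?(mulrDl, mulrDr, =^~ scalerAl, =^~ scalerAr) // ?(pD, mulrDr, BZ).
  rewrite -(sw_epsl (g := fun z => phi (SA z)) x); last by move=> a b; rewrite AD pD.
  apply: eq_sw => x' x3.
  transitivity (sw x' (fun x1 x2 => SB (phi x1) * phi x2) * phi (SA x3)).
    rewrite -(sw_hom x' (g := fun a b => SB a * b)); last first.
      by split=> *; rewrite ?BD ?BZ ?(mulrDl, mulrDr) // -scalerAl -scalerAr.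
    by rewrite [sw _ _]hB (bialg_hom_eps hphi) -scalerAl mul1r AZ pZ.
  rewrite (sw_comp (F := fun z => z * phi (SA x3))); last by move=> *; rewrite mulrDl.
  by apply: eq_sw => x1 x2; rewrite /T mulrA.
rewrite -(sw_epsr (g := fun z => SB (phi z)) x); last by move=> a b; rewrite pD BD.
apply: eq_sw => x1 x'.
transitivity (SB (phi x1) * phi (sw x' (fun x2 x3 => x2 * SA x3))).
  rewrite (sw_comp _ _ pD) (sw_comp (F := fun z => SB (phi x1) * z)).
    by apply: eq_sw => x2 x3; rewrite /T (bialg_homM hphi).
  by move=> *; rewrite mulrDr.
by rewrite [sw _ _]hA pZ (bialg_hom1 hphi) -scalerAr mulr1 pZ BZ.
Qed.

End AntipodeMorphism.

Section HopfInheritance.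
Variables (R S : comNzRingType) (f : {rmorphism R -> S}).
Variables (A : bialgebra R) (B : bialgebra S) (phi : A -> B).

Lemma hopf_sub (X : set B) SB : is_sub f phi X -> antipode SB ->
  (forall x, X x -> X (SB x)) -> injective f -> is_hopf A.
Proof.
move=> [hphi inj <-] [lB hl hr] SX injf.
have lp := bialg_hom_slin hphi; have pD := slin_add lp; have pZ := slinZ lp.
have BD : is_add SB := slin_add (f := idfun) lB.
have BZ a y : SB (a *: y) = a *: SB y := slinZ (f := idfun) lB a y.
have ex x : exists y, phi y = SB (phi x).
  by have [|y _ <-] := SX (phi x); [exists x | exists y].
pose SA x := projT1 (cid (ex x)).
have SAE x : phi (SA x) = SB (phi x) by rewrite /SA; case: (cid _).
exists SA; split=> [a x y|x|x].
- by apply: inj; rewrite SAE !lp BD BZ !SAE.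
- apply: inj; rewrite -[tens_fold _ _]/(sw x _) (sw_comp _ _ pD) pZ (bialg_hom1 hphi).
  rewrite -(bialg_hom_eps hphi) -hl -[RHS]/(sw _ _) (sw_hom hphi).
    by apply: eq_sw => a b; rewrite (bialg_homM hphi) SAE.
  by split=> *; rewrite ?BD ?BZ ?(mulrDl, mulrDr) // -scalerAl -scalerAr.
- apply: inj; rewrite -[tens_fold _ _]/(sw x _) (sw_comp _ _ pD) pZ (bialg_hom1 hphi).
  rewrite -(bialg_hom_eps hphi) -hr -[RHS]/(sw _ _) (sw_hom hphi).
    by apply: eq_sw => a b; rewrite (bialg_homM hphi) SAE.
  by split=> *; rewrite ?BD ?BZ ?(mulrDl, mulrDr) // -scalerAl -scalerAr.
Qed.

(** Surjectivity of [f] lets every scalar of [S] be lifted to [R], so that the induced map inherits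
    linearity from [SA]. *)
Lemma hopf_quotient (I : set A) SA : is_quotient f phi I -> antipode SA ->
  (forall x, I x -> I (SA x)) -> (forall s, exists r, f r = s) -> is_hopf B.
Proof.
move=> [hphi surj <-] [lA hl hr] SI surjf.
have lp := bialg_hom_slin hphi; have pD := slin_add lp; have pZ := slinZ lp.
have AD : is_add SA := slin_add (f := idfun) lA.
have AZ a y : SA (a *: y) = a *: SA y := slinZ (f := idfun) lA a y.
have ex y : exists x, phi x = y.
  have [x _ e] : range phi y by rewrite surj.
  by exists x.
pose s y := projT1 (cid (ex y)).
have sK y : phi (s y) = y by rewrite /s; case: (cid _).
pose SB y := phi (SA (s y)).
have SBE x : SB (phi x) = phi (SA x).
  apply/eqP; rewrite -subr_eq0 -(is_addB pD) -(is_addB AD); apply/eqP.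
  by apply: SI => /=; rewrite (is_addB pD) sK subrr.
exists SB; have lSB : linear SB.
  move=> a x y; have [r <-] := surjf a; rewrite -(sK x) -(sK y) -lp !SBE lA.
  by rewrite lp.
have BD : is_add SB := slin_add (f := idfun) lSB.
have BZ a y : SB (a *: y) = a *: SB y := slinZ (f := idfun) lSB a y.
split=> // y; rewrite -(sK y) -[LHS]/(sw _ _) (sw_hom hphi).
- rewrite (bialg_hom_eps hphi) -(bialg_hom1 hphi) -pZ -hl -[tens_fold _ _]/(sw _ _).
  by rewrite (sw_comp _ _ pD); apply: eq_sw => a b; rewrite (bialg_homM hphi) SBE.
- by split=> *; rewrite ?BD ?BZ ?(mulrDl, mulrDr) // -scalerAl -scalerAr.
- rewrite (bialg_hom_eps hphi) -(bialg_hom1 hphi) -pZ -hr -[tens_fold _ _]/(sw _ _).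
  by rewrite (sw_comp _ _ pD); apply: eq_sw => a b; rewrite (bialg_homM hphi) SBE.
- by split=> *; rewrite ?BD ?BZ ?(mulrDl, mulrDr) // -scalerAl -scalerAr.
Qed.

End HopfInheritance.

(** * Universal property of the extension of scalars *)

Section BaseChangeTheory.
Variables (R S : comNzRingType) (f : {rmorphism R -> S}).
Variables (A : bialgebra R) (E : bialgebra S) (iota : A -> E).
Hypothesis bc : is_base_change f iota.

Let hiota : bialg_hom f iota. Proof. by case: bc. Qed.
Let li : slinear f iota := bialg_hom_slin hiota.

Lemma base_change_ind (Q : E -> Prop) :
  (forall c x, Q (c *: iota x)) -> (forall u v, Q u -> Q v -> Q (u + v)) -> forall e, Q e.
Proof.
move=> Qg QD e; case: bc => _ [g _ gK]; rewrite -(gK e) /tens_fold.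
apply: (big_ind Q) => //; rewrite -(scale0r (iota 0)); exact: Qg.
Qed.

(** The bijection in [is_base_change] compares [E] with the concrete tensor product, where the lift
    is given by a fold; its inverse is linear because it is. *)
Lemma base_change_lift (P : lmodType S) (h : A -> P) : slinear f h ->
  exists2 F : E -> P, slinear idfun F & forall x, F (iota x) = h x.
Proof.
move=> lh; case: bc => _ [g gK Kg].
have lL := bc_lift_slin li.
have lg : slinear idfun (g : E -> bc_type f A).
  move=> a x y; apply: (can_inj gK); rewrite [LHS]Kg.
  rewrite -[RHS]/(bc_lift iota _) lL; congr (a *: _ + _).
    exact: esym (Kg x).
  exact: esym (Kg y).
exists (fun e => bc_lift h (g e)) => [a x y|x].
  by rewrite lg (bc_lift_slin lh).
rewrite -[RHS](bc_lift_inj lh); congr bc_lift.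
apply: (can_inj gK); rewrite [LHS]Kg.
by rewrite -[RHS]/(bc_lift iota _) (bc_lift_inj li).
Qed.

Lemma hopf_base_change SA : antipode SA ->
  exists2 SE : E -> E, antipode SE & forall x, SE (iota x) = iota (SA x).
Proof.
move=> [lA hl hr].
have [|SE lSE SEi] := @base_change_lift E (iota \o SA).
  by move=> a x y /=; rewrite lA li.
exists SE => //; have ED := slin_add lSE; have EZ := slinZ lSE.
have EB1 : balanced (fun a b => SE a * b).
  by split=> *; rewrite ?ED ?EZ ?(mulrDl, mulrDr) // -scalerAl -scalerAr.
have EB2 : balanced (fun a b => a * SE b).
  by split=> *; rewrite ?ED ?EZ ?(mulrDl, mulrDr) // -scalerAl -scalerAr.
split=> // e; elim/base_change_ind: e => [c x|u v hu hv].
- rewrite -[LHS]/(sw _ _) swZ //; last by move=> a y z; rewrite EZ -scalerAl.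
  rewrite (sw_hom hiota) // linearZ /= -scalerA -(bialg_hom1 hiota).
  rewrite (bialg_hom_eps hiota) -(slinZ li) -hl; congr (c *: _).
  rewrite -[tens_fold _ _]/(sw _ _) (sw_comp _ _ (slin_add li)).
  by apply: eq_sw => a b; rewrite (bialg_homM hiota) SEi.
- by rewrite -[LHS]/(sw _ _) (sw_add EB1) linearD scalerDl -hu -hv.
- rewrite -[LHS]/(sw _ _) swZ //; last by move=> a y z; rewrite -scalerAl.
  rewrite (sw_hom hiota) // linearZ /= -scalerA -(bialg_hom1 hiota).
  rewrite (bialg_hom_eps hiota) -(slinZ li) -hr; congr (c *: _).
  rewrite -[tens_fold _ _]/(sw _ _) (sw_comp _ _ (slin_add li)).
  by apply: eq_sw => a b; rewrite (bialg_homM hiota) SEi.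
- by rewrite -[LHS]/(sw _ _) (sw_add EB2) linearD scalerDl -hu -hv.
Qed.

End BaseChangeTheory.

(** * The maps δ_n *)

Section Delta.
Variables (R : comNzRingType) (A : bialgebra R).
Implicit Types (x y : A) (n : nat).

Definition augm y : A := y - (eps y)%:A.

Lemma augm_slin : slinear idfun augm.
Proof.
move=> a x y; rewrite /augm linearP scalerDl scalerBr opprD addrACA.
by congr (_ - _ + _); rewrite -scalerA.
Qed.

Lemma augm1 : augm 1 = 0. Proof. by rewrite /augm eps1 scale1r subrr. Qed.

Lemma eps_augm x : eps (augm x) = 0.
Proof.
rewrite /augm linearB /= [X in _ - X](slinZ (@eps_slin _ A)) eps1.
by rewrite -[_ *: _]/(_ * _) mulr1 subrr.
Qed.

Lemma augmE x : x = augm x + (eps x)%:A. Proof. by rewrite subrK. Qed.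

Lemma tpow_map_slin n : slinear idfun (tpow_map augm (n := n)).
Proof. by elim: n => // n IH /=; exact: (tens_map_slin augm_slin IH). Qed.

Lemma iter_cop_slin n : slinear idfun (@iter_cop R A n).
Proof.
elim: n => [|n IH] /=; first exact: eps_slin.
move=> a x y /=; rewrite cop_slin.
exact: (tens_map_slin (@slinear_id _ _) IH).
Qed.

Lemma delta_slin n : slinear idfun (@delta R A n).
Proof.
by move=> a x y; rewrite /delta iter_cop_slin tpow_map_slin.
Qed.

Let deltaD n := slin_add (@delta_slin n).
Let deltaZ n := slinZ (@delta_slin n).
Let augmD := slin_add augm_slin.
Let augmZ := slinZ augm_slin.

Lemma deltaS n x : delta n.+1 x = sw x (fun a b => pure (augm a) (delta n b)).
Proof.
rewrite /delta /= -/augm (tens_map_comp _ _ _ augm_slin (@tpow_map_slin n)).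
by [].
Qed.

Lemma delta1 n : delta n.+1 (1 : A) = 0.
Proof.
rewrite deltaS sw1; first by rewrite augm1 pure0l.
exact: (balanced_slin augm_slin (@delta_slin n) (pure_balanced _ _)).
Qed.

Let pure_augm_delta n : balanced (fun a b => pure (augm a) (@delta R A n b)).
Proof. exact: (balanced_slin augm_slin (@delta_slin n) (pure_balanced _ _)). Qed.

(** The map [s] is the identification of the tensor powers, retained only as a linear map: linearity
    is what transfers divisibility by powers of [t]. *)
Lemma delta_split n m : exists2 s : tpow A (n + m) -> tens (tpow A n) (tpow A m),
  slinear idfun s & forall x, sw x (fun a b => pure (delta n a) (delta m b)) = s (delta (n + m) x).
Proof.
elim: n => [|n [s ls hs]].
  exists (fun w => pure (1 : R^o) w) => [a u v|x]; first by rewrite pureDr pureZr.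
  rewrite -[RHS](sw_epsl (g := fun b => pure (1 : R^o) (delta m b)) x); last first.
    by move=> a b; rewrite deltaD pureDr.
  apply: eq_sw => a b; rewrite deltaZ -[delta 0 a]/(eps a).
  by rewrite pureZr -pureZl -[_ *: (1 : R^o)]/(_ * _) mulr1.
pose alpha (c : A) (u : tens (tpow A n) (tpow A m)) : tens (tpow A n.+1) (tpow A m) :=
  tens_fold (fun w v => pure (pure c w : tpow A n.+1) v) u.
have aB c : balanced (fun w v => pure (pure c w : tpow A n.+1) v : tens _ (tpow A m)).
  split=> [w1 w2 v|w v1 v2|r w v]; rewrite ?pureDr ?pureDl //.
  by rewrite pureZr pureZl pureZr.
have aZ c : slinear idfun (alpha c).
  apply: tens_fold_slin => // r w v; by rewrite pureZr pureZl.
have aDl u : is_add (alpha^~ u).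
  by move=> c d; rewrite /alpha -tens_foldD; apply: eq_tens_fold => w v; rewrite !pureDl.
have aZl r c u : alpha (r *: c) u = alpha c (r *: u).
  rewrite (slinZ (aZ c)) /alpha (tens_fold_comp (F := fun z => r *: z)); last exact: scalerDr.
  by apply: eq_tens_fold => w v; rewrite !pureZl.
have sD := slin_add ls.
have bB : balanced (fun a w => alpha a (s w)).
  split=> [c d w|c w1 w2|r c w]; first exact: aDl.
    by rewrite sD (slin_add (aZ c)).
  by rewrite aZl (slinZ ls).
exists (tens_fold (fun a w => alpha a (s w))) => [|x].
  apply: tens_fold_slin => // r c w; by rewrite aZl (slinZ (aZ c)).
rewrite -[delta (n.+1 + m) x]/(delta (n + m).+1 x) deltaS (sw_comp _ _ (tens_fold_add bB)).
transitivity (sw x (fun y b => sw y (fun c d =>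
    pure (pure (augm c) (delta n d) : tpow A n.+1) (delta m b)))).
  apply: eq_sw => y b; rewrite deltaS.
  by rewrite (sw_comp (F := fun z => pure (z : tpow A n.+1) (delta m b))) //; exact: pure_addl.
rewrite (sw_coassoc (T := fun c d b => pure (pure (augm c) (delta n d) : tpow A n.+1) (delta m b))).
- apply: eq_sw => c z; rewrite tens_foldE // -hs.
  rewrite (sw_comp _ _ (slin_add (aZ _))); apply: eq_sw => d b.
  by rewrite /alpha tens_foldE.
- move=> b; split=> [c1 c2 d|c d1 d2|r c d].
  + by rewrite augmD !pureDl.
  + by rewrite deltaD pureDr pureDl.
  + by rewrite augmZ deltaZ pureZl pureZr.
- move=> c; split=> [d1 d2 b|d b1 b2|r d b].
  + by rewrite deltaD pureDr pureDl.
  + by rewrite deltaD pureDr.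
  + by rewrite !deltaZ pureZr pureZl pureZr.
Qed.

(** δ_1 is [id - u ∘ ε] up to the identification [kappa] of [A ⊗ R] with [A]. *)
Lemma augm_of_delta :
  exists2 kappa : tpow A 1 -> A, slinear idfun kappa & forall x, kappa (delta 1 x) = augm x.
Proof.
have rB : balanced (fun (a : A) (r : R^o) => (r : R) *: a).
  by split=> *; rewrite ?(scalerDr, scalerDl) // scalerA mulrC.
exists (tens_fold (fun (a : A) (r : R^o) => (r : R) *: a)) => [|x].
  by apply: tens_fold_slin => // a x r; rewrite !scalerA mulrC.
rewrite deltaS (sw_comp _ _ (tens_fold_add rB)) -[RHS](sw_epsr (g := augm) x) //.
by apply: eq_sw => c d; rewrite augmZ tens_foldE.
Qed.

(** The last factor is left in [A] itself, where functionals on [A] and the antipode can be applied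
    to it. *)
Lemma delta_split_last n : exists2 s : tpow A n.+1 -> tens (tpow A n) A,
  slinear idfun s & forall x, sw x (fun a b => pure (delta n a) (augm b)) = s (delta n.+1 x).
Proof.
have [s0 ls0 hs0] := delta_split n 1; rewrite addn1 in s0 ls0 hs0 *.
have [kappa lk hk] := augm_of_delta.
exists (tens_map idfun kappa \o s0) => [a u v|x /=].
  by rewrite /= ls0 (tens_map_slin (@slinear_id _ _) lk).
rewrite -hs0 (sw_comp _ _ (tens_map_add (@slinear_id _ _) lk)); apply: eq_sw => a b.
by rewrite (tens_map_pure (@slinear_id _ _) lk) hk.
Qed.

(** [T] reverses the tensor factors and applies [S] to each, because [S] reverses coproducts. Its
    linearity shows that [S] preserves the kernels of the δ_n and the divisibility of their values
    by powers of [t]. *)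
Lemma delta_antipode n (S : A -> A) : antipode S ->
  exists2 T : tpow A n -> tpow A n, slinear idfun T & forall x, delta n (S x) = T (delta n x).
Proof.
move=> hS; have lS : slinear idfun S by case: hS.
elim: n => [|n [T lT hT]]; first by exists idfun => // x; exact: (antipode_eps hS).
have [s ls hs] := delta_split_last n.
pose g (w : tpow A n) (b : A) : tpow A n.+1 := pure (S b) (T w).
have gB : balanced g.
  split=> [w1 w2 b|w b1 b2|r w b]; rewrite /g ?(slin_add lT) ?(slin_add lS) ?pureDr ?pureDl //.
  by rewrite (slinZ lT) (slinZ lS) pureZr pureZl.
exists (tens_fold g \o s) => [a u v|x] /=.
  rewrite ls; apply: (tens_fold_slin (f := idfun) gB) => r w b.
  by rewrite /g (slinZ lT) pureZr.
rewrite -hs (sw_comp _ _ (tens_fold_add gB)) deltaS /sw (antipode_cop hS).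
rewrite (sw_comp _ _ (tens_fold_add (@pure_augm_delta n))); apply: eq_sw => a b.
rewrite !tens_foldE // /g hT; congr (pure _ _).
by rewrite /augm (is_addB (slin_add lS)) (slinZ lS) (antipode1 hS) (antipode_eps hS).
Qed.

(** δ_(n+2) factors through δ_(n+1): the map [(augm ⊗ augm) Δ] is applied to the first factor. As it
    kills constants, it does not see the [augm] already applied there. *)
Lemma delta_eq0S n x : delta n.+1 x = 0 -> delta n.+2 x = 0.
Proof.
pose psi (y : A) (w : tpow A n) : tpow A n.+2 :=
  sw y (fun a c => pure (augm a) (pure (augm c) w : tpow A n.+1)).
have psiB y : is_add (psi y).
  move=> w1 w2; rewrite /psi -swD; apply: eq_sw => a c.
  by rewrite !pureDr.
have bal w : balanced (fun a c => pure (augm a) (pure (augm c) w : tpow A n.+1)).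
  split=> [a1 a2 c|a c1 c2|r a c].
  - by rewrite augmD (pureDl (augm a1)).
  - by rewrite augmD (pureDl (augm c1)) pureDr.
  - by rewrite !augmZ !pureZl pureZr.
have psiZ r y w : psi (r *: y) w = psi y (r *: w).
  rewrite /psi swZ //; last by move=> a b c; rewrite augmZ pureZl.
  rewrite (sw_comp (F := fun z => r *: z)); last exact: scalerDr.
  by apply: eq_sw => a c; rewrite !pureZr.
have pB : balanced psi.
  split=> [y1 y2 w|y|r y w]; [exact: (sw_add (bal w)) | exact: psiB | exact: psiZ].
have psi_augm y w : psi (augm y) w = psi y w.
  have psiDl : is_add (psi^~ w) by exact: (sw_add (bal w)).
  have -> : psi y w = psi (augm y) w + psi (eps y)%:A w by rewrite {1}(augmE y); exact: psiDl.
  by rewrite psiZ [X in _ + X]sw1 // augm1 pure0l addr0.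
suff -> : delta n.+2 x = tens_fold psi (delta n.+1 x).
  by move=> ->; rewrite (is_add0 (tens_fold_add pB)).
rewrite (deltaS n) (sw_comp _ _ (tens_fold_add pB)).
transitivity (sw x (fun y d => psi y (delta n d))); last first.
  by apply: eq_sw => y d; rewrite tens_foldE.
rewrite /psi sw_coassoc.
- rewrite deltaS; apply: eq_sw => a z; rewrite deltaS.
  by rewrite (sw_comp _ _ (pure_addr _)).
- by move=> d.
- move=> a; split=> [c1 c2 d|c d1 d2|r c d].
  + by rewrite augmD (pureDl (augm c1)) pureDr.
  + by rewrite deltaD !pureDr.
  + by rewrite augmZ deltaZ !(pureZl, pureZr).
Qed.

Lemma delta_eq0_le n m x : (n < m)%N -> delta n.+1 x = 0 -> delta m x = 0.
Proof.
move=> + h; elim: m => // m IH; rewrite ltnS leq_eqVlt => /predU1P[<-//|/[dup] lt /IH].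
by case: m lt {IH} => // m _; exact: delta_eq0S.
Qed.

End Delta.

Section TpowHom.
Variables (R S : comNzRingType) (f : {rmorphism R -> S}).
Variables (A : bialgebra R) (B : bialgebra S) (phi : A -> B).
Hypothesis hphi : bialg_hom f phi.

Fixpoint tpow_hom (n : nat) : tpow A n -> tpow B n :=
  match n return tpow A n -> tpow B n with
  | 0 => f
  | m.+1 => tens_map phi (@tpow_hom m)
  end.

Lemma tpow_hom_slin n : slinear f (@tpow_hom n).
Proof.
elim: n => [|n IH] /=; first by move=> a x y; rewrite rmorphD rmorphM.
exact: (tens_map_slin (bialg_hom_slin hphi) IH).
Qed.

Lemma augm_hom x : phi (augm x) = augm (phi x).
Proof.
have lp := bialg_hom_slin hphi.
by rewrite /augm (is_addB (slin_add lp)) (slinZ lp) (bialg_hom1 hphi) (bialg_hom_eps hphi).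
Qed.

Lemma delta_hom n x : delta n (phi x) = tpow_hom (delta n x).
Proof.
elim: n x => [|n IH] x; first exact: (bialg_hom_eps hphi).
rewrite !deltaS (sw_hom hphi); last first.
  exact: (balanced_slin (@augm_slin _ B) (@delta_slin _ B n) (pure_balanced _ _)).
rewrite (sw_comp _ _ (slin_add (@tpow_hom_slin n.+1))); apply: eq_sw => a b /=.
by rewrite (tens_map_pure (bialg_hom_slin hphi) (@tpow_hom_slin n)) augm_hom IH.
Qed.

End TpowHom.

(** * Filtered vector spaces and locally split modules *)

Section AdaptedFamilies.
Variables (k : fieldType) (V : lmodType k) (F : nat -> set V).
Hypotheses (hF : forall n, submod (F n)) (F0 : forall x, F 0 x).
Hypotheses (FS : forall n, F n.+1 `<=` F n) (Fsep : forall x, (forall n, F n x) -> x = 0).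

Lemma filtration_le m n : (m <= n)%N -> F n `<=` F m.
Proof.
elim: n => [|n IH]; first by rewrite leqn0 => /eqP->.
by rewrite leq_eqVlt => /predU1P[->//|/IH h] x /FS; exact: h.
Qed.

(** A finite basis compatible with the filtration: [w i] has order exactly [d i], since [l i]
    vanishes on [F (d i).+1] but not at [w i]. *)
Definition adapted (I : finType) (w : I -> V) (d : I -> nat) (l : I -> V -> k^o) :=
  [/\ forall i, F (d i) (w i), forall i, slinear idfun (l i),
      forall i x, F (d i).+1 x -> l i x = 0
    & forall i j, l i (w j) = (i == j)%:R].

(* Vectors are added one at a time: the part of [x] killed by the functionals
   found so far is put in the last [F d] that contains it modulo the family. *)
Lemma adapted_family (s : seq V) :
  exists (I : finType) (w : I -> V) (d : I -> nat) (l : I -> V -> k^o),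
    adapted w d l /\ forall x, x \in s -> x = \sum_i (l i x : k) *: w i.
Proof.
elim: s => [|x s [I [w [d [l [[wF ll lF lw] hs]]]]]].
  by exists void, (fun i => 0), (fun i => 0%N), (fun i => fun=> 0); split=> //; split=> // -[].
have lD i := slin_add (ll i); have lZ i := slinZ (ll i).
pose W := [set y | exists c : I -> k, y = \sum_i c i *: w i].
have hW : submod W.
  split=> [|a _ _ [b ->] [c ->]]; first by exists (fun=> 0); rewrite big1 // => *; rewrite scale0r.
  exists (fun i => a * b i + c i); rewrite scaler_sumr -big_split.
  by apply: eq_bigr => i _; rewrite scalerDl scalerA.
have lW i (c : I -> k) : l i (\sum_j c j *: w j) = c i.
  rewrite (is_add_sum (lD i)) (bigD1 i) //= lZ lw eqxx big1 => [|j ji].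
    by rewrite addr0; exact: mulr1.
  by rewrite lZ lw eq_sym (negbTE ji) scaler0.
pose x' := x - \sum_i (l i x : k) *: w i.
have lx' i : l i x' = 0 by rewrite (is_addB (lD i)) lW subrr.
have [x'0|/eqP x'0] := eqVneq x' 0.
  exists I, w, d, l; split=> // y; rewrite inE => /predU1P[->|/hs //].
  by apply/eqP; rewrite -subr_eq0; apply/eqP.
pose P m := [set z | exists y v, [/\ F m y, W v & z = y + v]] x'.
(* The functionals kill [x'], so the coefficients of the correction in [W] are determined by [y],
   and those with [d i < m] vanish; the correction itself lies in [F m]. *)
have hP m : P m -> F m x'.
  move=> [y [v [Fy [c ->] e]]]; rewrite e; apply: submodD => //.
  apply: submod_sum => // i _ _.
  have ci : c i = - l i y.
    by have := lx' i; rewrite e lD lW addrC => /eqP; rewrite addr_eq0 => /eqP.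
  case: (leqP m (d i)) => [le|lt]; first by apply: submodZ => //; exact: (filtration_le le).
  by rewrite ci lF ?oppr0 ?scale0r; [case: (hF m) | exact: (filtration_le lt)].
have exn : exists m, ~~ `[< P m >].
  have /existsNP[m Fm] : ~ forall m, F m x' by move/Fsep.
  by exists m; apply/negP => /asboolP/hP.
have P0 : P 0%N by exists x', 0; split=> //; [case: hW | rewrite addr0].
(* [P 0] holds, so the least failing index is a successor [m.+1], and [m] is the order of [x']
   modulo the family. *)
have [[|m] /negP nP minP] := ex_minnP exn; first by case: nP; apply/asboolP.
have Pm : P m.
  by apply/asboolP/negPn/negP => h; have := minP m h; rewrite ltnn.
pose N := [set z | exists y v, [/\ F m.+1 y, W v & z = y + v]].
have hN : submod N.
  split; first by exists 0, 0; rewrite addr0; split=> //; [case: (hF m.+1) | case: hW].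
  move=> a _ _ [y [v [Fy Wv ->]]] [z [u [Fz Wu ->]]].
  exists (a *: y + z), (a *: v + u); split.
  - by case: (hF m.+1) => _; apply.
  - by case: hW => _; apply.
  by rewrite scalerDr addrACA.
have [|lam [llam lamN lam1]] := exists_functional (g := idfun) (fun _ _ => id) hN (x0 := x').
  move=> a Na; apply: contrapT => /eqP a0; apply: nP; apply/asboolP.
  by have := submodZ a^-1 hN Na; rewrite scalerA mulVf // scale1r.
have lamW v : W v -> lam v = 0.
  by move=> Wv; apply: lamN; exists 0, v; split=> //; [case: (hF m.+1)|rewrite add0r].
have Ww i : W (w i).
  exists (fun j => (j == i)%:R); rewrite (bigD1 i) //= eqxx scale1r big1 ?addr0 // => j ji.
  by rewrite (negbTE ji) scale0r.
exists (I + unit)%type, (fun i => if i is inl i then w i else x'),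
  (fun i => if i is inl i then d i else m), (fun i => if i is inl i then l i else lam).
split.
  split=> [[i|[]]|[i|[]]|[i|[]] y|[i|[]] [j|[]]] //.
  - exact: hP.
  - exact: lF.
  - by move=> Fy; apply: lamN; exists y, 0; split=> //; [case: hW|rewrite addr0].
  - exact: lamW.
move=> y ys; rewrite big_sumType /= big_const card_unit /= addr0.
move: ys; rewrite inE => /predU1P[->|/hs e].
  have -> : lam x = 1.
    rewrite -lam1 /x' (is_addB (slin_add llam)) [X in _ - X]lamW ?subr0 //.
    by exists (l ^~ x).
  by rewrite scale1r addrC subrK.
have -> : lam y = 0 by apply: lamW; exists (l ^~ y).
by rewrite scale0r addr0.
Qed.

End AdaptedFamilies.

Section LocallySplit.
Variable R : comNzRingType.

(** A finite family lies in a free direct summand with basis [e] and coordinate functionals [l].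
    This takes the place of a basis of the whole module, which is never constructed. *)
Definition locally_split (M : lmodType R) := forall s : seq M,
  exists (I : finType) (e : I -> M) (l : I -> M -> R^o),
    [/\ forall i, slinear idfun (l i), forall i j, l i (e j) = (i == j)%:R
      & forall x, x \in s -> x = \sum_i (l i x : R) *: e i].

Lemma locally_split_ring : locally_split R^o.
Proof.
move=> s; exists unit, (fun=> 1), (fun=> idfun); split; [by []|by case; case|move=> x _].
by rewrite big_const card_unit /= addr0; exact: esym (mulr1 x).
Qed.

Lemma tens_expand (M N : lmodType R) (I J : finType) (e : I -> M) (l : I -> M -> R^o)
    (e' : J -> N) (l' : J -> N -> R^o) (u : tens M N) :
  (forall p, p \in tens_repr u -> p.1 = \sum_i (l i p.1 : R) *: e i) ->
  (forall p, p \in tens_repr u -> p.2 = \sum_j (l' j p.2 : R) *: e' j) ->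
  u = \sum_(i : I * J)
    (tens_fold (fun x y => (l i.1 x : R) * l' i.2 y) u : R) *: pure (e i.1) (e' i.2).
Proof.
move=> hl hl'; rewrite [LHS]tens_sum_pure /tens_fold.
under [RHS]eq_bigr do rewrite scaler_suml.
rewrite exchange_big !big_seq; apply: eq_bigr => p pu.
rewrite [in LHS](hl p pu) [in LHS](hl' p pu) (is_add_sum (pure_addl _)).
transitivity (\sum_i \sum_j (pure ((l i p.1 : R) *: e i) ((l' j p.2 : R) *: e' j) : tens M N)).
  by apply: eq_bigr => i _; exact: (is_add_sum (pure_addr ((l i p.1 : R) *: e i))).
rewrite pair_big; apply: eq_bigr => -[i j] _ /=.
by rewrite pureZl pureZr scalerA.
Qed.

Lemma functional_pair_balanced (M N : lmodType R) (l : M -> R^o) (l' : N -> R^o) :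
  slinear idfun l -> slinear idfun l' -> balanced (fun x y => (l x : R) * l' y).
Proof.
move=> ll ll'; split=> [x1 x2 y|x y1 y2|a x y].
- by rewrite (slin_add ll) mulrDl.
- by rewrite (slin_add ll') mulrDr.
- by rewrite (slinZ ll) (slinZ ll') -[_ *: l _]/(_ * _) -[_ *: l' _]/(_ * _) mulrCA mulrA.
Qed.

Lemma locally_split_tens (M N : lmodType R) :
  locally_split M -> locally_split N -> locally_split (tens M N).
Proof.
move=> hM hN s.
pose s1 := flatten [seq map fst (tens_repr u) | u <- s].
pose s2 := flatten [seq map snd (tens_repr u) | u <- s].
have [I [e [l [ll le hs1]]]] := hM s1; have [J [e' [l' [ll' le' hs2]]]] := hN s2.
pose L (p : I * J) (u : tens M N) : R^o := tens_fold (fun x y => l p.1 x * l' p.2 y) u.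
have LB p := functional_pair_balanced (ll p.1) (ll' p.2).
have Ll p : slinear idfun (L p).
  apply: tens_fold_slin => // a x y.
  by rewrite (slinZ (ll _)) -[_ *: l _ _]/(_ * _) -mulrA.
exists (I * J)%type, (fun p => pure (e p.1) (e' p.2)), L; split=> //.
  move=> [i j] [i' j']; rewrite /L tens_foldE; last exact: (LB (i, j)).
  by rewrite /= le le' -natrM mulnb.
move=> u us; apply: tens_expand => p pu.
  by apply: hs1; apply/flatten_mapP; exists u => //; exact: map_f.
by apply: hs2; apply/flatten_mapP; exists u => //; exact: map_f.
Qed.

End LocallySplit.

(** Finitely many elements of [E] involve finitely many elements of [A], and the coordinate
    functionals of these extend to [E] by [base_change_lift]. *)
Lemma locally_split_base_change (R S : comNzRingType) (f : {rmorphism R -> S})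
    (A : bialgebra R) (E : bialgebra S) (iota : A -> E) :
  is_base_change f iota -> locally_split A -> locally_split E.
Proof.
move=> bc hA s.
have [ss hss] : exists ss : seq A, forall x, x \in s -> exists2 cs : seq (S * A),
    forall p, p \in cs -> p.2 \in ss & x = \sum_(p <- cs) p.1 *: iota p.2.
  elim: s => [|x s [ss IH]]; first by exists [::].
  have [cs ecs] : exists cs : seq (S * A), x = \sum_(p <- cs) p.1 *: iota p.2.
    elim/(base_change_ind bc): x => [c x|_ _ [cs ->] [cs' ->]].
      by exists [:: (c, x)]; rewrite big_seq1.
    by exists (cs ++ cs'); rewrite big_cat.
  exists (map snd cs ++ ss) => y; rewrite inE => /predU1P[->|/IH[cs' h e]].
    by exists cs => // p pcs; rewrite mem_cat map_f.
  by exists cs' => // p /h; rewrite mem_cat orbC => ->.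
have [I [e [l [ll le hl]]]] := hA ss.
have lft i : exists F : E -> S^o, slinear idfun F /\ forall x, F (iota x) = f (l i x).
  have [|F lF hF] := @base_change_lift _ _ _ _ _ _ bc S^o (fun x => f (l i x)); last by exists F.
  by move=> a x y; rewrite ll rmorphD rmorphM.
have [F hF] := choice lft.
have li : slinear f iota by case: bc => /bialg_hom_slin.
exists I, (iota \o e), F; split=> [i|i j|x xs]; first by case: (hF i).
  by case: (hF i) => _ ->; rewrite le rmorph_nat.
have [cs hcs ->] := hss x xs.
transitivity (\sum_(p <- cs) \sum_i (F i (p.1 *: iota p.2) : S) *: iota (e i)).
  rewrite !big_seq; apply: eq_bigr => p /hcs /hl e2.
  rewrite {1}e2 (is_add_sum (slin_add li)) scaler_sumr; apply: eq_bigr => i _.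
  by case: (hF i) => lF hFi; rewrite (slinZ li) (slinZ lF) hFi scalerA.
rewrite exchange_big; apply: eq_bigr => i _ /=.
by rewrite (is_add_sum (slin_add (proj1 (hF i)))) scaler_suml.
Qed.


Lemma locally_split_torsion_free (R : idomainType) (M : lmodType R) :
  locally_split M -> torsion_free M.
Proof.
move=> hM a x ax0; case: (eqVneq a 0) => [|a0]; [by left | right].
have [I [e [l [ll _ /(_ _ (mem_head _ _)) ->]]]] := hM [:: x].
rewrite big1 // => i _; have /eqP := congr1 (l i) ax0.
rewrite (slinZ (ll i)) (is_add0 (slin_add (ll i))) mulf_eq0 (negbTE a0) /= => /eqP->.
by rewrite scale0r.
Qed.

Lemma locally_split_tpow (R : comNzRingType) (A : bialgebra R) n :
  locally_split A -> locally_split (tpow A n).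
Proof.
move=> hA; elim: n => [|n IH]; [exact: locally_split_ring | exact: locally_split_tens].
Qed.

(** With the trivial filtration, everything in degree 0 and zero above, [adapted_family] gives bases
    of finite-dimensional subspaces with dual functionals. *)
Lemma locally_split_field (k : fieldType) (V : lmodType k) : locally_split V.
Proof.
move=> s; pose F n := [set x : V | (0 < n)%N -> x = 0].
have hF n : submod (F n).
  split=> [|a x y Fx Fy n0]; first by move=> _.
  by rewrite (Fx n0) (Fy n0) scaler0 addr0.
have FS n : F n.+1 `<=` F n by move=> x /(_ isT) -> _.
have Fsep x : (forall n, F n x) -> x = 0 by move=> /(_ 1%N) /(_ isT).
have F0 x : F 0%N x by [].
have [I [w [d [l [[_ ll _ lw] hs]]]]] := adapted_family hF F0 FS Fsep s.
by exists I, w, l.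
Qed.

(** * Laurent polynomials and filtrations of bialgebras *)

Lemma localizing_tofrac (R : idomainType) : localizing (@tofrac R).
Proof.
split=> [p q /eqP|]; first by rewrite tofrac_eq => /eqP.
elim/quotW => x; exists (frac x).2, (frac x).1; split; first exact: denom_ratioP.
apply/eqP; rewrite -[_ * _]/(FracField.mul _ _) !piE.
rewrite FracField.equivfE /FracField.mulf !numden_Ratio ?mulf_neq0 ?oner_eq0 ?denom_ratioP //.
by rewrite !mul1r mulr1.
Qed.

Section LaurentTheory.
Variable k : fieldType.
Local Notation L := (laurent k).
Local Notation lp := (@laurent_poly k).

Lemma laurent_poly_inj : injective lp.
Proof. by move=> p q /(congr1 (@laurent_val k)) /= /eqP; rewrite tofrac_eq => /eqP. Qed.

Lemma laurent_invK n : lp 'X^n * laurent_inv k n = 1.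
Proof. by apply: val_inj; rewrite /= mulfV ?tofracXn_neq0. Qed.

Lemma laurent_Xn_poly (s : L) : exists n p, lp 'X^n * s = lp p.
Proof.
case: s => s hs; move/asboolP: (hs) => [n [p e]]; exists n, p.
by apply: val_inj; rewrite /= e mulrCA mulfV ?tofracXn_neq0 // mulr1.
Qed.

Lemma laurent_inv0 : laurent_inv k 0 = 1.
Proof. by apply: val_inj; rewrite /= expr0 rmorph1 invr1. Qed.

Lemma laurent_invD m n : laurent_inv k (m + n) = laurent_inv k m * laurent_inv k n.
Proof. by apply: val_inj; rewrite /= exprD rmorphM invfM. Qed.

Fact laurent_integral : GRing.integral_domain_axiom L.
Proof.
move=> x y /(congr1 (@laurent_val k)) /= /eqP; rewrite mulf_eq0.
by case/orP=> /eqP h; apply/orP; [left | right]; apply/eqP/val_inj.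
Qed.

(** The structure of integral domain asks for an inverse function; units and inverses are chosen
    classically. *)
Let unit_pred : {pred L} := fun x => `[< exists y, y * x = 1 >].
Let inv (x : L) : L := if pselect (exists y, y * x = 1) is left h then projT1 (cid h) else x.

Fact laurent_mulVx : {in unit_pred, left_inverse 1 inv *%R}.
Proof.
by move=> x /asboolP h; rewrite /inv; case: pselect => // h'; case: (cid h').
Qed.

Fact laurent_unitPl x y : y * x = 1 -> unit_pred x.
Proof. by move=> e; apply/asboolP; exists y. Qed.

Fact laurent_invr_out : {in [predC unit_pred], inv =1 id}.
Proof.
by move=> x /asboolP h; rewrite /inv; case: pselect.
Qed.

HB.instance Definition _ := GRing.ComNzRing_hasMulInverse.Build L
  laurent_mulVx laurent_unitPl laurent_invr_out.
HB.instance Definition _ := GRing.ComUnitRing_isIntegral.Build L laurent_integral.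

Lemma localizing_laurent : localizing lp.
Proof.
split; first exact: laurent_poly_inj.
move=> s; have [n [p e]] := laurent_Xn_poly s; exists 'X^n, p; split=> //.
by rewrite -size_poly_eq0 size_polyXn.
Qed.

Let laurent_num (s : L) : exists p n, lp 'X^n * s = lp p.
Proof. by have [n [p e]] := laurent_Xn_poly s; exists p, n. Qed.

(** Powers of [t] take the value 1 at [t = 1], so the result does not depend on the power used to
    clear denominators. *)
Definition laurent_ev (s : L) : k := (projT1 (cid (laurent_num s))).[1].

Lemma laurent_evE s n p : lp 'X^n * s = lp p -> laurent_ev s = p.[1].
Proof.
rewrite /laurent_ev; case: (cid _) => q [m e'] /= e.
have : 'X^m * p = 'X^n * q.
  by apply: laurent_poly_inj; rewrite !rmorphM /= -e -e' mulrCA.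
move/(congr1 (horner_eval (1 : k))).
by rewrite /horner_eval !hornerM !hornerXn !expr1n !mul1r => ->.
Qed.

Fact laurent_ev_zmod : zmod_morphism laurent_ev.
Proof.
move=> x y; have [n [p ep]] := laurent_Xn_poly x; have [m [q eq]] := laurent_Xn_poly y.
rewrite (laurent_evE ep) (laurent_evE eq).
rewrite (@laurent_evE _ (n + m) ('X^m * p - 'X^n * q)).
  by rewrite hornerD hornerN !hornerM !hornerXn !expr1n !mul1r.
rewrite exprD rmorphB !rmorphM /= -ep -eq mulrBr.
  by congr (_ - _); rewrite -!mulrA //; exact: mulrCA.
Qed.

Fact laurent_ev_monoid : monoid_morphism laurent_ev.
Proof.
split=> [|x y].
  by rewrite (@laurent_evE _ 0 1) ?hornerC // expr0 rmorph1 mulr1.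
have [n [p ep]] := laurent_Xn_poly x; have [m [q eq]] := laurent_Xn_poly y.
rewrite (laurent_evE ep) (laurent_evE eq) (@laurent_evE _ (n + m) (p * q)) ?hornerM //.
by rewrite exprD !rmorphM /= -ep -eq mulrACA.
Qed.

HB.instance Definition _ := GRing.isZmodMorphism.Build L k laurent_ev laurent_ev_zmod.
HB.instance Definition _ := GRing.isMonoidMorphism.Build L k laurent_ev laurent_ev_monoid.

Lemma laurent_ev_poly p : laurent_ev (lp p) = p.[1].
Proof. by apply: (@laurent_evE _ 0); rewrite expr0 rmorph1 mul1r. Qed.

Lemma laurent_ev_inv n : laurent_ev (laurent_inv k n) = 1.
Proof. by rewrite (@laurent_evE _ n 1) ?hornerC // laurent_invK rmorph1. Qed.

Lemma laurent_ev_const c : laurent_ev (laurent_const k c) = c.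
Proof. by rewrite laurent_ev_poly hornerC. Qed.

End LaurentTheory.

(** * Filtrations compatible with the bialgebra structure *)

Section FilteredTensors.
Variables (R : comNzRingType) (A : bialgebra R) (G : nat -> set A).

Definition filtered_tens n (u : tens A A) := exists2 s : seq (A * A),
  forall p, p \in s -> exists i j, [/\ (i + j)%N = n, G i p.1 & G j p.2]
  & u = \sum_(p <- s) pure p.1 p.2.

Lemma filtered_tens0 n : filtered_tens n 0.
Proof. by exists [::]; rewrite ?big_nil. Qed.

Lemma filtered_tensD n u v : filtered_tens n u -> filtered_tens n v -> filtered_tens n (u + v).
Proof.
move=> [s hs ->] [s' hs' ->]; exists (s ++ s'); last by rewrite big_cat.
by move=> p; rewrite mem_cat => /orP[/hs|/hs'].
Qed.

Lemma filtered_tens_sum n (I : eqType) (r : seq I) (F : I -> tens A A) :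
  (forall i, i \in r -> filtered_tens n (F i)) -> filtered_tens n (\sum_(i <- r) F i).
Proof.
move=> h; rewrite big_seq; apply: (big_ind (filtered_tens n)) => //.
  exact: filtered_tens0.
exact: filtered_tensD.
Qed.

Lemma filtered_tens_pure i j x y : G i x -> G j y -> filtered_tens (i + j) (pure x y).
Proof.
move=> Gx Gy; exists [:: (x, y)]; last by rewrite big_seq1.
by move=> p; rewrite inE => /eqP->; exists i, j.
Qed.

Lemma filtered_tensM n m u v : (forall i j x y, G i x -> G j y -> G (i + j)%N (x * y)) ->
  filtered_tens n u -> filtered_tens m v -> filtered_tens (n + m) (tens_mul u v).
Proof.
move=> GM [s hs ->] [s' hs' ->].
rewrite (is_add_sum (tens_mul_addl _)); apply: filtered_tens_sum => p /hs[i [j [<- Gi Gj]]].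
rewrite (is_add_sum (tens_mul_addr _)); apply: filtered_tens_sum => q /hs'[i' [j' [<- Gi' Gj']]].
by rewrite tens_mulE addnACA; apply: filtered_tens_pure; exact: GM.
Qed.

(** The last clause makes the counit vanish on [t^-n G n] for [n > 0], so that counits of elements
    of the Rees module stay in the smaller ring. *)
Definition bialg_filtration :=
  [/\ forall n, submod (G n), forall x, G 0 x,
      forall i j x y, G i x -> G j y -> G (i + j)%N (x * y),
      forall n x, G n x -> filtered_tens n (cop x)
    & forall n x, G n.+1 x -> eps x = 0].

End FilteredTensors.

Section AugmentationPowers.
Variables (R : comNzRingType) (A : bialgebra R).
Local Notation J := (@aug_ideal R A).
Local Notation Jn := (ideal_exp J).

Lemma aug_submod : submod J.
Proof.
split=> [|a x y Jx Jy]; rewrite /aug_ideal /= ?linear0 //.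
rewrite [LHS](@eps_slin _ A) Jx Jy addr0; exact: mulr0.
Qed.

Lemma ideal_mul_gen (I K : set A) x y : I x -> K y -> ideal_mul I K (x * y).
Proof.
move=> Ix Ky; exists [:: (x, y)]; last by rewrite big_seq1.
by move=> p; rewrite inE => /eqP->.
Qed.

Lemma ideal_mul_sub (I K N : set A) : submod N ->
  (forall x y, I x -> K y -> N (x * y)) -> ideal_mul I K `<=` N.
Proof.
by move=> hN h _ [s hs ->]; apply: submod_sum => // p ps _; case: (hs p ps) => *; exact: h.
Qed.

Lemma ideal_mul_submod (I K : set A) : submod I -> submod (ideal_mul I K).
Proof.
move=> hI; split=> [|a _ _ [s hs ->] [s' hs' ->]]; first by exists [::]; rewrite ?big_nil.
exists ([seq (a *: p.1, p.2) | p <- s] ++ s').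
  move=> p; rewrite mem_cat => /orP[/mapP[q /hs[Iq Kq] ->]|/hs' //].
  by split=> //=; apply: submodZ.
rewrite big_cat big_map /= scaler_sumr; congr (_ + _).
by apply: eq_bigr => p _; rewrite scalerAl.
Qed.

Lemma ideal_exp_submod n : submod (Jn n).
Proof. by case: n => [|n] //=; apply: ideal_mul_submod; exact: aug_submod. Qed.

Lemma ideal_expl n x y : Jn n y -> Jn n (x * y).
Proof.
case: n => [//|n] /= [s hs ->]; rewrite mulr_sumr.
apply: (submod_sum (ideal_exp_submod n.+1)) => p /hs[Jp Kp] _; rewrite mulrA.
by apply: ideal_mul_gen => //; rewrite /aug_ideal /= epsM Jp mulr0.
Qed.

Lemma ideal_expM i j x y : Jn i x -> Jn j y -> Jn (i + j) (x * y).
Proof.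
elim: i x => [|i IH] x /= hx hy; first exact: ideal_expl.
case: hx => s hs ->; rewrite mulr_suml.
apply: (submod_sum (ideal_exp_submod (i + j).+1)) => p /hs[Jp Kp] _; rewrite -mulrA.
by apply: ideal_mul_gen => //; exact: IH.
Qed.

Lemma ideal_expr n x y : Jn n x -> Jn n (x * y).
Proof. by move=> h; rewrite -[n]addn0; apply: ideal_expM. Qed.

Lemma ideal_expS n : Jn n.+1 `<=` Jn n.
Proof.
by apply: ideal_mul_sub; [exact: ideal_exp_submod | move=> x y _; exact: ideal_expl].
Qed.

Lemma ideal_exp1 x : J x -> Jn 1 x.
Proof. by move=> Jx; rewrite -[x]mulr1; exact: ideal_mul_gen. Qed.

Lemma ideal_exp_eps n x : Jn n.+1 x -> eps x = 0.
Proof.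
move=> /(ideal_mul_sub aug_submod); apply=> a b ea _.
by rewrite /aug_ideal /= epsM ea mul0r.
Qed.

Lemma ideal_exp_filtration : bialg_filtration Jn.
Proof.
split=> //; [exact: ideal_exp_submod | exact: ideal_expM | | exact: ideal_exp_eps].
elim=> [|n IH] x hx.
  by exists (tens_repr (cop x)); [move=> p _; exists 0, 0 | exact: tens_sum_pure].
case: hx => s hs ->; rewrite linear_sum; apply: filtered_tens_sum => p /hs[Jp Kp].
rewrite copM -add1n; apply: filtered_tensM => //; [exact: ideal_expM | | exact: IH].
(* For [p.1] in [J] both summands have degree 1: [augm a] is in [J] in the first, and [p.1] in the
   second. *)
have -> : cop p.1 = sw p.1 (fun a b => pure (augm a) b) + pure 1 p.1.
  rewrite -[in LHS](sw_pure p.1) -[in X in _ = _ + X](cop_epsl p.1).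
  rewrite -[tens_fold _ _]/(sw _ _) (sw_comp _ _ (pure_addr _)) -swD.
  by apply: eq_sw => a b; rewrite pureZr -pureZl -pureDl -augmE.
apply: filtered_tensD.
  apply: filtered_tens_sum => q _; rewrite -[1%N]addn0.
  by apply: filtered_tens_pure => //; apply: ideal_exp1; exact: eps_augm.
by rewrite -[1%N]add0n; apply: filtered_tens_pure => //; exact: ideal_exp1.
Qed.

Lemma ideal_exp_antipode S n x : antipode S -> Jn n x -> Jn n (S x).
Proof.
move=> hS; have lS : slinear idfun S by case: hS.
elim: n x => [//|n IH] x [s hs ->]; rewrite (is_add_sum (slin_add lS)).
apply: (submod_sum (ideal_exp_submod n.+1)) => p /hs[Jp Kp] _.
rewrite (antipodeM hS) -addn1; apply: ideal_expM; first exact: IH.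
by apply: ideal_exp1; rewrite /aug_ideal /= (antipode_eps hS).
Qed.

End AugmentationPowers.

Section SpanOver.
Variables (R S : comNzRingType) (f : {rmorphism R -> S}).

Lemma span_over_mem (V : lmodType S) (X : set V) x : X x -> span_over f X x.
Proof.
move=> Xx; exists [:: (1, x)]; last by rewrite big_seq1 rmorph1 scale1r.
by move=> p; rewrite inE => /eqP->.
Qed.

Lemma span_over_lin (V : lmodType S) (X : set V) a x y :
  span_over f X x -> span_over f X y -> span_over f X (f a *: x + y).
Proof.
move=> [s hs ->] [s' hs' ->]; exists ([seq (a * p.1, p.2) | p <- s] ++ s').
  by move=> p; rewrite mem_cat => /orP[/mapP[q /hs ? ->]|/hs'].
rewrite big_cat big_map /= scaler_sumr; congr (_ + _).
by apply: eq_bigr => p _; rewrite rmorphM scalerA.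
Qed.

Lemma span_over0 (V : lmodType S) (X : set V) : span_over f X 0.
Proof. by exists [::]; rewrite ?big_nil. Qed.

Lemma span_over_sub (V : lmodType S) (X N : set V) :
  N 0 -> (forall a x y, N x -> N y -> N (f a *: x + y)) -> X `<=` N -> span_over f X `<=` N.
Proof.
move=> N0 Nl XN _ [s hs ->]; elim: s hs => [|p s IH] hs; first by rewrite big_nil.
rewrite big_cons; apply: Nl; first by apply: XN; apply: hs; rewrite mem_head.
by apply: IH => q qs; apply: hs; rewrite inE qs orbT.
Qed.

End SpanOver.

Section FilteredSpan.
Variables (R0 : comNzRingType) (R S : idomainType).
Variables (g : {rmorphism R0 -> S}) (f : {rmorphism R -> S}).
Variables (A : bialgebra R0) (E : bialgebra S) (iota : A -> E).
Variables (G : nat -> set A) (tau : nat -> S).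
Hypotheses (hiota : bialg_hom g iota) (hG : bialg_filtration G).
Hypotheses (tau0 : tau 0 = 1) (tauD : forall i j, tau (i + j)%N = tau i * tau j).
Hypothesis geps : forall x, exists a, g (eps (x : A)) = f a.

(** With [tau n = t^-n] and powers of the augmentation ideal this serves for [B^∨_t], where [f] is
    [laurent_poly], and for the [∨] of a [{poly k}]-bialgebra, where [f] is [tofrac].
    Multiplicativity of [tau] distributes [t^-n] over products and over the two legs of a
    coproduct. *)
Lemma filtered_span_closed :
  sub_bialg_closed f (span_over f [set z | exists n x, G n x /\ z = tau n *: iota x]).
Proof.
case: hG => Gs G0 GM Gcop Geps; set gen := [set z | _]; set X := span_over f gen.
have Xl a x y : X x -> X y -> X (f a *: x + y) by exact: span_over_lin.
have X0 : X 0 by exact: span_over0.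
have XD x y : X x -> X y -> X (x + y).
  by move=> Xx Xy; rewrite -[x]scale1r -(rmorph1 f); exact: Xl.
have XZ a x : X x -> X (f a *: x) by move=> Xx; rewrite -[_ *: _]addr0; exact: Xl.
have li := bialg_hom_slin hiota.
split.
- by split.
- split; first by apply: span_over_mem; exists 0%N, 1; rewrite tau0 scale1r (bialg_hom1 hiota).
  move=> x y Xx Xy; move: x Xx; apply: span_over_sub => [|a x x' h h'|x [n [x0 [Gx ->]]]].
  + by rewrite /= mul0r.
  + by rewrite /= mulrDl -scalerAl; exact: Xl.
  move: y Xy; apply: span_over_sub => [|a y y' h h'|y [m [y0 [Gy ->]]]].
  + by rewrite /= mulr0.
  + by rewrite /= mulrDr -scalerAr; exact: Xl.
  rewrite /= -scalerAl -scalerAr scalerA -tauD -(bialg_homM hiota).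
  by apply: span_over_mem; exists (n + m)%N, (x0 * y0); split=> //; exact: GM.
- apply: span_over_sub => [|a x y [b ex] [c ey]|x [n [x0 [Gx ->]]]].
  + by exists 0; rewrite linear0 rmorph0.
  + by exists (a * b + c); rewrite [LHS](@eps_slin _ E) ex ey rmorphD rmorphM.
  + case: n Gx => [|n] Gx; rewrite /= [eps _](slinZ (@eps_slin _ E)) (bialg_hom_eps hiota).
      by rewrite tau0 [_ *: _]mul1r.
    by exists 0; rewrite (Geps _ _ Gx) !rmorph0; exact: mulr0.
- apply: span_over_sub => [|a x y [s hs ex] [s' hs' ey]|x [n [x0 [Gx ->]]]].
  + by exists [::]; rewrite // linear0 big_nil.
  + exists ([seq (f a *: p.1, p.2) | p <- s] ++ s').
      move=> p; rewrite mem_cat => /orP[/mapP[q /hs [X1 X2] ->]|/hs' //].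
      by split=> //; exact: XZ.
    rewrite linearP ex ey big_cat big_map /= scaler_sumr; congr (_ + _).
    by apply: eq_bigr => p _; rewrite pureZl.
  + have [s hs e] := Gcop n x0 Gx.
    pose XT (u : tens E E) := exists2 s : seq (E * E),
      forall p, p \in s -> X p.1 /\ X p.2 & u = \sum_(p <- s) pure p.1 p.2.
    rewrite linearZ /= (bialg_hom_cop hiota) e (is_add_sum (tens_map_add li li)) scaler_sumr.
    rewrite -[exists2 s, _ & _]/(XT _) big_seq; apply: (big_ind XT).
    * by exists [::]; rewrite ?big_nil.
    * move=> _ _ [s1 h1 ->] [s2 h2 ->]; exists (s1 ++ s2); last by rewrite big_cat.
      by move=> p; rewrite mem_cat => /orP[/h1|/h2].
    * move=> p /hs[i [j [<- Gi Gj]]].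
      exists [:: (tau i *: iota p.1, tau j *: iota p.2)].
        move=> q; rewrite inE => /eqP-> /=; split; apply: span_over_mem.
          by exists i, p.1.
        by exists j, p.2.
      by rewrite big_seq1 (tens_map_pure li li) tauD pureZl pureZr scalerA.
Qed.

End FilteredSpan.

(** * Rees bialgebras *)

Section Vee.
Variables (k : fieldType) (B : bialgebra k).
Local Notation Jn := (ideal_exp (@aug_ideal k B)).

(* In the quotient the powers of the augmentation ideal have trivial
   intersection, so that adapted functionals kill them eventually. *)
Lemma vee_exists : exists V : bialgebra k, is_vee B V.
Proof.
have [Js J0 JM Jcop Jeps] := ideal_exp_filtration B.
pose I := \bigcap_n Jn n.
have hI : submod I.
  split=> [n _|a x y Ix Iy n _]; first by case: (Js n).
  by case: (Js n) => _; apply; [exact: Ix | exact: Iy].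
have [||||V [pi hpi]] := quotient_bialgebra_exists hI; last by exists V, pi.
- by move=> x y Iy n _; apply: ideal_expl; exact: Iy.
- by move=> x y Ix n _; apply: ideal_expr; exact: Ix.
- by move=> x /(_ 1%N Logic.I); exact: Jeps.
move=> V p lp surj kerp x Ix.
have pD := slin_add lp.
pose F n := p @` Jn n.
have hF n : submod (F n).
  split; first by exists 0; [case: (Js n) | exact: is_add0].
  move=> a _ _ [y Jy <-] [z Jz <-]; exists (a *: y + z); last by rewrite lp.
  by case: (Js n) => _; apply.
have FS n : F n.+1 `<=` F n by move=> _ [y Jy <-]; exists y => //; exact: ideal_expS.
have F0 y : F 0%N y by have [z <-] := surj y; exists z.
have Fsep y : (forall n, F n y) -> y = 0.
  have [z <-] := surj y => h; apply/kerp => n _.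
  have [z' Jz' e] := h n; rewrite -[z](subrK z'); apply: (submodD (Js n)) => //.
  by have /kerp : p (z - z') = 0; [rewrite (is_addB pD) e subrr | apply].
pose u := tens_map p p (cop x).
have [K [w [d [l [[wF ll lF lw] hl]]]]] :=
  adapted_family hF F0 FS Fsep (map fst (tens_repr u) ++ map snd (tens_repr u)).
rewrite -[tens_map _ _ _]/u.
rewrite (@tens_expand k V V K K w l w l u); first last.
- by move=> q qu; apply: hl; rewrite mem_cat map_f ?orbT.
- by move=> q qu; apply: hl; rewrite mem_cat map_f.
rewrite big1 // => -[i j] _ /=.
have bal := functional_pair_balanced (ll i) (ll j).
(* In a splitting [a + b = d i + d j + 1] either [a > d i] or [b > d j], and the corresponding
   functional vanishes. *)
have [s hs e] := Jcop (d i + d j).+1 x (Ix _ Logic.I).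
rewrite /u tens_fold_map // e (is_add_sum (tens_fold_add (balanced_slin lp lp bal))).
rewrite big_seq big1 ?scale0r // => q /hs[a [b [eab Ja Jb]]].
rewrite tens_foldE; last exact: (balanced_slin lp lp bal).
have Fle m n : (m <= n)%N -> F n `<=` F m by exact: (filtration_le FS).
have [ale|alt] := leqP a (d i); last by rewrite (lF i) ?mul0r //; apply: (Fle _ _ alt); exists q.1.
have [ble|blt] := leqP b (d j); last by rewrite (lF j) ?mulr0 //; apply: (Fle _ _ blt); exists q.2.
by have := leq_add ale ble; rewrite eab ltnn.
Qed.

(** Each power of the augmentation ideal of [V] is contained in the image of the same power in [B],
    and the kernel of [pi] lies in every [Jn n]; a preimage of [x] therefore lies in all of them. *)
Lemma vee_separated (V : bialgebra k) (x : V) :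
  is_vee B V -> (forall n, ideal_exp (@aug_ideal k V) n x) -> x = 0.
Proof.
move=> [pi [hpi surj kerpi]] hx; have lpi := bialg_hom_slin hpi; have piD := slin_add lpi.
have sub n : ideal_exp (@aug_ideal k V) n `<=` pi @` Jn n.
  elim: n => [|n IH] y; first by have [z _ <-] : range pi y by [rewrite surj]; exists z.
  apply: ideal_mul_sub y => [|a b ea Jb].
    have [J0 Jl] := ideal_exp_submod B n.+1.
    split; first by exists 0 => //; exact: is_add0.
    by move=> a _ _ [y Jy <-] [z Jz <-]; exists (a *: y + z); [exact: Jl | rewrite lpi].
  have [a' _ ea'] : range pi a by rewrite surj.
  have [b' Jb' <-] := IH _ Jb; exists (a' * b'); last by rewrite (bialg_homM hpi) ea'.
  by apply: ideal_mul_gen => //; move: ea; rewrite /aug_ideal /= -ea' (bialg_hom_eps hpi).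
have [z _ ez] : range pi x by rewrite surj.
have Iz : (\bigcap_n Jn n) z.
  move=> n _; have [z' Jz' e] := sub n x (hx n).
  rewrite -[z](subrK z'); apply: (submodD (ideal_exp_submod B n)) => //.
  have : [set y | pi y = 0] (z - z') by rewrite /= (is_addB piD) e ez subrr.
  by rewrite kerpi; apply.
by move: Iz; rewrite -kerpi /= ez.
Qed.

End Vee.

Section Rees.
Variables (k : fieldType) (V : bialgebra k) (G : nat -> set V).
Hypotheses (hG : bialg_filtration G) (GS : forall n, G n.+1 `<=` G n).
Hypothesis Gsep : forall x, (forall n, G n x) -> x = 0.

Local Notation lp := (@laurent_poly k).
Local Notation T n := (laurent_inv k n).

Let gens (E : bialgebra (laurent k)) (iota : V -> E) :=
  [set z | exists n x, G n x /\ z = T n *: iota x].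

Lemma base_change_torsion_free (S : idomainType) (f : {rmorphism k -> S}) (A : bialgebra k)
    (E : bialgebra S) (iota : A -> E) : is_base_change f iota -> torsion_free E.
Proof.
move=> bc; apply: locally_split_torsion_free; apply: (locally_split_base_change bc).
exact: locally_split_field.
Qed.

Lemma rees_exists (E : bialgebra (laurent k)) (iota : V -> E) :
  is_base_change (laurent_const k) iota ->
  exists (Vt : bialgebra {poly k}) (i : Vt -> E), is_sub lp i (span_over lp (gens iota)).
Proof.
move=> bc; apply: sub_bialgebra_exists.
- exact: euclid_poly.
- exact: localizing_laurent.
- exact: (base_change_torsion_free bc).
- case: bc => hiota _; apply: (filtered_span_closed hiota hG).
  + exact: laurent_inv0.
  + exact: laurent_invD.
  + by move=> x; exists (eps x)%:P.
Qed.

(** An adapted family [w] of orders [d] yields the basis [t^(-d j) w j] with dual functionals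
    [t^(d j) l j]. These take polynomial values on the lattice because [l j] vanishes on [G n] for
    [n > d j]. *)
Lemma rees_locally_split (E : bialgebra (laurent k)) (iota : V -> E) (Vt : bialgebra {poly k})
    (i : Vt -> E) : is_base_change (laurent_const k) iota ->
  is_sub lp i (span_over lp (gens iota)) -> locally_split Vt.
Proof.
move=> bc [hi inji ranX] s; have [hiota _] := bc.
have li := bialg_hom_slin hi; have liota := bialg_hom_slin hiota.
have spanX y : span_over lp (gens iota) (i y) by rewrite -ranX; exists y.
have [ss hss] : exists ss : seq V, forall y, y \in s -> exists2 cs : seq ({poly k} * E),
    forall p, p \in cs -> exists n x, [/\ x \in ss, G n x & p.2 = T n *: iota x]
    & i y = \sum_(p <- cs) lp p.1 *: p.2.
  elim: s => [|y s [ss IH]]; first by exists [::].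
  have [cs hcs ey] := spanX y.
  have [ss' hss'] : exists ss' : seq V, forall p, p \in cs ->
      exists n x, [/\ x \in ss', G n x & p.2 = T n *: iota x].
    elim: cs hcs {ey} => [|p cs IHcs] hcs; first by exists [::].
    have [|ss' h'] := IHcs; first by move=> q qcs; apply: hcs; rewrite inE qcs orbT.
    have [n [x [Gx e]]] := hcs p (mem_head _ _).
    exists (x :: ss') => q; rewrite inE => /predU1P[->|/h' [m [z [zs Gz e']]]].
      by exists n, x; rewrite mem_head.
    by exists m, z; rewrite inE zs orbT.
  exists (ss' ++ ss) => z; rewrite inE => /predU1P[->|/IH[cs' h e]].
    exists cs => // p /hss'[n [x [xs Gx e]]]; exists n, x; split=> //.
    by rewrite mem_cat xs.
  exists cs' => // p /h[n [x [xs Gx e']]]; exists n, x; split=> //.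
  by rewrite mem_cat xs orbT.
have [Gs G0 _ _ _] := hG.
have [I [w [d [l [[wG ll lG lw] hl]]]]] := adapted_family Gs G0 GS Gsep ss.
have Gle m n : (m <= n)%N -> G n `<=` G m by exact: (filtration_le GS).
have lft j : exists F : E -> (laurent k)^o, slinear idfun F /\
    forall x, F (iota x) = laurent_const k (l j x).
  have [|F lF hF] := @base_change_lift _ _ _ _ _ _ bc (laurent k)^o
    (fun x => laurent_const k (l j x)); last by exists F.
  by move=> a x y; rewrite ll rmorphD rmorphM.
have [F hF] := choice lft.
have FD j := slin_add (proj1 (hF j)); have FZ j := slinZ (proj1 (hF j)).
have Fgen j n x : G n x -> exists p, lp 'X^(d j) * F j (T n *: iota x) = lp p.
  move=> Gx; rewrite FZ (proj2 (hF j)) -[_ *: _]/(_ * _).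
  have [le|lt] := leqP n (d j).
    exists ('X^(d j - n) * (l j x)%:P).
    rewrite -{1}(subnK le) exprD !rmorphM /= -!mulrA; congr (_ * _).
    by rewrite mulrA laurent_invK mul1r.
  by exists 0; rewrite (lG j) ?rmorph0 ?mulr0 //; exact: (Gle _ _ lt).
have Fpoly j y : exists p, lp 'X^(d j) * F j (i y) = lp p.
  move: (i y) (spanX y); apply: span_over_sub => [|a x z [p ep] [q eq]|z [n [x [Gx ->]]]] /=.
  - by exists 0; rewrite (is_add0 (FD j)) mulr0 rmorph0.
  - exists (a * p + q); rewrite FD FZ mulrDr eq rmorphD rmorphM /= -ep.
    by congr (_ + _); exact: mulrCA.
  - exact: Fgen.
pose Q j y : {poly k}^o := projT1 (cid (Fpoly j y)).
have QE j y : lp (Q j y) = lp 'X^(d j) * F j (i y) by rewrite /Q; case: (cid _).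
have exe j : exists y, i y = T (d j) *: iota (w j).
  have : span_over lp (gens iota) (T (d j) *: iota (w j)).
    by apply: span_over_mem; exists (d j), (w j); split=> //; exact: wG.
  by rewrite -ranX => -[y _ <-]; exists y.
have [e ee] := choice exe.
exists I, e, Q; split.
- move=> j a x y; apply: laurent_poly_inj.
  rewrite QE li FD FZ mulrDr -[_ *: _ in RHS]/(a * Q j x) rmorphD rmorphM /= !QE.
  by congr (_ + _); exact: mulrCA.
- move=> j j'; apply: laurent_poly_inj; rewrite QE ee FZ (proj2 (hF j)) lw rmorph_nat.
  rewrite -[_ *: _]/(_ * _) mulrA.
  case: eqP => [->|_]; last by rewrite mulr0 rmorph0.
  by rewrite laurent_invK mulr1 rmorph1.
- move=> y ys; apply: inji; rewrite (is_add_sum (slin_add li)).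
  under eq_bigr do rewrite (slinZ li) /= QE ee scalerA -mulrA mulrCA laurent_invK mulr1.
  have [cs hcs ->] := hss y ys.
  transitivity (\sum_(p <- cs) \sum_j (F j (lp p.1 *: p.2) : laurent k) *: iota (w j)).
    rewrite !big_seq; apply: eq_bigr => p /hcs[n [x [/hl ex Gx ->]]].
    rewrite {1}ex (is_add_sum (slin_add liota)) scalerA scaler_sumr; apply: eq_bigr => j _.
    by rewrite (slinZ liota) !FZ (proj2 (hF j)) !scalerA.
  rewrite exchange_big; apply: eq_bigr => j _ /=.
  by rewrite (is_add_sum (FD j)) scaler_suml.
Qed.

End Rees.

(** * The Drinfeld prime *)

Lemma submod_basis_fin (R : idomainType) (E : lmodType R) (X : set E) (I : finType)
    (l : I -> E -> R^o) :
  euclid R -> submod X -> (forall i, slinear idfun (l i)) ->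
  (forall x, X x -> (forall i, l i x = 0) -> x = 0) ->
  exists fs, [/\ forall i, (i < size fs)%N -> X fs`_i, indep fs & X `<=` span fs].
Proof.
move=> eucl hX ll inj.
pose l' m : E -> R^o := if insub m : option 'I_#|I| is Some o then l (enum_val o) else fun=> 0.
apply: (@submod_basis R E eucl X #|I| l') => // [m|x Xx h].
  by rewrite /l'; case: insub => // a x y; rewrite scaler0 addr0.
apply: inj => // i; have := h (enum_rank i) (ltn_ord _).
by rewrite /l' valK enum_rankK.
Qed.

Section DrinfeldPrime.
Variables (k : fieldType) (M : bialgebra {poly k}).
Hypothesis hM : locally_split M.
Local Notation R := {poly k}.
Local Notation t := ('X : {poly k}).

Definition drinfeld_set : set M :=
  [set b | forall n, exists u : tpow M n, delta n b = 'X^n *: u].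
Local Notation X := drinfeld_set.

Let tfn n : torsion_free (tpow M n).
Proof. by apply: locally_split_torsion_free; exact: locally_split_tpow. Qed.

Let tf_cancel n m (x y : tpow M n) : 'X^m *: x = 'X^m *: y -> x = y.
Proof.
move=> e; apply/eqP; rewrite -subr_eq0; apply/eqP.
have /(@tfn n)[] // : ('X^m : R) *: (x - y) = 0 by rewrite scalerBr e subrr.
by move/eqP; rewrite -size_poly_eq0 size_polyXn.
Qed.

Let deltaD n := slin_add (@delta_slin _ M n).
Let deltaZ n := slinZ (@delta_slin _ M n).

Lemma drinfeld_submod : submod X.
Proof.
split=> [n|a x y hx hy n]; first by exists 0; rewrite (is_add0 (@deltaD n)) scaler0.
have [u eu] := hx n; have [v ev] := hy n; exists (a *: u + v).
by rewrite delta_slin eu ev scalerDr !scalerA mulrC.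
Qed.

Lemma drinfeld1 : X 1.
Proof.
case=> [|n]; last by exists 0; rewrite delta1 scaler0.
by exists (1 : R^o); rewrite -[delta _ _]/(eps _) eps1 expr0 scale1r.
Qed.

(** Writing [y = augm y + ε(y)] in the second leg splits the image under δ_n into a part that
    factors through [δ_(n+1) b], divisible by [t^(n+1)], and the term [l 1 · δ_n b]. *)
Lemma drinfeld_functional (l : M -> R^o) b : slinear idfun l -> X b ->
  X (sw b (fun x y => (l y : R) *: x)).
Proof.
move=> ll Xb n; have [s ls hs] := delta_split_last M n.
have [u eu] := Xb n; have [v ev] := Xb n.+1.
pose Phi : tens (tpow M n) M -> tpow M n := tens_fold (fun w y => (l y : R) *: w).
have PB : balanced (fun (w : tpow M n) y => (l y : R) *: w).
  split=> [w1 w2 y|w y1 y2|a w y]; first by rewrite scalerDr.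
    by rewrite (slin_add ll) scalerDl.
  by rewrite (slinZ ll) !scalerA mulrC.
have Pl : slinear idfun Phi.
  by apply: tens_fold_slin => // a w y; rewrite !scalerA mulrC.
exists (t *: Phi (s v) + (l 1 : R) *: u).
have -> : delta n (sw b (fun x y => (l y : R) *: x)) =
    Phi (sw b (fun x y => pure (delta n x) (augm y))) + (l 1 : R) *: delta n b.
  rewrite (sw_comp _ _ (@deltaD n)) (sw_comp _ _ (slin_add Pl)).
  have -> : delta n b = sw b (fun x y => delta n (eps y *: x)).
    by rewrite (sw_epsr b (@deltaD n)).
  rewrite (sw_comp (F := fun z => (l 1 : R) *: z)); last exact: scalerDr.
  rewrite -swD; apply: eq_sw => x y; rewrite /Phi tens_foldE // !deltaZ scalerA -scalerDl.
  congr (_ *: _); rewrite {1}(augmE y) (slin_add ll) (slinZ ll).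
  by congr (_ + _); exact: mulrC.
rewrite hs ev eu (slinZ ls) (slinZ Pl) scalerDr !scalerA exprS.
by rewrite [_ * 'X^n]mulrC [in X in _ + X]mulrC.
Qed.

(** Divisibility of [δ_0 h] by [t] and of [δ_1 h] by [t^2] makes [h = augm h + ε(h)] itself
    divisible by [t], and one factor [t] cancels in every [δ_n h]. Independence modulo [t X] is used
    in this form. *)
Let X_reg h : (forall n, exists z : tpow M n, delta n h = 'X^(n.+1) *: z) ->
  exists2 h', X h' & h = t *: h'.
Proof.
move=> hz; have [z0 e0] := hz 0%N; have [z1 e1] := hz 1%N.
have [kappa lk hk] := augm_of_delta M.
have eh : h = t *: (t *: kappa z1 + (z0 : R)%:A).
  rewrite {1}(augmE h) -hk e1 (slinZ lk) -[eps h]/(delta 0 h) e0 expr1.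
  by rewrite scalerDr !scalerA expr2.
exists (t *: kappa z1 + (z0 : R)%:A); last exact: eh.
move=> n; have [z ez] := hz n; exists z; apply: (@tf_cancel n 1).
by rewrite scalerA -exprS -ez expr1 -(deltaZ) -eh.
Qed.

Lemma drinfeld_cop b : X b -> exists2 s : seq (M * M),
  forall p, p \in s -> X p.1 /\ X p.2 & cop b = \sum_(p <- s) pure p.1 p.2.
Proof.
move=> Xb; set u := cop b.
have [I [e [l [ll le hl]]]] := hM (map fst (tens_repr u) ++ map snd (tens_repr u)).
have lD i := slin_add (ll i); have lZ i := slinZ (ll i).
pose W := [set x | x = \sum_i (l i x : R) *: e i].
have hW : submod W.
  split=> [|a x y Wx Wy]; rewrite /W /=.
    by rewrite big1 // => i _; rewrite (is_add0 (lD i)) scale0r.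
  rewrite {1}Wx {1}Wy scaler_sumr -big_split; apply: eq_bigr => i _.
  by rewrite ll scalerDl scalerA.
(* The coordinates of the second leg, applied to the coproduct, give coefficients [v j] that lie
   both in [X] and in the finite free summand [W]. *)
pose v j := sw b (fun x y => (l j y : R) *: x).
have Xv j : X (v j) by exact: drinfeld_functional.
have Wv j : W (v j).
  rewrite /v /sw /tens_fold; apply: (submod_sum hW) => p pu _; apply: submodZ => //.
  by apply: hl; rewrite mem_cat map_f.
have uE : u = \sum_j pure (v j) (e j).
  rewrite [LHS]tens_sum_pure.
  transitivity (\sum_(p <- tens_repr u) \sum_j (pure ((l j p.2 : R) *: p.1) (e j) : tens M M)).
    rewrite !big_seq; apply: eq_bigr => p pu.
    rewrite {1}(hl p.2); last by rewrite mem_cat map_f ?orbT.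
    rewrite (is_add_sum (pure_addr _)); apply: eq_bigr => j _.
    by rewrite pureZl pureZr.
  rewrite exchange_big; apply: eq_bigr => j _.
  by rewrite /v /sw /tens_fold (is_add_sum (pure_addl _)).
pose Y := X `&` W.
have hY : submod Y.
  have [X0 Xl] := drinfeld_submod; have [W0 Wl] := hW.
  by split=> // a x y [Xx Wx] [Xy Wy]; split; [exact: Xl | exact: Wl].
(* The coordinates [l] separate the points of [W], so [Y] has a finite basis [fs]; regrouping the
   coproduct along [fs] moves the coefficients into the second legs [z i]. *)
have [|fs [Yfs ifs sfs]] := submod_basis_fin (@euclid_poly k) hY ll.
  by move=> x [_ Wx] h; rewrite [LHS]Wx big1 // => i _; rewrite h scale0r.
have [C hC] := choice (fun j => sfs (v j) (conj (Xv j) (Wv j))).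
pose z i := \sum_j C j i *: e j.
have uE2 : u = \sum_(i < size fs) pure fs`_i (z i).
  rewrite uE; transitivity (\sum_j \sum_(i < size fs) (pure fs`_i (C j i *: e j) : tens M M)).
    apply: eq_bigr => j _; rewrite {1}hC (is_add_sum (pure_addl _)).
    by apply: eq_bigr => i _; rewrite pureZl pureZr.
  rewrite exchange_big; apply: eq_bigr => i _.
  by rewrite /z (is_add_sum (pure_addr _)).
exists [seq (fs`_i, z i) | i <- iota 0 (size fs)]; last first.
  by rewrite big_map uE2 -[in LHS](big_mkord xpredT (fun i => pure fs`_i (z i))) /index_iota subn0.
move=> p /mapP[i0]; rewrite mem_iota /= add0n => li0 -> /=; split; first by case: (Yfs _ li0).
move=> m.
(* The exponent is raised one unit at a time up to [m]; each round gains one factor [t] for all the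
   [z i] together. *)
suff claim j : (j <= m)%N -> forall i, (i < size fs)%N ->
    exists y : tpow M m, delta m (z i) = 'X^j *: y by exact: claim.
elim: j => [|j IH] jm i li; first by exists (delta m (z i)); rewrite expr0 scale1r.
have [y hy] : exists y : nat -> tpow M m, forall i, (i < size fs)%N -> delta m (z i) = 'X^j *: y i.
  have ex i1 : exists y : tpow M m, (i1 < size fs)%N -> delta m (z i1) = 'X^j *: y.
    have [lt|_] := ltnP i1 (size fs); last by exists 0.
    by have [y ey] := IH (ltnW jm) i1 lt; exists y.
  by have [y hy] := choice ex; exists y.
(* The element [h] is formed so that [t^j δ_n h] is a linear image of [δ_(n+m) b]. Hence [δ_n h] is
   divisible by [t^(n+m-j)], and [j < m] leaves the extra factor that [X_reg] asks for. *)
have mu_div (mu : tpow M m -> R^o) : slinear idfun mu -> exists d : R, mu (y i) = d * t.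
  move=> lmu; pose h := \sum_(i < size fs) (mu (y i) : R) *: fs`_i.
  have Wh : W h.
    by apply: (submod_sum hW) => i1 _ _; apply: submodZ => //; case: (Yfs i1 (ltn_ord _)).
  have [n|h' Xh' eh] := @X_reg h.
    pose Phi : tens (tpow M n) (tpow M m) -> tpow M n :=
      tens_fold (fun w w' => (mu w' : R) *: w).
    have PB : balanced (fun (w : tpow M n) (w' : tpow M m) => (mu w' : R) *: w).
      split=> [w1 w2 w'|w w1 w2|a w w']; first by rewrite scalerDr.
        by rewrite (slin_add lmu) scalerDl.
      by rewrite (slinZ lmu) !scalerA mulrC.
    have Pl : slinear idfun Phi.
      by apply: tens_fold_slin => // a w w'; rewrite !scalerA mulrC.
    have [s ls hs] := delta_split M n m; have [w ew] := Xb (n + m)%N.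
    have ldd := tens_map_slin (@delta_slin _ M n) (@delta_slin _ M m).
    exists ('X^(m - j.+1) *: Phi (s w)); apply: (@tf_cancel n j).
    have -> : 'X^j *: delta n h = Phi (tens_map (@delta _ M n) (@delta _ M m) u).
      rewrite uE2 (is_add_sum (slin_add ldd)) (is_add_sum (slin_add Pl)).
      rewrite (is_add_sum (@deltaD n)) scaler_sumr; apply: eq_bigr => i1 _.
      rewrite (tens_map_pure (@delta_slin _ M n) (@delta_slin _ M m)) /Phi tens_foldE //.
      by rewrite hy // (slinZ lmu) deltaZ scalerA.
    rewrite -[tens_map _ _ _]/(sw b _) hs ew (slinZ ls) (slinZ Pl) !scalerA -!exprD.
    congr (_ *: _); congr (_ ^+ _); rewrite -[in LHS](subnK jm) !(addnS, addSn).
    by congr _.+1; rewrite addnA addnC addnA.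
  (* [W] is cut out by linear equations, so torsion-freeness puts [h'] in [W] along with [t h'].
     Comparing the expansions of [h] and [t h'] along [fs] gives the divisibility of each
     [mu (y i)]. *)
  have [|d ed] := sfs h'.
    split=> //; have := Wh; rewrite /W /= eh => e1.
    have tfM : torsion_free M by exact: locally_split_torsion_free.
    apply/eqP; rewrite -subr_eq0; apply/eqP.
    have [] // := tfM t (h' - \sum_i (l i h' : R) *: e i).
      rewrite scalerBr {1}e1 scaler_sumr -sumrB big1 // => i1 _.
      by rewrite lZ scalerA subrr.
    by move/eqP; rewrite polyX_eq0.
  exists (d i); rewrite mulrC.
  apply: (indep_coef (c := fun i => mu (y i)) (d := fun i => t * d i) ifs) => //.
  rewrite -/h eh ed scaler_sumr; apply: eq_bigr => i1 _.
  by rewrite scalerA.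
(* Divisibility of all coordinates of [y i] by [t] in a finite free summand amounts to divisibility
   of [y i] itself. *)
have [K [e' [l' [ll' _ hl']]]] := locally_split_tpow hM (n := m) [:: y i].
have [d hd] := choice (fun a => mu_div _ (ll' a)).
exists (\sum_a d a *: e' a); rewrite hy // exprSr -scalerA; congr (_ *: _).
rewrite (hl' (y i)) ?mem_head // scaler_sumr; apply: eq_bigr => a _.
by rewrite scalerA hd mulrC.
Qed.

(** The coproducts of [b] and [c] have all entries in [X] by [drinfeld_cop], so [δ_(n+1) (b c)] is a
    sum of terms [augm (p q) ⊗ δ_n (p' q')]: the first factor contributes one [t], the induction on
    [n] the remaining [t^n]. *)
Lemma drinfeldM b c : X b -> X c -> X (b * c).
Proof.
move=> Xb Xc n; elim: n b c Xb Xc => [|n IH] b c Xb Xc.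
  by exists (eps (b * c) : R^o); rewrite expr0 scale1r.
have [s hs eb] := drinfeld_cop Xb; have [s' hs' ec] := drinfeld_cop Xc.
have ladd := tens_map_add (@augm_slin _ M) (@delta_slin _ M n).
have -> : delta n.+1 (b * c) = tens_map (@augm _ M) (@delta _ M n) (cop (b * c)).
  by rewrite deltaS.
rewrite copM eb ec (is_add_sum (tens_mul_addl _)) (is_add_sum ladd).
pose D := [set w : tpow M n.+1 | exists z, w = 'X^(n.+1) *: z].
have hD : submod D.
  split=> [|a _ _ [z ->] [z' ->]]; first by exists 0; rewrite scaler0.
  by exists (a *: z + z'); rewrite scalerDr !scalerA mulrC.
rewrite -[exists _, _]/(D _); apply: (submod_sum hD) => p /hs[Xp1 Xp2] _.
rewrite (is_add_sum (tens_mul_addr _)) (is_add_sum ladd).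
apply: (submod_sum hD) => q /hs'[Xq1 Xq2] _.
rewrite tens_mulE (tens_map_pure (@augm_slin _ M) (@delta_slin _ M n)).
have augmX x : X x -> exists y, augm x = t *: y.
  move=> /(_ 1%N)[z ez]; have [kappa lk hk] := augm_of_delta M.
  by exists (kappa z); rewrite -hk ez (slinZ lk) expr1.
have [y1 e1] := augmX _ Xp1; have [y2 e2] := augmX _ Xq1; have [w ew] := IH _ _ Xp2 Xq2.
exists (pure (y1 * q.1 + eps p.1 *: y2) w).
have -> : augm (p.1 * q.1) = augm p.1 * q.1 + eps p.1 *: augm q.1.
  rewrite /augm epsM mulrBl scalerBr -scalerAl mul1r scalerA.
  by rewrite addrA subrK.
rewrite e1 e2 -scalerAl scalerA [eps _ * _]mulrC -scalerA -scalerDr ew.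
by rewrite pureZl pureZr scalerA -exprS.
Qed.

Lemma drinfeld_prime_exists : exists H : bialgebra R, is_drinfeld_prime M H.
Proof.
have [||||H [i hi]] := @sub_bialgebra_exists R R idfun M X; last by exists H, i.
- exact: euclid_poly.
- exact: localizing_id.
- exact: locally_split_torsion_free.
- split; [exact: drinfeld_submod | | by move=> x _; exists (eps x) | exact: drinfeld_cop].
  by split; [exact: drinfeld1 | exact: drinfeldM].
Qed.

End DrinfeldPrime.

(** * Specialisation at t = 1 *)

Lemma bialg_hom_comp (R1 R2 R3 : comNzRingType) (f : {rmorphism R1 -> R2})
    (g : {rmorphism R2 -> R3}) (h : {rmorphism R1 -> R3})
    (A : bialgebra R1) (B : bialgebra R2) (C : bialgebra R3) (phi : A -> B) (psi : B -> C) :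
  (forall a, h a = g (f a)) -> bialg_hom f phi -> bialg_hom g psi -> bialg_hom h (psi \o phi).
Proof.
move=> hE hphi hpsi; split.
- by move=> a x y /=; rewrite (bialg_hom_slin hphi) (bialg_hom_slin hpsi) hE.
- split=> [|x y] /=; first by rewrite (bialg_hom1 hphi) (bialg_hom1 hpsi).
  by rewrite (bialg_homM hphi) (bialg_homM hpsi).
- by move=> x /=; rewrite (bialg_hom_eps hpsi) (bialg_hom_eps hphi) hE.
- move=> x /=; rewrite (bialg_hom_cop hpsi) (bialg_hom_cop hphi).
  by rewrite (tens_map_comp _ _ _ (bialg_hom_slin hpsi) (bialg_hom_slin hpsi)).
Qed.

(** Each compatibility is checked after composing with the injection [i], that with the coproduct
    after [i ⊗ i], which is injective by [tens_map_inj]. The source may live over another ring [R0],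
    as the maps from [k] to [k[t]] and from [k[t]] to [k] require. *)
Lemma bialg_hom_factor (R0 : comNzRingType) (R S : idomainType) (f : {rmorphism R -> S})
    (g : {rmorphism R0 -> R}) (h : {rmorphism R0 -> S})
    (A : bialgebra R) (E : bialgebra S) (C : bialgebra R0) (i : A -> E) (X : set E) (phi : C -> E) :
  euclid R -> localizing f -> torsion_free E -> is_sub f i X ->
  (forall a, h a = f (g a)) -> bialg_hom h phi -> (forall c, X (phi c)) ->
  exists2 j : C -> A, bialg_hom g j & forall c, i (j c) = phi c.
Proof.
move=> eucl locf tf [hi inji <-] hE hphi Xphi.
have li := bialg_hom_slin hi.
have inj2 := tens_map_inj eucl locf tf tf li li inji inji.
have ex c : exists y, i y = phi c by have [y _ e] := Xphi c; exists y.
have [j jE] := choice ex.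
exists j => //.
have lj : slinear g j.
  by move=> a x y; apply: inji; rewrite li !jE (bialg_hom_slin hphi) hE.
split=> //.
- split=> [|x y]; apply: inji; first by rewrite jE (bialg_hom1 hi) (bialg_hom1 hphi).
  by rewrite (bialg_homM hi) !jE (bialg_homM hphi).
- move=> x; apply: (proj1 locf); rewrite -hE -(bialg_hom_eps hphi) -(bialg_hom_eps hi).
  by rewrite jE.
- move=> x; apply: inj2; rewrite -(bialg_hom_cop hi) jE (bialg_hom_cop hphi).
  by rewrite (tens_map_comp _ _ _ li li); apply: eq_tens_map => y /=; rewrite jE.
Qed.

Lemma range_sub_bialg_closed (R S : idomainType) (f : {rmorphism R -> S}) (A : bialgebra R)
    (B : bialgebra S) (phi : A -> B) :
  bialg_hom f phi -> (forall s, exists r, f r = s) -> sub_bialg_closed idfun (range phi).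
Proof.
move=> hphi surjf; have lp := bialg_hom_slin hphi; split.
- split; first by exists 0; rewrite ?(is_add0 (slin_add lp)).
  move=> a _ _ [x _ <-] [y _ <-]; have [r <-] := surjf a.
  by exists (r *: x + y); rewrite ?lp.
- split; first by exists 1; rewrite ?(bialg_hom1 hphi).
  by move=> _ _ [x _ <-] [y _ <-]; exists (x * y); rewrite ?(bialg_homM hphi).
- by move=> x _; exists (eps x).
- move=> _ [x _ <-]; exists [seq (phi p.1, phi p.2) | p <- tens_repr (cop x)].
    by move=> p /mapP[q _ ->]; split; [exists q.1 | exists q.2].
  by rewrite (bialg_hom_cop hphi) /tens_map /tens_fold big_map.
Qed.

Lemma quotient_unique (R S : comNzRingType) (f : {rmorphism R -> S}) (H : bialgebra R)
    (Q V : bialgebra S) (p : H -> Q) (q : H -> V) (I : set H) :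
  (forall s, exists r, f r = s) -> is_quotient f p I -> is_quotient f q I ->
  exists phi : Q -> V, bialg_iso phi.
Proof.
move=> surjf [hp surjp kerp] [hq surjq kerq].
have lp := bialg_hom_slin hp; have lq := bialg_hom_slin hq.
have kpq x y : p x = p y <-> q x = q y.
  have kI z : p z = 0 <-> q z = 0.
    by split=> h; [have : I z by rewrite -kerp | have : I z by rewrite -kerq];
      [rewrite -kerq | rewrite -kerp].
  split=> e; apply/eqP; rewrite -subr_eq0.
    by rewrite -(is_addB (slin_add lq)); apply/eqP/kI; rewrite (is_addB (slin_add lp)) e subrr.
  by rewrite -(is_addB (slin_add lp)); apply/eqP/kI; rewrite (is_addB (slin_add lq)) e subrr.
have exp y : exists x, p x = y by have [x _ <-] : range p y by [rewrite surjp]; exists x.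
have exq y : exists x, q x = y by have [x _ <-] : range q y by [rewrite surjq]; exists x.
have [s sK] := choice exp; have [s' s'K] := choice exq.
exists (q \o s).
have phiE x : (q \o s) (p x) = q x by apply/kpq; rewrite sK.
have lphi : slinear idfun (q \o s).
  move=> a x y; have [r <-] := surjf a; rewrite -(sK x) -(sK y) -lp !phiE.
  by rewrite lq.
split; last first.
  exists (p \o s') => [x|y] /=; last by rewrite -[RHS]s'K; apply/kpq; rewrite sK.
  by rewrite -[RHS]sK; apply/kpq; rewrite s'K.
split=> //.
- split=> [|x y]; first by rewrite -(bialg_hom1 hp) phiE (bialg_hom1 hq).
  by rewrite -(sK x) -(sK y) -(bialg_homM hp) !phiE (bialg_homM hq).
- by move=> x; rewrite -(sK x) phiE (bialg_hom_eps hq) (bialg_hom_eps hp).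
- move=> x; rewrite -(sK x) phiE (bialg_hom_cop hq) (bialg_hom_cop hp).
  by rewrite (tens_map_comp _ _ _ lphi lphi); apply: eq_tens_map => y; rewrite /= -phiE.
Qed.

(** [C] is regarded as an [S1]-module through [g], which turns the semilinear extension into a
    linear lift. *)
Lemma base_change_hom (R1 S1 S2 : comNzRingType) (f : {rmorphism R1 -> S1})
    (g : {rmorphism S1 -> S2}) (h : {rmorphism R1 -> S2})
    (A : bialgebra R1) (E : bialgebra S1) (C : bialgebra S2) (iota : A -> E) (phi : A -> C) :
  is_base_change f iota -> (forall a, h a = g (f a)) -> bialg_hom h phi ->
  exists2 F : E -> C, bialg_hom g F & forall x, F (iota x) = phi x.
Proof.
move=> bc hE hphi; have [hiota _] := bc.
have [|F lF Fi] := @base_change_lift _ _ _ _ _ _ bc (res_mod C g) phi.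
  by move=> a x y; rewrite (bialg_hom_slin hphi) hE.
have lF' : slinear g (F : E -> C) by move=> a x y; rewrite lF.
exists (F : E -> C) => //; have FD := slin_add lF'; have FZ := slinZ lF'.
split=> //.
- split=> [|x y]; first by rewrite -(bialg_hom1 hiota) Fi (bialg_hom1 hphi).
  elim/(base_change_ind bc): x => [c x|x x' hx hx']; last by rewrite mulrDl !FD hx hx' mulrDl.
  elim/(base_change_ind bc): y => [d y|y y' hy hy']; last by rewrite mulrDr !FD hy hy' mulrDr.
  rewrite -scalerAl -scalerAr !FZ -(bialg_homM hiota) !Fi (bialg_homM hphi).
  by rewrite -scalerAl -scalerAr.
- elim/(base_change_ind bc) => [c x|x y hx hy]; last by rewrite FD !linearD hx hy rmorphD.
  rewrite FZ Fi [LHS](slinZ (@eps_slin _ C)) [X in _ = g X](slinZ (@eps_slin _ E)).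
  by rewrite (bialg_hom_eps hiota) (bialg_hom_eps hphi) hE -[in RHS]/(c * _) rmorphM.
- elim/(base_change_ind bc) => [c x|x y hx hy]; last first.
    by rewrite FD !linearD hx hy (tens_map_add lF' lF').
  rewrite FZ Fi !linearZ /= (slinZ (tens_map_slin lF' lF')) (bialg_hom_cop hiota).
  rewrite (bialg_hom_cop hphi); congr (_ *: _); rewrite (tens_map_comp _ _ _ lF' lF').
  by apply: eq_tens_map => y /=; rewrite Fi.
Qed.

Section AtOne.
Variable k : fieldType.
Local Notation R := {poly k}.
Local Notation ev := (horner_eval (1 : k)).
Local Notation t1 := ('X - 1%:P : {poly k}).
Local Notation lp := (@laurent_poly k).

Lemma ev_surj : forall s : k, exists r : R, ev r = s.
Proof. by move=> s; exists s%:P; rewrite /horner_eval hornerC. Qed.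

Lemma poly_sub_at1 (p : R) : exists q : R, p = (p.[1])%:P + t1 * q.
Proof.
have /factor_theorem[q e] : root (p - (p.[1])%:P) 1.
  by rewrite rootE hornerD hornerN hornerC subrr.
by exists q; rewrite mulrC -e addrC subrK.
Qed.

Lemma Xn_sub_at1 n : exists q : R, 'X^n = 1 + t1 * q.
Proof. by have [q e] := poly_sub_at1 'X^n; exists q; rewrite {1}e hornerXn expr1n. Qed.

(** [t^n] is 1 modulo [t - 1], so factors [t] can be cancelled on the fibre. *)
Lemma at1_cancel (C : lmodType R) n (c z : C) : 'X^n *: c = t1 *: z -> exists y, c = t1 *: y.
Proof.
have [q eq] := Xn_sub_at1 n => e; exists (z - q *: c).
by rewrite scalerBr -e eq scalerDl scale1r scalerA addrK.
Qed.

Lemma at1_hom0 (C : bialgebra R) (V : bialgebra k) (p : C -> V) y :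
  bialg_hom ev p -> p (t1 *: y) = 0.
Proof.
move=> hp; rewrite (slinZ (bialg_hom_slin hp)) /= /horner_eval.
by rewrite hornerD hornerN hornerX hornerC subrr scale0r.
Qed.

(** Every element of [A] enters [H] after multiplication by a power of [t]. As [t] acts as 1 on the
    fibre, the inclusion changes nothing at [t = 1]. *)
Lemma at1_restrict (A H : bialgebra R) (V : bialgebra k) (p : A -> V) (i : H -> A) :
  is_quotient ev p [set z | exists y, z = t1 *: y] -> bialg_hom idfun i -> injective i ->
  (forall v, exists n x, i x = 'X^n *: v) ->
  is_quotient ev (p \o i) [set z | exists y, z = t1 *: y].
Proof.
move=> [hp surjp kerp] hi inji cof; have li := bialg_hom_slin hi.
have hpi : bialg_hom ev (p \o i) by exact: (bialg_hom_comp (f := idfun) (g := ev)).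
split=> //.
  apply/seteqP; split=> // y _; have [x _ <-] : range p y by rewrite surjp.
  have [n [z e]] := cof x; exists z => //=.
  by rewrite e (slinZ (bialg_hom_slin hp)) /= /horner_eval hornerXn expr1n scale1r.
apply/seteqP; split=> z; last by move=> [y ->]; exact: at1_hom0.
move=> /= pz; have [y e] : [set z | exists y, z = t1 *: y] (i z) by rewrite -kerp.
have [n [x ex]] := cof y.
apply: (@at1_cancel H n z x); apply: inji.
by rewrite !(slinZ li) ex e !scalerA mulrC.
Qed.

(** The counterpart of [at1_restrict] for an enlargement: [c] receives the value [p y] for any [y]
    with [j y = t^n c]. This does not depend on [n], because [p (t^n x) = p x]. *)
Lemma at1_extend (A C : bialgebra R) (V : bialgebra k) (p : A -> V) (j : A -> C) :
  is_quotient ev p [set z | exists y, z = t1 *: y] -> bialg_hom idfun j -> injective j ->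
  (forall c, exists n y, j y = 'X^n *: c) ->
  exists p' : C -> V, is_quotient ev p' [set z | exists y, z = t1 *: y].
Proof.
move=> [hp surjp kerp] hj injj cof; have lj := bialg_hom_slin hj.
have lp := bialg_hom_slin hp.
have pXn n x : p ('X^n *: x) = p x.
  by rewrite (slinZ lp) /= /horner_eval hornerXn expr1n scale1r.
have [y0 hy0] := choice (fun c => let: ex_intro n (ex_intro y e) := cof c in
  ex_intro (fun y => exists n, j y = 'X^n *: c) y (ex_intro _ n e)).
pose p' c := p (y0 c).
have p'E n y c : j y = 'X^n *: c -> p' c = p y.
  move=> e; have [m em] := hy0 c.
  rewrite /p' -(pXn n) -(pXn m y); congr p; apply: injj.
  by rewrite !(slinZ lj) e em !scalerA mulrC.
have p'j y : p' (j y) = p y by apply: (@p'E 0); rewrite expr0 scale1r.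
have lp' : slinear ev p'.
  move=> a c d; have [n en] := hy0 c; have [m em] := hy0 d.
  rewrite (@p'E (n + m) (a *: ('X^m *: y0 c) + 'X^n *: y0 d)); last first.
    rewrite lj !(slinZ lj) en em scalerDr !scalerA -exprD.
    by congr (_ *: _ + _); rewrite -mulrA -exprD addnC mulrC.
  by rewrite lp !pXn.
have hp' : bialg_hom ev p'.
  split=> //.
  - split=> [|c d]; first by rewrite -(bialg_hom1 hj) p'j (bialg_hom1 hp).
    have [n en] := hy0 c; have [m em] := hy0 d.
    rewrite (@p'E (n + m) (y0 c * y0 d)) ?(bialg_homM hp) //.
    by rewrite (bialg_homM hj) en em -scalerAl -scalerAr scalerA exprD.
  - move=> c; have [n en] := hy0 c; rewrite /p' (bialg_hom_eps hp).
    have := bialg_hom_eps hj (y0 c); rewrite en [eps _](slinZ (@eps_slin _ C)) => /= <-.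
    by rewrite /horner_eval hornerM hornerXn expr1n mul1r.
  - move=> c; have [n en] := hy0 c; rewrite /p' (bialg_hom_cop hp).
    have -> : tens_map p' p' (cop c) = tens_map p' p' ('X^n *: cop c).
      rewrite (slinZ (tens_map_slin lp' lp')) /= /horner_eval hornerXn expr1n.
      by rewrite scale1r.
    rewrite -linearZ -en (bialg_hom_cop hj) (tens_map_comp _ _ _ lp' lp').
    by apply: eq_tens_map => y; rewrite /= p'j.
exists p'; split=> //.
  apply/seteqP; split=> // y _; have [x _ <-] : range p y by rewrite surjp.
  by exists (j x).
apply/seteqP; split=> c; last by move=> [y ->]; exact: at1_hom0.
have [n en] := hy0 c => /= pc.
have [z e] : [set z | exists y, z = t1 *: y] (y0 c) by rewrite -kerp.
by apply: (@at1_cancel C n c (j z)); rewrite -en e (slinZ lj).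
Qed.

(** * Evaluation at [t = 1] on a lattice *)

Section Evaluation.
Variables (V : bialgebra k) (E : bialgebra (laurent k)) (iota : V -> E).
Hypothesis bc : is_base_change (laurent_const k) iota.

Let hiota : bialg_hom (laurent_const k) iota. Proof. by case: bc. Qed.
Let li := bialg_hom_slin hiota.

Lemma evaluation_exists :
  exists2 psi : E -> V, bialg_hom (@laurent_ev k) psi & forall x, psi (iota x) = x.
Proof.
apply: (base_change_hom (h := idfun) (phi := idfun) bc) => [a|].
  by rewrite [RHS]laurent_ev_const.
by split=> // x; rewrite tens_id_sum.
Qed.

Variables (A : bialgebra R) (i : A -> E) (tau : nat -> laurent k) (G : nat -> set V).
Local Notation gens := [set z | exists n x, G n x /\ z = tau n *: iota x].
Hypothesis hi : is_sub lp i (span_over lp gens).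
Hypothesis tau_ev : forall n, laurent_ev (tau n) = 1.
(** [tau n] is congruent to [t^m] modulo [(t - 1) tau n]. For [tau n = t^-n] every [m] will do, for
    [tau n = t^n] it has to be at least [n]; hence the bound [N]. *)
Hypothesis tauX : forall n, exists N, forall m, (N <= m)%N ->
  exists q, lp 'X^m = tau n + lp (t1 * q) * tau n.

Variable psi : E -> V.
Hypotheses (hpsi : bialg_hom (@laurent_ev k) psi) (psii : forall x, psi (iota x) = x).

Lemma at1_hom : bialg_hom ev (psi \o i).
Proof.
case: hi => hhi _ _; apply: (bialg_hom_comp (f := lp) (g := @laurent_ev k)) => // a.
by rewrite [RHS]laurent_ev_poly.
Qed.

Lemma at1_kernel : [set z | (psi \o i) z = 0] = [set z | exists y, z = t1 *: y].
Proof.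
have [hhi inji ranX] := hi; have lhi := bialg_hom_slin hhi.
apply/seteqP; split=> z /=; last by move=> [y ->]; exact: (at1_hom0 _ at1_hom).
have lps := bialg_hom_slin hpsi; have pD := slin_add lps; have pZ := slinZ lps.
set X := span_over lp gens.
have XZ a e : X e -> X (lp a *: e).
  by move=> Xe; rewrite -[_ *: _]addr0; apply: span_over_lin => //; exact: span_over0.
(* The factor [t^m] is there because [iota (psi e)] need not lie in the lattice itself when
   [tau n = t^n]. Validity for all large [m] lets the property pass to sums; on the kernel of [psi]
   it gives the claim. *)
pose K e := X e /\ exists N, forall m, (N <= m)%N ->
    exists2 y, X y & lp 'X^m *: iota (psi e) - e = lp t1 *: y.
have key e : X e -> K e.
  apply: span_over_sub e => [|a e e' [Xe [N hN]] [Xe' [N' hN']]|_ [n [x [Gx ->]]]].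
  - split; first exact: span_over0.
    exists 0%N => m _; exists 0; first exact: span_over0.
    by rewrite (is_add0 pD) (is_add0 (slin_add li)) scaler0 subrr scaler0.
  - split; first exact: span_over_lin.
    exists (maxn N N') => m; rewrite geq_max => /andP[/hN[y Xy ey] /hN'[y' Xy' ey']].
    have [q eq] := poly_sub_at1 a.
    exists (lp (a.[1])%:P *: y + (lp (- q) *: e + y')).
      by do 2!apply: span_over_lin => //.
    rewrite pD pZ (slin_add li) (slinZ li) scalerDr opprD addrACA ey'.
    have -> : laurent_const k (laurent_ev (lp a)) = lp (a.[1])%:P by rewrite laurent_ev_poly.
    rewrite !scalerDr addrA; congr (_ + _).
    rewrite [X in _ = X + _]scalerA [lp t1 * _]mulrC -[X in _ = X + _]scalerA -ey scalerBr.
    rewrite !scalerA [lp 'X^m * _]mulrC -addrA; congr (_ + _).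
    rewrite {1}eq rmorphD rmorphM /= rmorphN mulrN scaleNr scalerDl opprD.
    by [].
  - split; first by apply: span_over_mem; exists n, x.
    have [N hN] := tauX n; exists N => m /hN[q eq].
    exists (lp q *: (tau n *: iota x)).
      by apply: XZ; apply: span_over_mem; exists n, x.
    have -> : psi (tau n *: iota x) = x.
      by rewrite pZ psii -[RHS]scale1r; congr (_ *: _); exact: tau_ev.
    rewrite eq scalerDl [X in X - _]addrC addrK !scalerA.
    by rewrite rmorphM -mulrA.
move=> pz; have [|_ [N hN]] := key (i z); first by rewrite /X -ranX; exists z.
have [y Xy] := hN N (leqnn _); move: Xy; rewrite /X -ranX pz => -[y0 _ <-].
rewrite (is_add0 (slin_add li)) scaler0 add0r => e.
exists (- y0); apply: inji; rewrite (slinZ lhi) (is_addN (slin_add lhi)) scalerN -e opprK.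
by [].
Qed.

End Evaluation.

End AtOne.

(** * The two constructions *)

Section Assembly.
Variable k : fieldType.
Local Notation R := {poly k}.
Local Notation ev := (horner_eval (1 : k)).
Local Notation t1 := ('X - 1%:P : {poly k}).
Local Notation lp := (@laurent_poly k).
Local Notation T n := (laurent_inv k n).
Local Notation at1_ideal := [set z | exists y, z = t1 *: y].

Lemma laurent_inv_at1 n : exists N, forall m, (N <= m)%N ->
  exists q, lp 'X^m = T n + lp (t1 * q) * T n.
Proof.
exists 0%N => m _; have [q eq] := Xn_sub_at1 k (m + n); exists q.
rewrite -[T n in X in X + _]mul1r -mulrDl -(rmorph1 lp) -rmorphD -eq exprD rmorphM -mulrA.
by rewrite laurent_invK mulr1.
Qed.

Lemma laurent_Xn_at1 n : exists N, forall m, (N <= m)%N ->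
  exists q, lp 'X^m = lp 'X^n + lp (t1 * q) * lp 'X^n.
Proof.
exists n => m le; have [q eq] := Xn_sub_at1 k (m - n); exists q.
by rewrite -rmorphM -rmorphD -[X in X + _]mul1r -mulrDl -eq -exprD subnK.
Qed.

Lemma laurent_ev_Xn n : laurent_ev (lp 'X^n) = 1.
Proof. by rewrite laurent_ev_poly hornerXn expr1n. Qed.

(** Compatibility with antipodes is automatic, by their uniqueness. *)
Lemma hopf_transport (Q V : bialgebra k) (phi : Q -> V) : bialg_iso phi -> hopf_iso phi.
Proof.
by move=> hphi; split=> // SA SB hA hB x; case: hphi => hp _; exact: (antipode_hom hp).
Qed.

Lemma hopf_at1 (H : bialgebra R) (Q : bialgebra k) : is_at1 H Q -> is_hopf H -> is_hopf Q.
Proof.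
move=> [p hp] [S hS]; apply: (hopf_quotient hp hS); last exact: ev_surj.
by move=> _ [y ->]; exists (S y); case: hS => lS _ _; rewrite (slinZ (f := idfun) lS).
Qed.

Lemma hopf_drinfeld_prime (M H : bialgebra R) : is_drinfeld_prime M H -> is_hopf M -> is_hopf H.
Proof.
move=> [i hi] [S hS]; apply: (hopf_sub hi hS) => // b hb n.
have [F lF hF] := delta_antipode n hS; have [u eu] := hb n.
by exists (F u); rewrite hF eu (slinZ lF).
Qed.

Section RationalSpan.
Variables (R0 : comNzRingType) (K : idomainType).
Variables (g : {rmorphism R0 -> K}) (f : {rmorphism R -> K}).
Variables (A : bialgebra R0) (E : bialgebra K) (iota : A -> E) (X : bialgebra R) (i : X -> E).
Variables (tau : nat -> K) (G : nat -> set A).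
Hypothesis bc : is_base_change g iota.
Hypothesis hi : is_sub f i (span_over f [set z | exists n x, G n x /\ z = tau n *: iota x]).
Hypotheses (injf : injective f) (GS : forall S n x, antipode S -> G n x -> G n (S x)).

(** The antipode of [A] extends linearly to [E], so preserving each [G n] is enough for it to
    preserve the span. *)
Lemma hopf_filtered_span : is_hopf A -> is_hopf X.
Proof.
move=> [SA hSA]; have [SE hSE SEi] := hopf_base_change bc hSA.
have lS : slinear idfun SE by case: hSE.
apply: (hopf_sub hi hSE) => //.
apply: span_over_sub => [|a x y hx hy|_ [n [x [Gx ->]]]] /=.
- by rewrite (is_add0 (slin_add lS)); exact: span_over0.
- by rewrite lS; exact: span_over_lin.
- rewrite (slinZ lS) SEi; apply: span_over_mem; exists n, (SA x); split=> //.
  exact: GS hSA Gx.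
Qed.

End RationalSpan.

(** * The fibre of the Drinfeld prime of [B^∨_t] *)

Section VeePart.
Variables (B V : bialgebra k) (Vt H : bialgebra R).
Hypotheses (hV : is_vee B V) (hVt : is_vee_t V Vt) (hH : is_drinfeld_prime Vt H).
Local Notation Jn := (ideal_exp (@aug_ideal k V)).

Lemma vee_hopf : is_hopf B -> [/\ is_hopf V, is_hopf Vt & is_hopf H].
Proof.
move=> [S hS]; have [pi hpi] := hV.
have hfV : is_hopf V.
  apply: (hopf_quotient hpi hS); last by move=> s; exists s.
  by move=> x Ix n _; apply: ideal_exp_antipode => //; exact: Ix.
have hfVt : is_hopf Vt.
  have [E [iota [i [bc hi]]]] := hVt.
  apply: (hopf_filtered_span bc hi) => //; first exact: laurent_poly_inj.
  by move=> S' n x hS'; exact: ideal_exp_antipode.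
by split=> //; exact: (hopf_drinfeld_prime hH).
Qed.

(* [V[t]] lies in the Drinfeld prime of [V_t], because [delta n x] is a sum of
   tensors of elements of [J = t (t^-1 J)]. *)
Lemma vee_at1 : exists q : H -> V, is_quotient ev q at1_ideal.
Proof.
have [E [iota [i [bc hi]]]] := hVt; have [hiota _] := bc.
have [hhi inji ranX] := hi; have lhi := bialg_hom_slin hhi.
have tfE := base_change_torsion_free bc.
have inX n x : Jn n x -> exists y, i y = T n *: iota x.
  move=> Jx; have : span_over lp [set z | exists n x, Jn n x /\ z = T n *: iota x] (T n *: iota x).
    by apply: span_over_mem; exists n, x.
  by rewrite -ranX => -[y _ <-]; exists y.
have iX x : span_over lp [set z | exists n x, Jn n x /\ z = T n *: iota x] (iota x).
  by apply: span_over_mem; exists 0%N, x; rewrite laurent_inv0 scale1r.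
have [j hj ij] := bialg_hom_factor (g := polyC) (h := laurent_const k) (@euclid_poly k)
  (localizing_laurent k) tfE hi (fun=> erefl) hiota iX.
have lj := bialg_hom_slin hj.
have [psi hpsi psii] := evaluation_exists bc.
have qVt : is_quotient ev (psi \o i) at1_ideal.
  split.
  - exact: (at1_hom hi hpsi).
  - by apply/seteqP; split=> // x _; exists (j x) => //=; rewrite ij psii.
  - exact: (at1_kernel bc hi (@laurent_ev_inv k) laurent_inv_at1 hpsi psii).
have [iH [hhiH injH ranH]] := hH.
have jH x : drinfeld_set (j x).
  move=> m; elim: m x => [|m IH] x; first by exists (eps (j x) : R^o); rewrite expr0 scale1r.
  rewrite deltaS (sw_hom hj); last first.
    exact: (balanced_slin (@augm_slin _ Vt) (@delta_slin _ Vt m) (pure_balanced _ _)).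
  pose D := [set w : tpow Vt m.+1 | exists u, w = 'X^(m.+1) *: u].
  have hD : submod D.
    split=> [|a _ _ [z ->] [z' ->]]; first by exists 0; rewrite scaler0.
    by exists (a *: z + z'); rewrite scalerDr !scalerA mulrC.
  rewrite -[exists _, _]/(D _); apply: (submod_sum hD) => p _ _.
  have [u eu] := IH p.2.
  have [y ey] := inX 1%N (augm p.1) (ideal_exp1 (eps_augm p.1)).
  exists (pure y u); rewrite eu pureZr exprSr -scalerA -(pureZl 'X y u); congr (_ *: pure _ _).
  apply: inji; rewrite -(augm_hom hj) ij (slinZ lhi) ey scalerA.
  by rewrite [X in _ = X *: _](laurent_invK k 1) scale1r.
(* It remains to bring [v] into the Drinfeld prime by a power of [t]: clearing the [t^-n] of its
   finitely many terms leaves a [{poly k}]-combination of elements [j x]. *)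
exists ((psi \o i) \o iH); apply: at1_restrict => // v.
have lH := bialg_hom_slin hhiH.
have : exists n, exists2 x, i (iH x) = lp 'X^n *: i v & True; last first.
  move=> [n [x e _]]; exists n, x; apply: inji; by rewrite e (slinZ lhi).
have : span_over lp [set z | exists n x, Jn n x /\ z = T n *: iota x] (i v).
  by rewrite -ranX; exists v.
move: (i v); apply: span_over_sub => [|a x y [n [x' ex _]] [m [y' ey _]]|_ [n [x [_ ->]]]] /=.
- by exists 0%N, 0; rewrite // (is_add0 (slin_add lH)) (is_add0 (slin_add lhi)) scaler0.
- exists (n + m)%N, ((a * 'X^m) *: x' + 'X^n *: y') => //.
  rewrite lH lhi (slinZ lH) (slinZ lhi) ex ey scalerDr !scalerA -!rmorphM exprD.
  by congr (lp _ *: _ + _); rewrite -mulrA mulrC ['X^m * _]mulrC.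
- have [z _ ez] : range iH (j x) by rewrite ranH; exact: jH.
  by exists n, z; rewrite // ez ij scalerA laurent_invK scale1r.
Qed.

End VeePart.

Lemma field_torsion_free (K : fieldType) (W : lmodType K) : torsion_free W.
Proof.
move=> a x e; case: (eqVneq a 0) => [|a0]; [by left | right].
by rewrite -(scale1r x) -(mulVf a0) -scalerA e scaler0.
Qed.

(** * The kernels [D n], [B'_t] and its fibre *)

Section PrimePart.
Variable B : bialgebra k.
Local Notation D := (Dker (A := B)).
Local Notation Dgens E iota := [set z : E | exists n x, D n x /\ z = lp 'X^n *: iota x].

Lemma Dker_le m n : (m <= n)%N -> D m `<=` D n.
Proof. by move=> le x /= h; apply: (delta_eq0_le _ h); rewrite ltnS. Qed.

Lemma Dker_submod n : submod (D n).
Proof.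
have l := @delta_slin _ B n.+1; split=> [|a x y Dx Dy]; rewrite /Dker /=.
  exact: (is_add0 (slin_add l)).
by rewrite l Dx Dy scaler0 addr0.
Qed.

Lemma Dker_bigcup_submod : submod (\bigcup_n D n).
Proof.
split=> [|a x y [n _ Dx] [m _ Dy]]; first by exists 0%N => //; case: (Dker_submod 0).
exists (maxn n m) => //; case: (Dker_submod (maxn n m)) => _; apply.
  exact: (Dker_le (leq_maxl _ _)).
exact: (Dker_le (leq_maxr _ _)).
Qed.

Lemma Dker_antipode S n x : antipode S -> D n x -> D n (S x).
Proof.
move=> hS Dx; have [F lF hF] := delta_antipode n.+1 hS.
by rewrite /Dker /= hF Dx (is_add0 (slin_add lF)).
Qed.

Section PolynomialModel.
Variables (M : bialgebra R) (j : B -> M).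
Hypothesis bcM : is_base_change polyC j.

Let hj : bialg_hom polyC j. Proof. by case: bcM. Qed.
Let lj := bialg_hom_slin hj.

Lemma poly_model_split : locally_split M.
Proof. exact: (locally_split_base_change bcM (@locally_split_field _ _)). Qed.

(** A lower bound [N] in place of an exact length lets expansions of different lengths be added. *)
Lemma poly_model_expand b : exists (x : nat -> B) N, forall n, (N <= n)%N ->
  b = \sum_(a < n) 'X^a *: j (x a).
Proof.
elim/(base_change_ind bcM): b => [p x|u v [x [N hN]] [y [N' hN']]].
  exists (fun a => p`_a *: x), (size p) => n le.
  transitivity (\sum_(a < n) (p`_a *: 'X^a) *: j x); last first.
    by apply: eq_bigr => a _; rewrite (slinZ lj) scalerA -mul_polyC mulrC.
  rewrite -scaler_suml; congr (_ *: _); rewrite -poly_def; apply/polyP => a.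
  by rewrite coef_poly; case: ltnP => // le'; rewrite nth_default // (leq_trans le).
exists (fun a => x a + y a), (maxn N N') => n; rewrite geq_max => /andP[/hN -> /hN' ->].
by rewrite -big_split; apply: eq_bigr => a _; rewrite (slin_add lj) scalerDr.
Qed.

(** Coefficients of powers of [t] in a tensor power of [B[t]] are read off by functionals: [nut] is
    compatible with [nu], and [nu] detects the given [z]. *)
Lemma tpow_functional n (z : tpow B n) : z <> 0 ->
  exists (nu : tpow B n -> k^o) (nut : tpow M n -> R^o),
  [/\ slinear idfun nu, slinear idfun nut, nu z <> 0
    & forall w, nut (tpow_hom polyC j w) = (nu w)%:P].
Proof.
elim: n z => [|n IH] z z0; first by exists idfun, idfun.
have [I [e [l [ll le hl]]]] := locally_split_field (map fst (tens_repr z)).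
pose c i (u : tpow B n.+1) : tpow B n := tens_fold (fun x w => (l i x : k) *: w) u.
have cB i : balanced (fun x (w : tpow B n) => (l i x : k) *: w).
  split=> [x1 x2 w|x w1 w2|a x w]; first by rewrite (slin_add (ll i)) scalerDl.
    by rewrite scalerDr.
  by rewrite (slinZ (ll i)) !scalerA mulrC.
have cl i : slinear idfun (c i).
  by apply: tens_fold_slin => // a x w; rewrite (slinZ (ll i)) -scalerA.
have zE : z = \sum_i (pure (e i) (c i z) : tpow B n.+1).
  rewrite [LHS]tens_sum_pure /c /tens_fold.
  under [RHS]eq_bigr do rewrite (is_add_sum (pure_addr _)).
  rewrite exchange_big !big_seq; apply: eq_bigr => p pz.
  rewrite {1}(hl p.1); last exact: map_f.
  rewrite (is_add_sum (pure_addl _)); apply: eq_bigr => i _.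
  by rewrite pureZl pureZr.
have [i ci0] : exists i, c i z <> 0.
  apply: contrapT => /forallNP h; apply: z0; rewrite zE big1 // => i _.
  by have /contrapT -> := h i; rewrite pure0r.
have [nu [nut [lnu lnut nuz hnu]]] := IH _ ci0.
have [|L lL hL] := @base_change_lift _ _ _ _ _ _ bcM R^o (fun x => (l i x)%:P).
  by move=> a x y; rewrite ll polyCD polyCM.
pose ct (u : tpow M n.+1) : tpow M n := tens_fold (fun m w => (L m : R) *: w) u.
have ctB : balanced (fun m (w : tpow M n) => (L m : R) *: w).
  split=> [x1 x2 w|x w1 w2|a x w]; first by rewrite (slin_add lL) scalerDl.
    by rewrite scalerDr.
  by rewrite (slinZ lL) !scalerA mulrC.
have ctl : slinear idfun ct.
  by apply: tens_fold_slin => // a x w; rewrite (slinZ lL) -scalerA.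
exists (nu \o c i), (nut \o ct); split=> //.
- by move=> a u v /=; rewrite cl lnu.
- by move=> a u v /=; rewrite ctl lnut.
have lh := tpow_hom_slin hj.
have e1 : is_add (fun w => nut (ct (tpow_hom polyC j (w : tpow B n.+1)))).
  by move=> u v; rewrite (slin_add (lh n.+1)) (slin_add ctl) (slin_add lnut).
have e2 : is_add (fun w : tpow B n.+1 => (nu (c i w))%:P).
  by move=> u v; rewrite (slin_add (cl i)) (slin_add lnu) polyCD.
apply: (tens_ext e1 e2) => x w /=.
rewrite (tens_map_pure lj (lh n)) /ct /c !tens_foldE // (slinZ lnut) (slinZ lnu) hL hnu.
by rewrite -[RHS]/((l i x * nu w)%:P) polyCM.
Qed.

(** For [b] the sum of the [t^a x_a], divisibility of [δ_(a+1) b] by [t^(a+1)] kills the coefficient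
    [δ_(a+1) x_a] of [t^a], which says that [x_a] is in [D a]. Conversely, for [x] in [D n],
    [t^n δ_m x] is zero when [m > n] and visibly divisible by [t^m] otherwise. *)
Lemma drinfeld_poly_model b : drinfeld_set b <->
  span_over idfun [set z | exists n x, D n x /\ z = 'X^n *: j x] b.
Proof.
split=> [Xb|]; last first.
  have [X0 Xl] := drinfeld_submod M.
  apply: span_over_sub => // _ [n [x [Dx ->]]] m.
  rewrite (slinZ (@delta_slin _ M m)) (delta_hom hj).
  have [le|lt] := leqP m n.
    exists ('X^(n - m) *: tpow_hom polyC j (delta m x)).
    by rewrite scalerA -exprD subnKC.
  exists 0; rewrite (delta_eq0_le lt Dx) (is_add0 (slin_add (tpow_hom_slin hj (n := m)))).
  by rewrite !scaler0.
have [x [N hN]] := poly_model_expand b.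
have Dx a : D a (x a).
  apply: contrapT => nD; have [nu [nut [lnu lnut nuz hnu]]] := tpow_functional nD.
  have [u eu] := Xb a.+1.
  (* Summation up to [maxn N a.+1] guarantees that the index [a] occurs. *)
  have := congr1 nut eu; rewrite (hN (maxn N a.+1)) ?leq_maxl //.
  rewrite (is_add_sum (slin_add (@delta_slin _ M a.+1))) (is_add_sum (slin_add lnut)).
  rewrite (slinZ lnut) => /(congr1 (fun p : R => p`_a)).
  rewrite -[_ *: nut u]/('X^(a.+1) * nut u) coefXnM ltnSn coef_sum.
  have lta : (a < maxn N a.+1)%N by rewrite leq_max ltnSn orbT.
  rewrite (bigD1 (Ordinal lta)) //= big1 => [|c ca]; last first.
    rewrite (slinZ (@delta_slin _ M a.+1)) (slinZ lnut) (delta_hom hj) hnu.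
    rewrite -[_ *: _]/('X^c * _) coefXnM coefC.
    case: ltnP => // le; rewrite subn_eq0; case: leqP => // le'.
    by case/eqP: ca; apply: val_inj; apply/eqP; rewrite eqn_leq le le'.
  rewrite addr0 (slinZ (@delta_slin _ M a.+1)) (slinZ lnut) (delta_hom hj) hnu.
  by rewrite -[_ *: _]/('X^a * _) coefXnM ltnn subnn coefC.
rewrite (hN N) //; apply: (big_ind (span_over idfun _)); first exact: span_over0.
  by move=> u v hu hv; rewrite -[u]scale1r; exact: (span_over_lin (f := idfun) 1).
by move=> a _; apply: span_over_mem; exists a, (x a).
Qed.

(** A coordinate functional of [B[t]], restricted to [B], extends to [E], and the extension takes at
    [F b] the value of the coordinate at [b]; thus [F b = 0] annihilates every coordinate. *)
Lemma poly_model_embed (E : bialgebra (laurent k)) (iota : B -> E) :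
  is_base_change (laurent_const k) iota ->
  exists F : M -> E, [/\ bialg_hom lp F, injective F & forall x, F (j x) = iota x].
Proof.
move=> bcE; have [hiota _] := bcE.
have [F hF Fj] := base_change_hom (g := lp) (h := laurent_const k) bcM (fun=> erefl) hiota.
have lF := bialg_hom_slin hF; exists F; split=> //.
suff F0 b : F b = 0 -> b = 0.
  move=> x y e; apply/eqP; rewrite -subr_eq0; apply/eqP/F0.
  by rewrite (is_addB (slin_add lF)) e subrr.
move=> Fb; have [I [e [l [ll _ /(_ _ (mem_head _ _)) ->]]]] := poly_model_split [:: b].
rewrite big1 // => i _; suff -> : l i b = 0 by rewrite scale0r.
have [|L lL hL] := @base_change_lift _ _ _ _ _ _ bcE (laurent k)^o (fun x => lp (l i (j x))).
  by move=> a x y; rewrite lj ll rmorphD rmorphM.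
apply: laurent_poly_inj; rewrite rmorph0.
have <- : L (F b) = lp (l i b); last by rewrite Fb (is_add0 (slin_add lL)).
elim/(base_change_ind bcM): {Fb} b => [p x|u v hu hv].
  by rewrite (slinZ lF) Fj (slinZ lL) hL (slinZ (ll i)) [in RHS]rmorphM.
by rewrite (slin_add lF) (slin_add lL) hu hv (slin_add (ll i)) rmorphD.
Qed.

End PolynomialModel.

Lemma prime_t_exists : exists Pt : bialgebra R, is_prime_t B Pt.
Proof.
have [E [iota bcE]] := base_change_exists (laurent_const k) B.
have [M [j bcM]] := base_change_exists polyC B.
have [F [hF injF Fj]] := poly_model_embed bcM bcE.
have lF := bialg_hom_slin hF.
have [H [iH [hiH injH ranH]]] := drinfeld_prime_exists (poly_model_split bcM).
exists H, E, iota, (F \o iH); split=> //; split.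
- exact: (bialg_hom_comp (f := idfun) (g := lp)).
- exact: inj_comp.
have ranF : span_over lp (Dgens E iota) = F @` (drinfeld_set (M := M)).
  apply/seteqP; split=> e.
    apply: span_over_sub e => [|a _ _ [b Xb <-] [c Xc <-]|_ [n [x [Dx ->]]]].
    - exists 0; first by case: (drinfeld_submod M).
      exact: (is_add0 (slin_add lF)).
    - exists (a *: b + c); last by rewrite lF.
      by case: (drinfeld_submod M) => _; apply.
    - exists ('X^n *: j x); last by rewrite (slinZ lF) Fj.
      by apply/(drinfeld_poly_model bcM); apply: span_over_mem; exists n, x.
  move=> [b /(drinfeld_poly_model bcM) Xb <-]; move: b Xb.
  apply: span_over_sub => [|a b c hb hc|_ [n [x [Dx ->]]]] /=.
  - by rewrite (is_add0 (slin_add lF)); exact: span_over0.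
  - by rewrite lF; exact: span_over_lin.
  - by rewrite (slinZ lF) Fj; apply: span_over_mem; exists n, x.
rewrite ranF; apply/seteqP; split=> [_ [x _ <-]|_ [b Xb <-]].
  exists (iH x) => //; have : range iH (iH x) by [exists x]; by rewrite ranH.
by have [x _ <-] : range iH b by [rewrite ranH]; exists x.
Qed.

Section PrimeModels.
Variable Pt : bialgebra R.
Hypothesis hPt : is_prime_t B Pt.

(** The target is [B] and not a model of [B']: the range found here is what shows that such a model
    exists. *)
Lemma prime_t_at1 : exists psi : Pt -> B, [/\ bialg_hom ev psi,
  range psi = \bigcup_n D n & [set z | psi z = 0] = at1_ideal].
Proof.
have [E [iota [i [bc hi]]]] := hPt; have [hhi inji ranX] := hi.
have [psi hpsi psii] := evaluation_exists bc.
have lpsi := bialg_hom_slin hpsi.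
exists (psi \o i); split; [exact: (at1_hom hi hpsi) | |].
  apply/seteqP; split=> [_ [z _ <-]|x [n _ Dx]].
    have : span_over lp (Dgens E iota) (i z) by rewrite -ranX; exists z.
    rewrite /comp; move: (i z); have [U0 Ul] := Dker_bigcup_submod.
    apply: span_over_sub => [|a u v hu hv|_ [n [x [Dx ->]]]] /=.
    - by rewrite (is_add0 (slin_add lpsi)).
    - by rewrite lpsi; exact: Ul.
    - rewrite (slinZ lpsi) psii; apply: submodZ; first exact: Dker_bigcup_submod.
      by exists n.
  have : span_over lp (Dgens E iota) (lp 'X^n *: iota x) by apply: span_over_mem; exists n, x.
  rewrite -ranX => -[z _ ez]; exists z => //=; rewrite ez (slinZ lpsi) psii.
  by rewrite [X in X *: _]laurent_ev_Xn scale1r.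
exact: (at1_kernel bc hi laurent_ev_Xn laurent_Xn_at1 hpsi psii).
Qed.

Lemma prime_quotient P : is_prime B P -> exists q : Pt -> P, is_quotient ev q at1_ideal.
Proof.
move=> [iP hiP]; have [hhi inji ranP] := hiP.
have [psi [hpsi ranpsi kerpsi]] := prime_t_at1.
have [|q hq qE] := bialg_hom_factor (g := ev) (h := ev) (@euclid_field k) (localizing_id k)
  (@field_torsion_free _ _) hiP (fun=> erefl) hpsi.
  by move=> c; rewrite -ranpsi; exists c.
exists q; split=> //.
  apply/seteqP; split=> // x _; have [z _ ez] : range psi (iP x).
    by rewrite ranpsi -ranP; exists x.
  by exists z => //; apply: inji; rewrite qE.
rewrite -kerpsi; apply/seteqP; split=> z /=; rewrite -qE; last move=> e.
  by move=> ->; exact: (is_add0 (slin_add (bialg_hom_slin hhi))).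
by apply: inji; rewrite e (is_add0 (slin_add (bialg_hom_slin hhi))).
Qed.

Lemma prime_exists : exists P : bialgebra k, is_prime B P.
Proof.
have [psi [hpsi ranpsi _]] := prime_t_at1.
have [P [i hi]] := sub_bialgebra_exists (@euclid_field k) (localizing_id k)
  (@field_torsion_free _ _) (range_sub_bialg_closed hpsi (@ev_surj k)).
by exists P, i; rewrite -ranpsi.
Qed.

Lemma prime_t_torsion_free : torsion_free Pt.
Proof.
have [E [iota [i [bc [hi inji _]]]]] := hPt; have li := bialg_hom_slin hi.
move=> a x /(congr1 i); rewrite (slinZ li) (is_add0 (slin_add li)).
case/(base_change_torsion_free bc) => [la|ix]; [left|right].
  by apply: laurent_poly_inj; rewrite rmorph0.
by apply: inji; rewrite ix (is_add0 (slin_add li)).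
Qed.

End PrimeModels.

Lemma prime_hopf P Pt : is_prime B P -> is_prime_t B Pt -> is_hopf B -> is_hopf P /\ is_hopf Pt.
Proof.
move=> [iP hiP] [E [iota [i [bc hi]]]] hfB; split; last first.
  apply: (hopf_filtered_span bc hi) => //; first exact: laurent_poly_inj.
  by move=> S n x hS; exact: Dker_antipode.
have [S hS] := hfB; apply: (hopf_sub hiP hS) => //.
by move=> x [n _ Dx]; exists n => //; exact: Dker_antipode.
Qed.

End PrimePart.

(** * The bialgebra [H^∨] over [k[t]] and its fibre *)

Section DrinfeldVee.
Variable A : bialgebra R.
Local Notation frac := (@tofrac R).
Local Notation Jn := (ideal_exp (@aug_ideal R A)).
Local Notation Jgens F iota := [set z : F | exists n x, Jn n x /\ z = (frac 'X^n)^-1 *: iota x].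

Lemma drinfeld_vee_exists : exists Hv : bialgebra R, is_drinfeld_vee A Hv.
Proof.
have [F [iota bc]] := base_change_exists frac A; have [hiota _] := bc.
have hX := filtered_span_closed (f := frac) (tau := fun n => (frac 'X^n)^-1) hiota
  (ideal_exp_filtration A).
have [|i j|x|Hv [i hi]] := sub_bialgebra_exists (@euclid_poly k) (@localizing_tofrac R)
  (@field_torsion_free _ _) (hX _ _ _).
- by rewrite expr0 rmorph1 invr1.
- by rewrite exprD rmorphM invfM.
- by exists (eps x).
by exists Hv, F, iota, i.
Qed.

Lemma hopf_drinfeld_vee Hv : is_drinfeld_vee A Hv -> is_hopf A -> is_hopf Hv.
Proof.
move=> [F [iota [i [bc hi]]]]; apply: (hopf_filtered_span bc hi).
  exact: (proj1 (@localizing_tofrac R)).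
by move=> S n x hS; exact: ideal_exp_antipode.
Qed.

Lemma drinfeld_vee_at1 Hv (P : bialgebra k) (p : A -> P) :
  torsion_free A -> is_drinfeld_vee A Hv -> is_quotient ev p at1_ideal ->
  exists q : Hv -> P, is_quotient ev q at1_ideal.
Proof.
move=> tf [F [iota [i [bc hi]]]] hp; have [hiota _] := bc.
have [hhi inji ranX] := hi; have lhi := bialg_hom_slin hhi.
have liota := bialg_hom_slin hiota.
have iX x : span_over frac (Jgens F iota) (iota x).
  by apply: span_over_mem; exists 0%N, x; rewrite expr0 rmorph1 invr1 scale1r.
have [j hj ij] := bialg_hom_factor (g := idfun) (h := frac) (@euclid_poly k)
  (@localizing_tofrac R) (@field_torsion_free _ _) hi (fun=> erefl) hiota iX.
(* By torsion-freeness some functional into the rational functions takes the value 1 at a given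
   nonzero [x]; it extends to [F], so [iota x] cannot vanish. *)
have injiota x : iota x = 0 -> x = 0.
  move=> e; apply: contrapT => x0.
  have [|a /tf[]//|lam [llam _ lam1]] :=
    exists_functional (proj1 (@localizing_tofrac R)) (N := [set 0 : A]) (x0 := x).
    by split=> // a y z -> ->; rewrite scaler0 addr0.
  have [L lL hL] := @base_change_lift _ _ _ _ _ _ bc {fraction R}^o lam llam.
  have := hL x; rewrite e (is_add0 (slin_add lL)) lam1 => /esym/eqP.
  by rewrite oner_eq0.
apply: (at1_extend hp hj).
  move=> x y /(congr1 i); rewrite !ij => e; apply/eqP; rewrite -subr_eq0; apply/eqP/injiota.
  by rewrite (is_addB (slin_add liota)) e subrr.
move=> c; have : exists n, exists2 y, iota y = frac 'X^n *: i c & True; last first.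
  by move=> [n [y e _]]; exists n, y; apply: inji; rewrite ij e (slinZ lhi).
have : span_over frac (Jgens F iota) (i c) by rewrite -ranX; exists c.
move: (i c); apply: span_over_sub => [|a x y [n [x' ex _]] [m [y' ey _]]|_ [n [x [_ ->]]]] /=.
- by exists 0%N, 0; rewrite // (is_add0 (slin_add liota)) scaler0.
- exists (n + m)%N, ((a * 'X^m) *: x' + 'X^n *: y') => //.
  rewrite liota (slinZ liota) ex ey scalerDr !scalerA -!rmorphM exprD.
  by congr (frac _ *: _ + _); rewrite -mulrA mulrC ['X^m * _]mulrC.
- by exists n, x; rewrite // scalerA mulfV ?tofracXn_neq0 // scale1r.
Qed.

End DrinfeldVee.

End Assembly.

(** * Existence of the models and the duality theorem *)

Lemma at1_iso (k : fieldType) (H : bialgebra {poly k}) (Q V : bialgebra k) (q : H -> V) :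
  is_at1 H Q -> is_quotient (horner_eval (1 : k)) q [set z | exists y, z = ('X - 1%:P) *: y] ->
  exists phi : Q -> V, bialg_iso phi.
Proof. by move=> [p hp] hq; exact: (quotient_unique (@ev_surj k) hp hq). Qed.

Lemma vee_prime_exists (k : fieldType) (B : bialgebra k) :
  exists (V : bialgebra k) (Vt H : bialgebra {poly k}) (Q : bialgebra k),
    [/\ is_vee B V, is_vee_t V Vt, is_drinfeld_prime Vt H & is_at1 H Q].
Proof.
have [V hV] := vee_exists B; have [E [iota bc]] := base_change_exists (laurent_const k) V.
have sep (x : V) := vee_separated (x := x) hV.
have filt := ideal_exp_filtration V.
have [Vt [i hi]] := rees_exists filt bc.
have hVt : is_vee_t V Vt by exists E, iota, i.
have [H hH] := drinfeld_prime_exists (rees_locally_split filt (@ideal_expS _ _) sep bc hi).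
have [q hq] := vee_at1 hVt hH.
(* [V] is itself a model of the fibre, presented by [q]. *)
by exists V, Vt, H, V; split=> //; exists q.
Qed.

Lemma prime_vee_exists (k : fieldType) (B : bialgebra k) :
  exists (P : bialgebra k) (Pt H : bialgebra {poly k}) (Q : bialgebra k),
    [/\ is_prime B P, is_prime_t B Pt, is_drinfeld_vee Pt H & is_at1 H Q].
Proof.
have [Pt hPt] := prime_t_exists B; have [P hP] := prime_exists hPt.
have [H hH] := drinfeld_vee_exists Pt.
have [p hp] := prime_quotient hPt hP.
have [q hq] := drinfeld_vee_at1 (prime_t_torsion_free hPt) hH hp.
by exists P, Pt, H, P; split=> //; exists q.
Qed.

(** The objects are given by predicates, so each half asserts that models exist, which keeps the
    rest from being vacuous, and that the isomorphism holds for every choice of models. In the Hopf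
    case the existence of antipodes on all of them is part of the conclusion. *)
Theorem proposition5p3 (k : fieldType) (B : bialgebra k) :
  ((exists (V : bialgebra k) (Vt H : bialgebra {poly k}) (Q : bialgebra k),
      [/\ is_vee B V, is_vee_t V Vt, is_drinfeld_prime Vt H & is_at1 H Q])
   /\
   (forall (V : bialgebra k) (Vt H : bialgebra {poly k}) (Q : bialgebra k),
      is_vee B V -> is_vee_t V Vt -> is_drinfeld_prime Vt H -> is_at1 H Q ->
      (exists phi : Q -> V, bialg_iso phi)
      /\
      (is_hopf B ->
        [/\ is_hopf V, is_hopf Vt, is_hopf H & is_hopf Q]
        /\ (exists phi : Q -> V, hopf_iso phi))))
  /\
  ((exists (P : bialgebra k) (Pt H : bialgebra {poly k}) (Q : bialgebra k),
      [/\ is_prime B P, is_prime_t B Pt, is_drinfeld_vee Pt H & is_at1 H Q])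
   /\
   (forall (P : bialgebra k) (Pt H : bialgebra {poly k}) (Q : bialgebra k),
      is_prime B P -> is_prime_t B Pt -> is_drinfeld_vee Pt H -> is_at1 H Q ->
      (exists phi : Q -> P, bialg_iso phi)
      /\
      (is_hopf B ->
        [/\ is_hopf P, is_hopf Pt, is_hopf H & is_hopf Q]
        /\ (exists phi : Q -> P, hopf_iso phi)))).
Proof.
split; split; [exact: vee_prime_exists | | exact: prime_vee_exists |].
- move=> V Vt H Q hV hVt hH hQ.
  have [q hq] := vee_at1 hVt hH; have [phi hphi] := at1_iso hQ hq.
  split; first by exists phi.
  move=> hB; have [hfV hfVt hfH] := vee_hopf hV hVt hH hB.
  split; first by split=> //; exact: (hopf_at1 hQ).
  by exists phi; exact: hopf_transport.
- move=> P Pt H Q hP hPt hH hQ.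
  have [p hp] := prime_quotient hPt hP.
  have [q hq] := drinfeld_vee_at1 (prime_t_torsion_free hPt) hH hp.
  have [phi hphi] := at1_iso hQ hq.
  split; first by exists phi.
  move=> hB; have [hfP hfPt] := prime_hopf hP hPt hB.
  have hfH := hopf_drinfeld_vee hH hfPt.
  split; first by split=> //; exact: (hopf_at1 hQ).
  by exists phi; exact: hopf_transport.
Qed.
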